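(* There is a $2$-degenerate graph $G$ with $\bar{\mathsf a}(G)\ge \bar\theta(G)\ge 3$, where $\bar\theta(G)$ denotes the geometric thickness and $\bar{\mathsf a}(G)$ the geometric arboricity of $G$.
   Context: Graphs are finite and simple. A graph is $2$-degenerate if every subgraph (with at least one vertex) contains a vertex of degree at most $2$ in that subgraph. A geometric drawing of a graph places the vertices at distinct points of the plane and draws each edge as the straight-line segment between its endpoints, such that no edge contains a vertex in its interior. Two edges cross if they share a point that is interior to both; a crossing in an edge-colored drawing is monochromatic if the two crossing edges have the same color. The geometric thickness $\bar\theta(G)$ is the smallest number of colors for which there is a geometric drawing of $G$ together with an edge coloring with that many colors and with no monochromatic crossing. The geometric arboricity $\bar{\mathsf a}(G)$ is the smallest number of colors for which there is a geometric drawing of $G$ together with an edge coloring with that many colors, with no monochromatic crossing, and such that every color class is acyclic (a forest). *)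

(* Defs.v *)
From HB Require Import structures.
From mathcomp Require Import all_boot all_order all_algebra.
From mathcomp Require Import boolp reals.
From mathcomp Require Import ring lra.

Set Implicit Arguments.
Unset Strict Implicit.
Unset Printing Implicit Defensive.

Import Order.TTheory GRing.Theory Num.Theory.
Local Open Scope ring_scope.

Record sgraph := SGraph {
  vertex :> finType;
  adj : rel vertex;
  adj_sym : symmetric adj;
  adj_irrefl : irreflexive adj }.

Section Graphs.
Variable G : sgraph.
Implicit Types (A E : {set G}) (F : {set {set G}}).

Definition edges : {set {set G}} :=
  [set E | [exists x : G, exists y : G, adj x y && (E == [set x; y])]].

(* Subgraphs need not be induced. *)
Definition is_subgraph A F : Prop :=
  F \subset edges /\ forall E, E \in F -> E \subset A.

Definition degree_in F (v : G) : nat := #|[set E in F | v \in E]|.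

Definition degenerate (d : nat) : Prop :=
  forall A F, is_subgraph A F -> A != set0 ->
    exists2 v, v \in A & (degree_in F v <= d)%N.

Definition acyclic F : Prop :=
  forall s : seq G, (3 <= size s)%N -> ~ ucycle (fun x y => [set x; y] \in F) s.

Definition color_class (c : {set G} -> nat) (i : nat) : {set {set G}} :=
  [set E in edges | c E == i].

(* The values of [c] outside [edges] are irrelevant. *)
Definition edge_coloring (k : nat) (c : {set G} -> nat) : Prop :=
  forall E, E \in edges -> (c E < k)%N.

End Graphs.

Section Drawings.
Variables (R : realType) (G : sgraph).
Implicit Types (pos : G -> 'rV[R]_2) (E : {set G}) (p : 'rV[R]_2).

Definition edge_interior pos E p : Prop :=
  exists x y t, [/\ E = [set x; y], 0 < t < 1
                  & p = (1 - t) *: pos x + t *: pos y].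

Definition geometric_drawing pos : Prop :=
  injective pos /\
  forall E, E \in edges G -> forall w : G, ~ edge_interior pos E (pos w).

Definition cross pos E1 E2 : Prop :=
  E1 <> E2 /\ exists p, edge_interior pos E1 p /\ edge_interior pos E2 p.

Definition no_monochromatic_crossing pos (c : {set G} -> nat) : Prop :=
  forall E1 E2, E1 \in edges G -> E2 \in edges G ->
    cross pos E1 E2 -> c E1 <> c E2.

Definition thickness_colorable (k : nat) : Prop :=
  exists pos c, [/\ geometric_drawing pos, edge_coloring k c
                  & no_monochromatic_crossing pos c].

Definition arboricity_colorable (k : nat) : Prop :=
  exists pos c, [/\ geometric_drawing pos, edge_coloring k c,
                    no_monochromatic_crossing pos c
                  & forall i, acyclic (color_class c i)].

(* Vertices on a parabola, every edge with its own color. *)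
Lemma arboricity_colorable_edges : arboricity_colorable #|edges G|.
Proof.
pose r (v : G) : R := (enum_rank v : nat)%:R.
pose pos v : 'rV[R]_2 := \row_(j < 2) r v ^+ j.+1.
pose c E := index E (enum (edges G)).
have r_inj : injective r.
  by move=> x y /eqP; rewrite eqr_nat => /eqP/val_inj/enum_rank_inj.
have c_inj E1 E2 : E1 \in edges G -> E2 \in edges G -> c E1 = c E2 -> E1 = E2.
  by move=> h1 h2; apply: (index_inj E1); rewrite mem_enum.
exists pos, c; split.
- split.
    move=> x y /rowP/(_ ord0); rewrite !mxE !expr1; exact: r_inj.
  move=> E; rewrite inE => /existsP[a /existsP[b /andP[ab /eqP->]]] w.
  case=> x [y [t [Exy /andP[t0 t1] e]]].
  have xy : x != y.
    apply/eqP => exy; have: #|[set a; b]| = #|[set x; y]| by rewrite Exy.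
    rewrite !cards2 exy eqxx; case: eqP => // eab.
    by move: ab; rewrite eab adj_irrefl.
  have := congr1 (fun m : 'rV[R]_2 => m ord0 ord0) e.
  have := congr1 (fun m : 'rV[R]_2 => m ord0 ord_max) e.
  rewrite !mxE /= !expr1 => e2 e1.
  have : t * (1 - t) * (r x - r y) ^+ 2 = 0.
    have -> : t * (1 - t) * (r x - r y) ^+ 2 =
      ((1 - t) * r x ^+ 2 + t * r y ^+ 2) - ((1 - t) * r x + t * r y) ^+ 2.
      by ring.
    by rewrite -e1 -e2 subrr.
  move/eqP; rewrite !mulf_eq0 orbb !subr_eq0.
  rewrite (gt_eqF t0) (gt_eqF t1) /= => /eqP/r_inj exy.
  by rewrite exy eqxx in xy.
- by move=> E hE; rewrite cardE index_mem mem_enum.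
- by move=> E1 E2 h1 h2 [ne _] /c_inj; move=> /(_ h1 h2).
move=> i [|x [|y [|z s]]] //= _ /andP[/= /and3P[h1 h2 _]].
move: h1 h2; rewrite !(inE, negb_or) => /andP[h1 /eqP c1] /andP[h2 /eqP c2].
case/andP=> /and3P[xy xz _] _.
have: [set x; y] = [set y; z] by apply: c_inj; rewrite ?inE // c1 c2.
move/setP/(_ x); rewrite !inE eqxx /= (negbTE xy) (negbTE xz).
by [].
Qed.

Lemma ex_thickness_colorable : exists k, `[< thickness_colorable k >].
Proof.
exists #|edges G|; apply/asboolP.
by have [pos [c [h1 h2 h3 _]]] := arboricity_colorable_edges; exists pos, c.
Qed.

Lemma ex_arboricity_colorable : exists k, `[< arboricity_colorable k >].
Proof. by exists #|edges G|; apply/asboolP/arboricity_colorable_edges. Qed.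

Definition geometric_thickness : nat := ex_minn ex_thickness_colorable.

Definition geometric_arboricity : nat := ex_minn ex_arboricity_colorable.

End Drawings.

(* Main.v *)
Require Import Defs.
From HB Require Import structures.
From mathcomp Require Import all_boot all_order all_algebra.
From mathcomp Require Import boolp reals.
From mathcomp Require Import ring lra zify.

Set Implicit Arguments.
Unset Strict Implicit.
Unset Printing Implicit Defensive.

Import Order.TTheory GRing.Theory Num.Theory.
Local Open Scope ring_scope.

(** The vertices of the graph are the binary terms of bounded depth over a large
set of labelled leaves, and [Join x y] is adjacent to [x] and to [y]. A deepest
vertex of a subgraph has at most its two subterms as neighbours, so the graph is
2-degenerate. What makes it hard to draw is that any two vertices have a common
neighbour, and these have common neighbours again.

Suppose that there is a drawing with two colours, red and blue. A small
perturbation puts the points in general position without making edges of one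
colour cross ([perturbed]; disjoint segments are separated by a line). By Ramsey's
theorem ([homogeneous_drawing]) one may then assume that every orientation, every
colour, and the side of a line on which two segments meet depends only on the
relative order of the labels involved. The labels are split into two kinds,
written A and B, with independent orders.

The vertices A i, B j and W i j = Join (A i) (B j) form a drawing of K33 with one
bend on every edge. Paths of such a drawing cross an odd number of times in total
([K33_odd]), hence W i j is joined to A i and B j in different colours, say red
and blue, and, for suitable directions of the two orders, the red edge from A s to
W s t crosses the blue edge from B l to W i l if s < i and l < t, and does not
cross it if s < i and t < l. Two fans with centres on one side of a line cannot
meet it in alternation ([no_alternation]), so the fans cross each other in the
order of their labels. Thus the edges from A c to the last W c are red columns, the
edges from B r to the last W r are blue rows, and W s t lies in the cell where
column s meets row t ([W_in_cell]).

A red edge cannot cross a column and a blue edge cannot cross a row. Hence a vertex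
joined in red to a vertex in column c, and in blue to a vertex in row r, lies in
the cell (c, r), unless both edges leave the grid ([answer]); but two copies of a
vertex that leaves beyond a corner of the grid would each have to pass beyond the
other ([no_corner]). If both edges had the same colour, K33 would be drawn without
crossings ([two_colours]). So a common neighbour of two placed vertices takes the
column of the one and the row of the other ([request]): it moves vertically along
a red edge and horizontally along a blue one.

This freedom is too large. A red path of vertices that goes up twice, then comes
down below the first of these vertices, cannot afterwards rise above the second:
its last edge would be enclosed by a second copy of the path ([hook],
[no_winding]). The same holds upside down, and for blue paths sideways. By asking
for common neighbours of vertices in suitable relative positions, one forces a
vertex that ends such a path in red and such a path in blue. A common neighbour of
this vertex and a W far beyond both paths can be joined to it in neither colour
([winds_both]), which is a contradiction ([no_env]).

Exchanging the two kinds of leaves, the colours, and the coordinates is a symmetry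
([transpose]) that turns every fact on columns into one on rows. The geometric
tool used throughout is [strip]: a segment that crosses a strip is a barrier
for the segments within the strip. *)

(** * Segments and affine functions *)

Section Plane.
Variable R : realFieldType.
Notation pt := (R * R)%type.
Implicit Types (a b c d p q x y lo up : pt) (f g : pt -> R) (s t u : R).

Definition orient a b c : R :=
  (b.1 - a.1) * (c.2 - a.2) - (b.2 - a.2) * (c.1 - a.1).

Definition mix t a b : pt :=
  ((1 - t) * a.1 + t * b.1, (1 - t) * a.2 + t * b.2).

Definition inseg a b p := exists t, 0 < t < 1 /\ p = mix t a b.

Definition affine f := forall t a b, f (mix t a b) = (1 - t) * f a + t * f b.

Lemma affine_orient a b : affine (orient a b).
Proof. by move=> t c d; rewrite /orient /=; ring. Qed.

Lemma affineZ k f : affine f -> affine (fun p => k * f p).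
Proof. by move=> hf t a b; rewrite hf; ring. Qed.

Lemma mix0 a b : mix 0 a b = a.
Proof. by case: a => x y; rewrite /mix /=; congr pair; ring. Qed.

Lemma mix1 a b : mix 1 a b = b.
Proof. by case: b => x y; rewrite /mix /=; congr pair; ring. Qed.

Lemma mixC t a b : mix t a b = mix (1 - t) b a.
Proof. by rewrite /mix; congr pair; ring. Qed.

Lemma mix_mix s t u a b : mix s (mix t a b) (mix u a b) = mix ((1 - s) * t + s * u) a b.
Proof. by rewrite /mix /=; congr pair; ring. Qed.

Lemma insegC a b p : inseg a b p -> inseg b a p.
Proof.
by case=> t [/andP[t0 t1] ->]; exists (1 - t); rewrite -mixC; split=> //; lra.
Qed.

Lemma orientC a b c : orient b a c = - orient a b c.
Proof. by rewrite /orient; ring. Qed.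

Lemma orient_rot a b c : orient b c a = orient a b c.
Proof. by rewrite /orient; ring. Qed.

Lemma orient_l a b : orient a b a = 0.
Proof. by rewrite /orient; ring. Qed.

Lemma orient_r a b : orient a b b = 0.
Proof. by rewrite /orient; ring. Qed.

Lemma online a b p : a != b -> orient a b p = 0 -> exists u, p = mix u a b.
Proof.
case: a b p => [a1 a2] [b1 b2] [p1 p2]; rewrite xpair_eqE negb_and /orient /mix /=.
case: (eqVneq a1 b1) => [->|n1] /=.
  move=> n2 e; exists ((p2 - a2) / (b2 - a2)).
  have h: b2 - a2 != 0 by rewrite subr_eq0 eq_sym.
  have e1: p1 = b1.
    have : (b2 - a2) * (p1 - b1) = 0 by lra.
    by move/eqP; rewrite mulf_eq0 (negbTE h) subr_eq0 /= => /eqP.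
  by rewrite e1; congr pair; field.
move=> _ e; exists ((p1 - a1) / (b1 - a1)).
have h: b1 - a1 != 0 by rewrite subr_eq0 eq_sym.
congr pair; first by field.
apply: (mulfI h); transitivity ((b1 - a1) * a2 + (b2 - a2) * (p1 - a1)); last by field.
by lra.
Qed.

(** How collinear points are recognized as inner points of a segment: columns and
rows are segments, and all that is known of a point on their lines is its position
with respect to other lines. *)
Lemma on_seg f g lo up p : affine f -> affine g ->
  f lo < f up -> g lo < g up -> f lo < f p -> g p < g up ->
  orient lo up p = 0 -> inseg lo up p.
Proof.
move=> hf hg f1 g1 f2 g2 o0.
have ne: lo != up by apply/eqP => e; move: f1; rewrite e ltxx.
have [u e] := online ne o0; exists u; split=> //; move: f2 g2; rewrite e hf hg.
move=> f2 g2; have h1: 0 < u * (f up - f lo) by lra.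
have h2: 0 < (1 - u) * (g up - g lo) by lra.
move: h1 h2; rewrite !pmulr_lgt0 ?subr_gt0 // => -> h; lra.
Qed.

(** Both functions are increasing in the coordinate along the line, so that
positions on a line can be compared by whichever transversal line is at hand. *)
Lemma mono_line f g a b p q : affine f -> affine g ->
  f a < f b -> g a < g b -> orient a b p = 0 -> orient a b q = 0 ->
  f p < f q -> g p < g q.
Proof.
move=> hf hg f1 g1 op oq.
have ne: a != b by apply/eqP => e; move: f1; rewrite e ltxx.
have [u ->] := online ne op; have [v ->] := online ne oq; rewrite !hf !hg => h.
have : 0 < (v - u) * (f b - f a) by lra.
rewrite pmulr_lgt0 ?subr_gt0 // => h1.
have : 0 < (v - u) * (g b - g a) by rewrite mulr_gt0 ?subr_gt0.
lra.
Qed.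

(** The intermediate value theorem for affine functions, with the care for the
endpoints that [strip] and [strip_weak] need. *)
Lemma exists_zero f x y : affine f -> f x * f y <= 0 -> f x != 0 ->
  exists t, [/\ 0 < t <= 1, f (mix t x y) = 0 & (f y != 0 -> t < 1)].
Proof.
move=> hf le nz; have ne: f x - f y != 0.
  apply/eqP => e; have e' : f y = f x by lra.
  by move: le; rewrite e'; apply/negP; rewrite -ltNge -expr2 exprn_even_gt0.
exists (f x / (f x - f y)); split.
- have h: 0 < (f x - f y) ^+ 2 by rewrite exprn_even_gt0.
  have e1: f x / (f x - f y) = f x * (f x - f y) / (f x - f y) ^+ 2 by field.
  have hx: 0 < f x ^+ 2 by rewrite exprn_even_gt0.
  rewrite e1 divr_gt0 //=; last by rewrite mulrBr -expr2; lra.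
  rewrite ler_pdivrMr // mul1r; have : 0 <= f y ^+ 2 by rewrite sqr_ge0.
  by rewrite !expr2; lra.
- by rewrite hf; field.
move=> nzy; have h: 0 < (f x - f y) ^+ 2 by rewrite exprn_even_gt0.
have e1: f x / (f x - f y) = f x * (f x - f y) / (f x - f y) ^+ 2 by field.
have hy: 0 < f y ^+ 2 by rewrite exprn_even_gt0.
rewrite e1 ltr_pdivrMr // mul1r; move: hy; rewrite !expr2; lra.
Qed.

Lemma mix_lt f x y t k : affine f -> 0 <= t <= 1 -> k < f x -> k < f y -> k < f (mix t x y).
Proof.
move=> hf /andP[t0 t1] h1 h2; rewrite hf.
have := mulr_ge0 t0 (ltW (eq_rect _ is_true h2 _ (esym (subr_gt0 k (f y))))).
have := mulr_ge0 (eq_rect _ is_true t1 _ (esym (subr_ge0 t 1))) (ltW (eq_rect _ is_true h1 _ (esym (subr_gt0 k (f x))))).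
case: (ltrgtP t 0) t0 => // [t0 _|-> _]; last lra.
have : 0 < t * (f y - k) by rewrite mulr_gt0 ?subr_gt0.
lra.
Qed.

Lemma mix_gt f x y t k : affine f -> 0 <= t <= 1 -> f x < k -> f y < k -> f (mix t x y) < k.
Proof.
move=> hf h01 h1 h2; have hg : affine (fun p => - f p) by move=> u a b; rewrite hf; ring.
by rewrite -ltrN2; apply: (mix_lt hg h01); rewrite ltrN2.
Qed.

(** The segment from [lo] to [up] is a barrier in the strip between the line f0 =
const through [lo] and the line f1 = const through [up]: where a segment within
the strip meets the line of the barrier, it meets the barrier itself. *)
Lemma strip f0 f1 lo up x y : affine f0 -> affine f1 ->
  f0 lo < f0 up -> f1 lo < f1 up ->
  f0 lo < f0 x -> f0 lo < f0 y -> f1 x < f1 up -> f1 y < f1 up ->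
  (forall t, 0 <= t <= 1 -> ~ inseg lo up (mix t x y)) ->
  0 < orient lo up x * orient lo up y.
Proof.
move=> h0 h1 l0 l1 x0 y0 x1 y1 no; rewrite ltNge; apply/negP => le.
suff [t [t01 e]] : exists t, 0 <= t <= 1 /\ orient lo up (mix t x y) = 0.
  apply: (no t t01); apply: (on_seg h0 h1) => //; [exact: mix_lt|exact: mix_gt].
have [e|nz] := eqVneq (orient lo up x) 0.
  by exists 0; rewrite mix0 lexx ler01.
have [t [/andP[t0 t1] e _]] := exists_zero (@affine_orient lo up) le nz.
by exists t; rewrite ltW.
Qed.

(** The same when [y] may be at the height of [lo], as for the edges of a fan
whose centre is level with the end of the barrier. *)
Lemma strip_weak f0 f1 lo up x y : affine f0 -> affine f1 ->
  f0 lo < f0 up -> f1 lo < f1 up ->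
  f0 lo < f0 x -> f0 lo <= f0 y -> f1 x < f1 up -> f1 y < f1 up ->
  orient lo up y != 0 ->
  (forall t, 0 <= t < 1 -> ~ inseg lo up (mix t x y)) ->
  0 < orient lo up x * orient lo up y.
Proof.
move=> h0 h1 l0 l1 x0 y0 x1 y1 nzy no; rewrite ltNge; apply/negP => le.
suff [t [t01 e]] : exists t, 0 <= t < 1 /\ orient lo up (mix t x y) = 0.
  apply: (no t t01); apply: (on_seg h0 h1) => //; last first.
    by apply: mix_gt => //; case/andP: t01 => -> /ltW.
  case/andP: t01 => t0 t1; rewrite h0.
  have := mulr_ge0 t0 (eq_rect _ is_true y0 _ (esym (subr_ge0 (f0 lo) (f0 y)))).
  have : 0 < (1 - t) * (f0 x - f0 lo) by rewrite mulr_gt0 ?subr_gt0.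
  lra.
have [e|nz] := eqVneq (orient lo up x) 0.
  by exists 0; rewrite mix0 lexx ltr01.
have [t [/andP[t0 t1] e /(_ nzy) t2]] := exists_zero (@affine_orient lo up) le nz.
by exists t; rewrite ltW.
Qed.

(** The point where the line through [a] and [b] meets the zero line of an affine
function [f]. *)
Definition meet f a b : pt := mix (f a / (f a - f b)) a b.

Lemma meetP f a b : affine f -> f a * f b < 0 ->
  inseg a b (meet f a b) /\ f (meet f a b) = 0.
Proof.
move=> hf lt; have nza: f a != 0 by apply/eqP => e; move: lt; rewrite e mul0r ltxx.
have nzb: f b != 0 by apply/eqP => e; move: lt; rewrite e mulr0 ltxx.
have ne: f a - f b != 0.
  apply/eqP => e; have e' : f b = f a by lra.
  by move: lt; rewrite e' -expr2 ltNge sqr_ge0.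
split; last by rewrite /meet hf; field.
exists (f a / (f a - f b)); split=> //.
have h: 0 < (f a - f b) ^+ 2 by rewrite exprn_even_gt0.
have e1: f a / (f a - f b) = f a * (f a - f b) / (f a - f b) ^+ 2 by field.
have ha: 0 < f a ^+ 2 by rewrite exprn_even_gt0.
have hb: 0 < f b ^+ 2 by rewrite exprn_even_gt0.
rewrite e1; apply/andP; split; first by rewrite divr_gt0 // mulrBr -expr2; lra.
by rewrite ltr_pdivrMr // mul1r; move: hb; rewrite !expr2; lra.
Qed.

Lemma inseg_online a b p : inseg a b p -> orient a b p = 0.
Proof. by case=> t [_ ->]; rewrite affine_orient orient_l orient_r; ring. Qed.

Lemma open_to_end (a b x : pt) u : inseg a b x -> 0 <= u < 1 -> inseg a b (mix u x b).
Proof.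
move=> [v [/andP[v0 v1] ->]] /andP[u0 u1]; exists ((1 - u) * v + u); split.
  have : 0 < (1 - u) * v by rewrite mulr_gt0 ?subr_gt0.
  have : 0 < (1 - u) * (1 - v) by rewrite mulr_gt0 ?subr_gt0.
  by move=> h1 h2; apply/andP; split; lra.
by rewrite -{2}(mix1 a b) mix_mix mulr1.
Qed.

Lemma sub_seg y x p q : inseg y x p -> inseg p x q -> inseg y x q.
Proof. by move=> ip /insegC[u [/andP[u0 u1] ->]]; rewrite mixC; apply: open_to_end => //; lra. Qed.

Definition noncross a b c d := forall p, inseg a b p -> ~ inseg c d p.

(** On the line through [b1] and [b2] the two segments pass one another in some
order, so each sees the crossing point of the other on the opposite side. *)
Lemma order_swap b1 b2 e0 e1 (g0 g1 : pt) (f := orient b1 b2) :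
  f e0 < 0 -> 0 < f e1 -> f g0 < 0 -> 0 < f g1 -> noncross e0 e1 g0 g1 ->
  orient e0 e1 (meet f g0 g1) * orient g0 g1 (meet f e0 e1) < 0.
Proof.
move=> le0 le1 lg0 lg1 no.
have hf : affine f by exact: affine_orient.
have [E1 E2] := @meetP f e0 e1 hf ltac:(by rewrite nmulr_rlt0).
have [G1 G2] := @meetP f g0 g1 hf ltac:(by rewrite nmulr_rlt0).
set E := meet f e0 e1 in E1 E2 *; set G := meet f g0 g1 in G1 G2 *.
have nb : b1 != b2.
  by apply/eqP => e; move: le0; rewrite /f /orient e !subrr !mul0r subrr ltxx.
have [u eu] := online nb E2; have [v ev] := online nb G2.
have oE := inseg_online E1; have oG := inseg_online G1.
have d e e' : orient e e' b2 - orient e e' b1 = - (f e' - f e).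
  by rewrite /f /orient; ring.
have dE := d e0 e1; have dG := d g0 g1.
have euv : u != v.
  by apply/eqP => e; apply: (no E E1); move: G1; rewrite ev -e -eu.
have -> : orient e0 e1 G = (u - v) * (f e1 - f e0).
  move: oE; rewrite eu ev !affine_orient => oE.
  by rewrite (_ : orient e0 e1 b2 = orient e0 e1 b1 - (f e1 - f e0)) in oE *; last lra; lra.
have -> : orient g0 g1 E = (v - u) * (f g1 - f g0).
  move: oG; rewrite eu ev !affine_orient => oG.
  by rewrite (_ : orient g0 g1 b2 = orient g0 g1 b1 - (f g1 - f g0)) in oG *; last lra; lra.
have h1: 0 < f e1 - f e0 by lra.
have h2: 0 < f g1 - f g0 by lra.
rewrite (_ : _ * _ = - ((u - v) ^+ 2 * ((f e1 - f e0) * (f g1 - f g0)))); last by ring.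
have h3: 0 < (u - v) ^+ 2 by rewrite exprn_even_gt0 //= subr_eq0.
by rewrite oppr_lt0; apply: mulr_gt0 h3 (mulr_gt0 h1 h2).
Qed.

End Plane.

(** * Parity of crossings *)

(* These let [vm_compute] decide a statement on ten booleans by discarding the
   cases that violate a hypothesis. *)
Definition forall_bool (f : bool -> bool) := f true && f false.

Lemma forall_boolP f : forall_bool f -> forall b, f b.
Proof. by case/andP => h1 h2 []. Qed.

Lemma and5_impl (b1 b2 b3 b4 b5 c : bool) : (b1 ==> b2 ==> b3 ==> b4 ==> b5 ==> c) ->
  [/\ b1, b2, b3, b4 & b5] -> c.
Proof. by move=> h [h1 h2 h3 h4 h5]; move: h; rewrite h1 h2 h3 h4 h5. Qed.

Section Crossing.
Variable R : realFieldType.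
Notation pt := (R * R)%type.
Implicit Types (a b c d e p q r x y : pt).

Definition ccw a b c := 0 < orient a b c.

Definition crossing a b c d : bool :=
  xorb (ccw a b c) (ccw a b d) && xorb (ccw c d a) (ccw c d b).

Lemma ccw_rot a b c : ccw b c a = ccw a b c.
Proof. by rewrite /ccw orient_rot. Qed.

Lemma ccwN a b c : orient a b c != 0 -> ccw b a c = negb (ccw a b c).
Proof. by move=> nz; rewrite /ccw (orientC a b c) oppr_gt0 -leNgt le_eqVlt (negbTE nz). Qed.

Lemma crossingC a b c d : crossing c d a b = crossing a b c d.
Proof. by rewrite /crossing andbC. Qed.

Lemma ccw_sign a b c d : orient a b c != 0 -> orient a b d != 0 ->
  xorb (ccw a b c) (ccw a b d) = (orient a b c * orient a b d < 0).
Proof.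
by rewrite /ccw; case: ltrgt0P => // h1 _; case: ltrgt0P => // h2 _ /=;
  rewrite ?(pmulr_rlt0 _ h1) ?(nmulr_rlt0 _ h1) ?h2 ?ltNge ?(ltW h2).
Qed.

Lemma inseg_crossing a b c d p : inseg a b p -> inseg c d p ->
  orient a b c != 0 -> orient a b d != 0 ->
  orient c d a != 0 -> orient c d b != 0 -> crossing a b c d.
Proof.
have key e f (g h : pt) : inseg e f p -> inseg g h p -> orient e f g != 0 ->
    orient e f h != 0 -> xorb (ccw e f g) (ccw e f h).
  move=> /inseg_online o [t [/andP[t0 t1] ep]] n1 n2; rewrite ccw_sign //.
  move: o; rewrite ep affine_orient => o.
  have e1: orient e f h * t = - ((1 - t) * orient e f g) by lra.
  rewrite -(pmulr_rlt0 _ t0).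
  have -> : t * (orient e f g * orient e f h) = - ((1 - t) * orient e f g ^+ 2).
    by rewrite mulrCA [t * _]mulrC e1; ring.
  by rewrite oppr_lt0; apply: mulr_gt0; rewrite ?subr_gt0 // exprn_even_gt0.
by move=> h1 h2 n1 n2 n3 n4; rewrite /crossing (key a b c d) // (key c d a b).
Qed.

Lemma crossing_inseg a b c d : crossing a b c d ->
  orient a b c != 0 -> orient a b d != 0 ->
  orient c d a != 0 -> orient c d b != 0 ->
  exists p, inseg a b p /\ inseg c d p.
Proof.
move=> /andP[h1 h2] n1 n2 n3 n4; move: h1 h2; rewrite !ccw_sign // => h1 h2.
have [m1 m2] := meetP (@affine_orient _ c d) h2.
exists (meet (orient c d) a b); split=> //.
have ncd: c != d by apply/eqP => e; move: n3; rewrite e /orient !subrr !mul0r subrr eqxx.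
have [u e] := online ncd m2; exists u; split=> //.
have := inseg_online m1; rewrite e affine_orient => o.
set f := orient a b c in h1 o; set g := orient a b d in h1 o.
have nz : f - g != 0 by apply/eqP => e'; move: h1; rewrite (_ : f = g) -?expr2 ?ltNge ?sqr_ge0 //; lra.
have eu : u = f / (f - g) by apply: (mulIf nz); rewrite mulfVK //; lra.
have h: 0 < (f - g) ^+ 2 by rewrite exprn_even_gt0.
have e1: f / (f - g) = f * (f - g) / (f - g) ^+ 2 by field.
have ha: 0 <= f ^+ 2 by rewrite sqr_ge0.
have hb: 0 <= g ^+ 2 by rewrite sqr_ge0.
rewrite eu e1; apply/andP; split.
  by rewrite divr_gt0 // mulrBr -expr2; lra.
by rewrite ltr_pdivrMr // mul1r; move: hb; rewrite !expr2; lra.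
Qed.

(** The sign condition that a three-term Grassmann-Pluecker relation AA' - BB' + CC'
= 0 imposes on the signs of its terms: they cannot all be positive, nor all be
negative. *)
Definition gp_bool (A B C : bool) := ~~ (A && ~~ B && C) && ~~ (~~ A && B && ~~ C).

Lemma gp_sign (A1 A2 B1 B2 C1 C2 : R) : A1 * A2 - B1 * B2 + C1 * C2 = 0 ->
  A1 != 0 -> A2 != 0 -> B1 != 0 -> B2 != 0 -> C1 != 0 -> C2 != 0 ->
  gp_bool ((0 < A1) == (0 < A2)) ((0 < B1) == (0 < B2)) ((0 < C1) == (0 < C2)).
Proof.
have s (x y : R) : x != 0 -> y != 0 -> if (0 < x) == (0 < y) then 0 < x * y else x * y < 0.
  case: ltrgt0P => // h1 _; case: ltrgt0P => // h2 _ /=.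
  - exact: mulr_gt0.
  - by rewrite pmulr_rlt0.
  - by rewrite nmulr_rlt0.
  - by rewrite nmulr_rgt0.
move=> e a1 a2 b1 b2 c1 c2; move: (s _ _ a1 a2) (s _ _ b1 b2) (s _ _ c1 c2).
rewrite /gp_bool; case: (_ == _); case: (_ == _); case: (_ == _) => //= h1 h2 h3; lra.
Qed.

Section Five.
Variables a b c d e : pt.
Hypotheses (abc : orient a b c != 0) (abd : orient a b d != 0)
  (abe : orient a b e != 0) (acd : orient a c d != 0) (ace : orient a c e != 0)
  (ade : orient a d e != 0) (bcd : orient b c d != 0) (bce : orient b c e != 0)
  (bde : orient b d e != 0) (cde : orient c d e != 0).

(* The five Grassmann-Pluecker relations among the ten orientations. *)
Let chirotope :
  [/\ gp_bool (ccw a b c == ccw a d e) (ccw a b d == ccw a c e) (ccw a b e == ccw a c d),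
      gp_bool (ccw a b c == ccw b d e) (ccw a b d == ccw b c e) (ccw a b e == ccw b c d),
      gp_bool (ccw a b c == ccw c d e) (ccw a c d == ccw b c e) (ccw a c e == ccw b c d),
      gp_bool (ccw a b d == ccw c d e) (ccw a c d == ccw b d e) (ccw a d e == ccw b c d)
    & gp_bool (ccw a b e == ccw c d e) (ccw a c e == ccw b d e) (ccw a d e == ccw b c e)].
Proof. by split; apply: gp_sign => //; rewrite /orient; ring. Qed.

Definition quad_crossings p q r s :=
  xorb (crossing p q r s) (xorb (crossing p r q s) (crossing p s q r)).

(* Rewrites every orientation in terms of the ten with increasing arguments. *)
Let order_ccw :
  [/\ (ccw c d a = ccw a c d) * (ccw c d b = ccw b c d) * (ccw c e a = ccw a c e)
        * (ccw c e b = ccw b c e) * (ccw d e a = ccw a d e),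
      (ccw d e b = ccw b d e) * (ccw d e c = ccw c d e) * (ccw b d a = ccw a b d)
        * (ccw b d c = ~~ ccw b c d) * (ccw a c b = ~~ ccw a b c),
      (ccw a d b = ~~ ccw a b d) * (ccw a d c = ~~ ccw a c d) * (ccw b c a = ccw a b c)
        * (ccw b e a = ccw a b e) * (ccw b e c = ~~ ccw b c e),
      (ccw b e d = ~~ ccw b d e) * (ccw a e b = ~~ ccw a b e) * (ccw a e c = ~~ ccw a c e)
        * (ccw a e d = ~~ ccw a d e)
    & (ccw c e d = ~~ ccw c d e)].
Proof.
have N x y z : orient x y z != 0 -> ccw x z y = ~~ ccw x y z.
  by move=> h; rewrite -ccwN // ccw_rot.
by rewrite (ccw_rot a c d) (ccw_rot b c d) (ccw_rot a c e) (ccw_rot b c e)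
  (ccw_rot a d e) (ccw_rot b d e) (ccw_rot c d e) (ccw_rot a b d)
  (ccw_rot a b c) (ccw_rot a b e) (N b c d) // (N a b c) // (N a b d) // (N a c d) //
  (N b c e) // (N b d e) // (N a b e) // (N a c e) // (N a d e) // (N c d e).
Qed.

Ltac decide_signs a b c d e :=
  apply: and5_impl;
  move: (ccw a b c); apply: forall_boolP;
  move: (ccw a b d); apply: forall_boolP;
  move: (ccw a b e); apply: forall_boolP;
  move: (ccw a c d); apply: forall_boolP;
  move: (ccw a c e); apply: forall_boolP;
  move: (ccw a d e); apply: forall_boolP;
  move: (ccw b c d); apply: forall_boolP;
  move: (ccw b c e); apply: forall_boolP;
  move: (ccw b d e); apply: forall_boolP;
  move: (ccw c d e); apply: forall_boolP;
  vm_compute; reflexivity.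

(** The five points have one, three or five crossings according to the number of
corners of their convex hull. As crossings depend on the ten orientations only, it
is enough to check the sign patterns that satisfy the Grassmann-Pluecker
relations. *)
Lemma K5_odd :
  xorb (quad_crossings a b c d) (xorb (quad_crossings a b c e)
    (xorb (quad_crossings a b d e) (xorb (quad_crossings a c d e)
      (quad_crossings b c d e)))) = true.
Proof.
have [o1 o2 o3 o4 o5] := order_ccw; move: chirotope.
rewrite /quad_crossings /crossing !(o1, o2, o3, o4, o5) => h; apply/eqP; move: h.
decide_signs a b c d e.
Qed.

Definition in_triangle p q r x :=
  (ccw p q x == ccw q r x) && (ccw q r x == ccw r p x).

(** The boundary of a triangle is crossed whenever the segment enters or leaves
it. It is checked on sign patterns, as for [K5_odd]. *)
Lemma triangle_parity :
  xorb (crossing a b d e) (xorb (crossing c b d e) (crossing a c d e)) =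
  xorb (in_triangle a b c d) (in_triangle a b c e).
Proof.
have [o1 o2 o3 o4 o5] := order_ccw; move: chirotope.
have e1 : ccw c b d = ~~ ccw b c d by rewrite ccwN.
have e2 : ccw c b e = ~~ ccw b c e by rewrite ccwN.
have e3 : ccw c a d = ~~ ccw a c d by rewrite ccwN.
have e4 : ccw c a e = ~~ ccw a c e by rewrite ccwN.
rewrite /in_triangle /crossing e1 e2 e3 e4 !(o1, o2, o3, o4, o5) => h; apply/eqP; move: h.
decide_signs a b c d e.
Qed.

End Five.

End Crossing.

(** A reflexive decision procedure for identities between sums modulo 2, for the
count of crossings in a drawing of K33: there are too many summands for a case
analysis. *)
Inductive xsum := XVar of nat | XAdd of xsum & xsum.

Fixpoint xeval (env : seq bool) e :=
  match e with XVar i => nth false env i | XAdd e1 e2 => xorb (xeval env e1) (xeval env e2) end.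

Fixpoint xvars e := match e with XVar i => [:: i] | XAdd e1 e2 => xvars e1 ++ xvars e2 end.

Definition xnull n e :=
  all (fun i => i < n)%N (xvars e) &&
  all (fun i => ~~ odd (count_mem i (xvars e))) (iota 0 n).

Lemma xevalE env e : xeval env e = \big[addb/false]_(i <- xvars e) nth false env i.
Proof.
elim: e => [i|e1 IH1 e2 IH2] /=; first by rewrite big_seq1.
by rewrite big_cat /= -IH1 -IH2; case: (xeval env e1); case: (xeval env e2).
Qed.

Lemma xnullP n e env : xnull n e -> xeval env e = false.
Proof.
case/andP => lt /allP ev; rewrite xevalE.
have -> : \big[addb/false]_(i <- xvars e) nth false env i =
    \big[addb/false]_(j <- iota 0 n) (odd (count_mem j (xvars e)) && nth false env j).
  elim: (xvars e) lt => [_|i s IH /= /andP[lt /IH{}IH]].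
    by rewrite big_nil big1.
  rewrite big_cons IH (bigD1_seq i) ?iota_uniq ?mem_iota //=.
  rewrite [RHS](bigD1_seq i) ?iota_uniq ?mem_iota //= eqxx addbA; congr addb.
    by rewrite oddD /=; case: (nth _ _ _); case: (odd _).
  by apply: eq_bigr => j /negbTE; rewrite eq_sym => ->.
by rewrite big1_seq // => j /andP[_ /ev /negbTE ->].
Qed.

Ltac xlookup x l :=
  match l with
  | x :: _ => constr:(0%N)
  | _ :: ?t => let n := xlookup x t in constr:(n.+1)
  end.

Ltac xatoms e l :=
  match e with
  | xorb ?a ?b => let l1 := xatoms a l in xatoms b l1
  | ?x => match l with
    | context[x :: _] => constr:(l)
    | _ => constr:(x :: l)
    end
  end.

Ltac xreify e l :=
  match e with
  | xorb ?a ?b => let a1 := xreify a l in let b1 := xreify b l in constr:(XAdd a1 b1)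
  | ?x => let n := xlookup x l in constr:(XVar n)
  end.

Ltac xor_ring :=
  match goal with |- ?a = ?b =>
    let l := xatoms (xorb a b) (@nil bool) in
    let e := xreify (xorb a b) l in
    let n := constr:(size l) in
    apply: Bool.xorb_eq; apply: (@xnullP n e l); vm_compute; reflexivity
  end.

Section K33.
Variable R : realFieldType.
Notation pt := (R * R)%type.

Lemma crossing_swap (a b c d : pt) : orient a b c != 0 -> orient a b d != 0 ->
  crossing b a c d = crossing a b c d.
Proof.
move=> n1 n2; rewrite /crossing (ccwN n1) (ccwN n2).
by case: (ccw a b c) (ccw a b d) (ccw c d a) (ccw c d b) => [] [] [] [].
Qed.

Definition generic (n : nat) (p : nat -> pt) := forall i j k : nat,
  (i < n)%N -> (j < n)%N -> (k < n)%N -> i != j -> j != k -> i != k ->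
  orient (p i) (p j) (p k) != 0.

Definition path_crossings (u v w u' v' w' : pt) :=
  xorb (xorb (crossing u w u' w') (crossing u w v' w')) (xorb (crossing v w u' w') (crossing v w v' w')).

Section Generic.
Variable p : nat -> pt.
Hypothesis gp : generic 15 p.

Let distinct5 (a b c d e : nat) :=
  uniq [:: a; b; c; d; e] && all (fun x => x < 15)%N [:: a; b; c; d; e].

Let K5n a b c d e : distinct5 a b c d e ->
  xorb (quad_crossings (p a) (p b) (p c) (p d)) (xorb (quad_crossings (p a) (p b) (p c) (p e))
    (xorb (quad_crossings (p a) (p b) (p d) (p e)) (xorb (quad_crossings (p a) (p c) (p d) (p e))
      (quad_crossings (p b) (p c) (p d) (p e))))) = true.
Proof.
rewrite /distinct5 /= !inE !negb_or => /andP[/and5P[/and4P[ab ac ad ae] /and3P[bc bd be] /andP[cd ce] de _]].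
by move=> /and5P[ha hb hc hd /andP[he _]]; apply: K5_odd; exact: gp.
Qed.

Let trin a b c d e : distinct5 a b c d e ->
  xorb (crossing (p a) (p b) (p d) (p e)) (xorb (crossing (p c) (p b) (p d) (p e)) (crossing (p a) (p c) (p d) (p e))) =
  xorb (in_triangle (p a) (p b) (p c) (p d)) (in_triangle (p a) (p b) (p c) (p e)).
Proof.
rewrite /distinct5 /= !inE !negb_or => /andP[/and5P[/and4P[ab ac ad ae] /and3P[bc bd be] /andP[cd ce] de _]].
by move=> /and5P[ha hb hc hd /andP[he _]]; apply: triangle_parity; exact: gp.
Qed.

(* Replacing a bent path u-w-v by the straight segment uv changes crossing
   numbers by those with the triangle uwv. *)
Let straight_pair i j k i' j' k' :
  distinct5 i k j i' k' -> distinct5 i k j j' k' -> distinct5 i' k' j' i j ->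
  path_crossings (p i) (p j) (p k) (p i') (p j') (p k') =
  xorb (crossing (p i) (p j) (p i') (p j'))
    (xorb (xorb (in_triangle (p i') (p k') (p j') (p i)) (in_triangle (p i') (p k') (p j') (p j)))
          (xorb (in_triangle (p i) (p k) (p j) (p i')) (in_triangle (p i) (p k) (p j) (p j')))).
Proof.
move=> /trin t1 /trin t2 /trin; rewrite !(crossingC (p i) (p j)) => t3.
rewrite -t3 /path_crossings; move: t1 t2.
set a1 := crossing _ _ _ _; set a2 := crossing _ _ _ _; set a3 := crossing _ _ _ _.
set a4 := crossing (p i) (p k) (p j') _; set a5 := crossing (p j) (p k) (p j') _.
set a6 := crossing (p i) (p j) (p j') _; set a7 := crossing (p i) (p j) (p i') (p j').
set b1 := in_triangle _ _ _ _; set b2 := in_triangle _ _ _ _; set b3 := in_triangle _ _ _ _.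
by case: a1 a2 a3 a4 a5 a6 a7 b1 b2 b3 => [] [] [] [] [] [] [] [] [] [].
Qed.

(* Points 0, 1, 2 are the one part of K33, points 3, 4, 5 the other, and the
   points 6, ..., 14 are the bends on the nine edges. *)
Let X i v w j v' w' := path_crossings (p i) (p v) (p w) (p j) (p v') (p w').

(** Straightening the bent edges changes the number of crossings by the numbers of
ends of edges in triangles; each end belongs to two edges, so modulo 2 these
cancel. In a straight-line drawing, the crossings of K33 are those of the three K5
on the first part and two points of the second, up to crossings with the sides of
the triangle of the first part; these are even in number by [triangle_parity], and
[K5_odd] gives three odd numbers. *)
Lemma K33_odd : xorb (X 0 3 6 1 4 10) (xorb (X 0 3 6 1 5 11) (xorb (X 0 4 7 1 3 9) (xorb (X 0 4 7 1 5 11) (xorb (X 0 5 8 1 3 9) (xorb (X 0 5 8 1 4 10) (xorb (X 0 3 6 2 4 13) (xorb (X 0 3 6 2 5 14) (xorb (X 0 4 7 2 3 12) (xorb (X 0 4 7 2 5 14) (xorb (X 0 5 8 2 3 12) (xorb (X 0 5 8 2 4 13) (xorb (X 1 3 9 2 4 13) (xorb (X 1 3 9 2 5 14) (xorb (X 1 4 10 2 3 12) (xorb (X 1 4 10 2 5 14) (xorb (X 1 5 11 2 3 12) (X 1 5 11 2 4 13))))))))))))))))) = true.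
Proof.
rewrite /X !straight_pair //=.
have := K5n (isT : distinct5 0 1 2 3 4); have := K5n (isT : distinct5 0 1 2 3 5).
have := K5n (isT : distinct5 0 1 2 4 5).
have := trin (isT : distinct5 0 1 2 3 4); have := trin (isT : distinct5 0 1 2 3 5).
have := trin (isT : distinct5 0 1 2 4 5).
have swap_ends (a b c d : nat) : uniq [:: a; b; c; d] -> all (fun x => x < 15)%N [:: a; b; c; d] ->
    crossing (p b) (p a) (p c) (p d) = crossing (p a) (p b) (p c) (p d).
  rewrite /= !inE !negb_or => /and4P[/and3P[ab ac ad] /andP[bc bd] cd _] /and5P[ha hb hc hd _].
  by apply: crossing_swap; exact: gp.
rewrite !(swap_ends 1%N 2%N) // /quad_crossings => t1 t2 t3 k1 k2 k3.
match type of k1 with ?K1 = _ => match type of k2 with ?K2 = _ => match type of k3 with ?K3 = _ =>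
match type of t1 with ?L1 = ?R1 => match type of t2 with ?L2 = ?R2 => match type of t3 with ?L3 = ?R3 =>
  transitivity (xorb K1 (xorb K2 (xorb K3 (xorb (xorb L1 R1) (xorb (xorb L2 R2) (xorb L3 R3))))))
end end end end end end; last by rewrite k1 k2 k3 t1 t2 t3 !Bool.xorb_nilpotent.
clear.
repeat match goal with |- context[crossing ?a ?b ?c ?d] => generalize (crossing a b c d); move=> ? end.
repeat match goal with |- context[in_triangle ?a ?b ?c ?d] => generalize (in_triangle a b c d); move=> ? end.
xor_ring.
Qed.
End Generic.
End K33.

Local Open Scope nat_scope.

(* Linear arithmetic on the labels, which hides the real inequalities. *)
Ltac nlia :=
  repeat match goal with
  | H : is_true (Order.lt _ _) |- _ => clear H
  | H : is_true (Order.le _ _) |- _ => clear H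
  | H : forall _, _ |- _ => clear H
  | H : exists _, _ |- _ => clear H
  | H : _ \/ _ |- _ => clear H
  | H : _ /\ _ |- _ => clear H
  | H : [/\ _, _ & _] |- _ => clear H
  end; lia.

(** * Terms *)

Inductive term := Leaf of bool & nat | Join of term & term.

Notation A := (Leaf true).
Notation B := (Leaf false).
Notation W i j := (Join (A i) (B j)).

Fixpoint term_code x : GenTree.tree (bool * nat) :=
  match x with
  | Leaf b n => GenTree.Leaf (b, n)
  | Join x y => GenTree.Node 0 [:: term_code x; term_code y]
  end.

Fixpoint term_decode c : option term :=
  match c with
  | GenTree.Leaf (b, n) => Some (Leaf b n)
  | GenTree.Node _ [:: c1; c2] =>
      if term_decode c1 is Some x then
        if term_decode c2 is Some y then Some (Join x y) else None
      else None
  | _ => None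
  end.

Lemma term_codeK : pcancel term_code term_decode.
Proof. by elim=> [b n|x IHx y IHy] //=; rewrite IHx IHy. Qed.

HB.instance Definition _ := Countable.copy term (pcan_type term_codeK).

Lemma Join_eq a b c d : (Join a b == Join c d) = (a == c) && (b == d).
Proof. by apply/eqP/andP => [[-> ->]|[/eqP-> /eqP->]]. Qed.

Lemma Leaf_eq a n b m : (Leaf a n == Leaf b m) = (a == b) && (n == m).
Proof. by apply/eqP/andP => [[-> ->]|[/eqP-> /eqP->]]. Qed.

Lemma Join_Leaf_eq a b c n : ((Join a b == Leaf c n) = false) * ((Leaf c n == Join a b) = false).
Proof. by split; apply/eqP. Qed.

Definition termE := (Join_eq, Leaf_eq, Join_Leaf_eq).

Fixpoint depth x := if x is Join y z then (maxn (depth y) (depth z)).+1 else 0.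

Fixpoint labels (b : bool) x :=
  match x with
  | Leaf b' n => if b == b' then [:: n] else [::]
  | Join y z => labels b y ++ labels b z
  end.

Fixpoint relabel (s t : nat -> nat) x :=
  match x with
  | Leaf b n => Leaf b ((if b then s else t) n)
  | Join y z => Join (relabel s t y) (relabel s t z)
  end.

Definition child x y := if x is Join a b then (y == a) || (y == b) else false.

Definition fits L p q x :=
  [&& depth x <= L, all (fun n => n < p) (labels true x) & all (fun n => n < q) (labels false x)].

Definition mono p m (s : nat -> nat) :=
  (forall i j, i < j -> j < p -> s i < s j) /\ (forall i, i < p -> s i < m).

Lemma mono_lt p m s i j : mono p m s -> i < p -> j < p -> (s i < s j) = (i < j).
Proof.
move=> [h _] hi hj; case: (ltngtP i j) => [lt|lt|->]; last by rewrite ltnn.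
  by rewrite h.
by apply/negbTE; rewrite -leqNgt ltnW // h.
Qed.

Lemma depth_relabel s t x : depth (relabel s t x) = depth x.
Proof. by elim: x => //= x -> y ->. Qed.

Lemma labels_relabel b s t x : labels b (relabel s t x) = map (if b then s else t) (labels b x).
Proof.
elim: x => [c n|x IHx y IHy] /=; last by rewrite map_cat IHx IHy.
by case: eqP => [->|].
Qed.

Lemma fits_relabel L p q p' q' s t x : fits L p q x -> (forall i, i < p -> s i < p') ->
  (forall i, i < q -> t i < q') -> fits L p' q' (relabel s t x).
Proof.
rewrite /fits depth_relabel !labels_relabel !all_map => /and3P[-> h1 h2] hs ht /=.
by apply/andP; split; [move: h1|move: h2]; apply: sub_all => i /=; auto.
Qed.

Lemma fits_Join L p q x y : fits L p q (Join x y) ->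
  fits L p q x /\ fits L p q y.
Proof.
rewrite /fits /= !all_cat => /and3P[h /andP[-> ->] /andP[-> ->]]; rewrite !andbT.
by split; apply: leq_trans h; rewrite ltnW // ltnS ?leq_maxl ?leq_maxr.
Qed.

Lemma fits_child L p q x y : fits L p q x -> child x y -> fits L p q y.
Proof. by case: x => // a b /fits_Join[h1 h2] /orP[] /eqP->. Qed.

Lemma relabel_inj L p q s t x y : fits L p q x -> fits L p q y ->
  (forall i j, i < p -> j < p -> s i = s j -> i = j) ->
  (forall i j, i < q -> j < q -> t i = t j -> i = j) ->
  relabel s t x = relabel s t y -> x = y.
Proof.
move=> lx ly hs ht; elim: x y lx ly => [b n|x IHx y IHy] [c m|z w] //=.
  rewrite /fits /= => l1 l2 [eb]; move: l1 l2; rewrite -eb.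
  by case: b eb => _ /=; rewrite !andbT /= => h1 h2; [move/hs=> ->|move/ht=> ->].
by move=> /fits_Join[l1 l2] /fits_Join[l3 l4] [e1 e2]; rewrite (IHx z) // (IHy w).
Qed.

Lemma relabel_comp s t s' t' x : relabel s t (relabel s' t' x) = relabel (s \o s') (t \o t') x.
Proof. by elim: x => [[] n|x IHx y IHy] //=; rewrite IHx IHy. Qed.

Lemma relabel_ext s t s' t' x : {in labels true x, s =1 s'} -> {in labels false x, t =1 t'} ->
  relabel s t x = relabel s' t' x.
Proof.
elim: x => [[] n|x IHx y IHy] /= hs ht; first by rewrite hs ?mem_head.
  by rewrite ht ?mem_head.
by congr Join; [apply: IHx|apply: IHy] => i hi; [apply: hs|apply: ht|apply: hs|apply: ht];
  rewrite mem_cat hi ?orbT.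
Qed.

Lemma relabel_id x : relabel id id x = x.
Proof. by elim: x => [[] n|x IHx y IHy] //=; rewrite IHx IHy. Qed.

Lemma child_relabel s t x y : child x y -> child (relabel s t x) (relabel s t y).
Proof. by case: x => //= a b /orP[] /eqP->; rewrite eqxx ?orbT. Qed.

Lemma child_depth x y : child x y -> depth y < depth x.
Proof. by case: x => //= a b /orP[] /eqP->; rewrite ltnS ?leq_maxl ?leq_maxr. Qed.

Local Open Scope ring_scope.

(** * Two-coloured drawings on terms *)

Section Drawing.
Variables (R : realFieldType) (L : nat).
Notation pt := (R * R)%type.
Implicit Types (P : term -> pt) (k : term -> term -> bool).

(** Edges are oriented from a term to its subterms: [P] places the terms, and [k x y] is the colour of the edge from [x] to its
immediate subterm [y]. *)
Definition drawing N P k :=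
  (forall x y z, fits L N N x -> fits L N N y -> fits L N N z ->
     x != y -> y != z -> x != z -> orient (P x) (P y) (P z) != 0) /\
  (forall x y x' y', fits L N N x -> fits L N N x' -> child x y -> child x' y' ->
     (x, y) != (x', y') -> k x y = k x' y' -> noncross (P x) (P y) (P x') (P y')).

(** All that the proof observes of a drawing: orientations, colours, and on which
side of the line x1x2 the line x3x4 meets the line x5x6. Keeping [<] and [<=] apart
saves an argument on general position where the point of intersection is
involved. *)
Definition obs P k x1 x2 x3 x4 x5 x6 : seq bool :=
  let o := orient (P x1) (P x2) (P x3) in
  let o' := orient (P x1) (P x2) (meet (orient (P x5) (P x6)) (P x3) (P x4)) in
  [:: 0 < o; 0 <= o; k x1 x2; 0 < o'; 0 <= o'].

(** Observations on terms with at most [K] labels of either kind depend on the order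
of the labels only: any two increasing relabellings give the same. *)
Definition uniform K N P k := forall p q s t s' t' x1 x2 x3 x4 x5 x6,
  (p <= K)%N -> (q <= K)%N ->
  mono p N s -> mono p N s' -> mono q N t -> mono q N t' ->
  all (fits L p q) [:: x1; x2; x3; x4; x5; x6] ->
  obs P k (relabel s t x1) (relabel s t x2) (relabel s t x3) (relabel s t x4) (relabel s t x5) (relabel s t x6) =
  obs P k (relabel s' t' x1) (relabel s' t' x2) (relabel s' t' x3) (relabel s' t' x4) (relabel s' t' x5) (relabel s' t' x6).

(** The symmetry between columns and rows. It reverses the order of subterms as
well, so that [W i j] is mapped to [W j i]. *)
Fixpoint transpose x := match x with Leaf b n => Leaf (~~ b) n | Join x y => Join (transpose y) (transpose x) end.

Definition swap_xy (p : pt) : pt := (p.2, p.1).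

Definition transpose_place P x := swap_xy (P (transpose x)).
Definition transpose_colour k x y := ~~ k (transpose x) (transpose y).

Lemma transposeK : involutive transpose.
Proof. by elim=> [b n|x IHx y IHy] /=; rewrite ?negbK ?IHx ?IHy. Qed.

Lemma transpose_eq x y : (transpose x == transpose y) = (x == y).
Proof. exact: (inj_eq (inv_inj transposeK)). Qed.

Lemma depth_transpose x : depth (transpose x) = depth x.
Proof. by elim: x => //= x -> y ->; rewrite maxnC. Qed.

Lemma labels_transpose b x : labels b (transpose x) =i labels (~~ b) x.
Proof.
elim: x => [c n|x IHx y IHy] i /=; first by case: b; case: c.
by rewrite !mem_cat IHx IHy orbC.
Qed.

Lemma fits_transpose p q x : fits L p q (transpose x) = fits L q p x.
Proof.
rewrite /fits depth_transpose; congr andb; rewrite andbC.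
by congr andb; apply: eq_all_r => i; rewrite labels_transpose.
Qed.

Lemma child_transpose x y : child (transpose x) (transpose y) = child x y.
Proof. by case: x => //= a b; rewrite !transpose_eq orbC. Qed.

Lemma relabel_transpose s t x : relabel s t (transpose x) = transpose (relabel t s x).
Proof. by elim: x => [[] n|x IHx y IHy] //=; rewrite IHx IHy. Qed.

Lemma orient_swap_xy (a b c : pt) : orient (swap_xy a) (swap_xy b) (swap_xy c) = - orient a b c.
Proof. by rewrite /orient /=; ring. Qed.

Lemma mix_swap_xy u (a b : pt) : mix u (swap_xy a) (swap_xy b) = swap_xy (mix u a b).
Proof. by []. Qed.

Lemma swap_xyK : involutive swap_xy. Proof. by case. Qed.

Lemma inseg_swap_xy (a b p : pt) : inseg (swap_xy a) (swap_xy b) (swap_xy p) -> inseg a b p.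
Proof. by case=> u [hu e]; exists u; split=> //; rewrite -[p]swap_xyK e mix_swap_xy swap_xyK. Qed.

Lemma drawing_transpose N P k : drawing N P k -> drawing N (transpose_place P) (transpose_colour k).
Proof.
move=> [gp nc]; split=> [x y z hx hy hz|x y x' y' hx hx' c c' ne e p].
  rewrite /transpose_place orient_swap_xy oppr_eq0 => xy yz xz.
  by apply: gp; rewrite ?fits_transpose // transpose_eq.
rewrite -[p]swap_xyK => /inseg_swap_xy i1 /inseg_swap_xy i2.
apply: (nc (transpose x) (transpose y) (transpose x') (transpose y')) i1 i2; rewrite ?fits_transpose ?child_transpose //.
  by rewrite xpair_eqE !transpose_eq -xpair_eqE.
exact: negb_inj.
Qed.

Lemma meet_swap_xy (a b c d : pt) : meet (orient (swap_xy a) (swap_xy b)) (swap_xy c) (swap_xy d) =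
  swap_xy (meet (orient a b) c d).
Proof.
by rewrite /meet !orient_swap_xy mix_swap_xy -opprD invrN mulrNN.
Qed.

Lemma obs_transpose P k x1 x2 x3 x4 x5 x6 : obs (transpose_place P) (transpose_colour k) x1 x2 x3 x4 x5 x6 =
  let o := obs P k (transpose x1) (transpose x2) (transpose x3) (transpose x4) (transpose x5) (transpose x6) in
  [:: ~~ nth true o 1; ~~ nth true o 0; ~~ nth true o 2; ~~ nth true o 4; ~~ nth true o 3].
Proof.
by rewrite /obs /transpose_place /= meet_swap_xy !orient_swap_xy !oppr_gt0 !oppr_ge0 -!leNgt -!ltNge.
Qed.

Lemma uniform_transpose K N P k : uniform K N P k -> uniform K N (transpose_place P) (transpose_colour k).
Proof.
move=> H p q s t s' t' x1 x2 x3 x4 x5 x6 hp hq ms ms' mt mt' hl.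
rewrite !obs_transpose -!relabel_transpose (H q p t s t' s') //.
by move: hl; rewrite /= !fits_transpose.
Qed.

End Drawing.

(** * Fans and the order of their crossings *)

Section Fans.
Variable R : realFieldType.
Notation pt := (R * R)%type.
Implicit Types (a b w : pt).

Lemma meetN b0 b1 a w : meet (orient b1 b0) a w = meet (orient b0 b1) a w.
Proof. by rewrite /meet !(orientC b0 b1) -opprD invrN mulrNN. Qed.

Lemma order_swapW b0 b1 e0 e1 g0 g1 (f := orient b0 b1 : pt -> R) :
  f e0 * f e1 < 0 -> f g0 * f g1 < 0 -> 0 < f e0 * f g0 -> noncross e0 e1 g0 g1 ->
  orient e0 e1 (meet f g0 g1) * orient g0 g1 (meet f e0 e1) < 0.
Proof.
move=> le lg leg no; have ne0: f e0 != 0 by apply/eqP => e; move: le; rewrite e mul0r ltxx.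
case: (ltrgtP (f e0) 0) => [h|h|h]; last by rewrite h eqxx in ne0.
  apply: order_swap => //; first by move: le; rewrite nmulr_rlt0.
    by move: leg; rewrite nmulr_rgt0.
  by move: lg; rewrite nmulr_rlt0 //; move: leg; rewrite nmulr_rgt0.
have e : forall x, orient b1 b0 x = - f x by move=> x; rewrite orientC.
rewrite /f -!(meetN b0 b1); apply: order_swap => //; rewrite e ?oppr_gt0 ?oppr_lt0 //.
- by move: le; rewrite pmulr_rlt0.
- by move: leg; rewrite pmulr_rgt0.
by move: lg; rewrite pmulr_rlt0 //; move: leg; rewrite pmulr_rgt0.
Qed.

(** Let w1, w2, w3, w4 be reached from a, a', a, a' across the line b0 b1. From the
centre that is nearer to the line, two edges run to the line within a strip that
is crossed by an edge of the other fan. So the two meet the line on the same side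
of that edge, which therefore does not meet the line between them. *)
Lemma no_alternation b0 b1 a a' w1 w2 w3 w4 (f := orient b0 b1 : pt -> R) (m := meet f) :
  0 < f a * f a' -> f a * f w1 < 0 -> f a' * f w2 < 0 -> f a * f w3 < 0 -> f a' * f w4 < 0 ->
  noncross a w1 a' w2 -> noncross a w3 a' w2 -> noncross a w3 a' w4 ->
  orient a w3 a' != 0 -> orient a' w2 a != 0 ->
  0 < orient a' w2 (m a w1) * orient a w3 (m a' w2) ->
  0 < orient a w3 (m a' w2) * orient a' w4 (m a w3) -> False.
Proof.
move=> faa l1 l2 l3 l4 n12 n32 n34 nz nz' h1 h2.
have hf : affine f by exact: affine_orient.
have s4 : orient a w3 (m a' w4) * orient a' w4 (m a w3) < 0 by exact: order_swapW.
have s3 : orient a w3 (m a' w2) * orient a' w2 (m a w3) < 0 by exact: order_swapW.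
have [i1 z1] := meetP hf l1; have [i2 z2] := meetP hf l2.
have [i3 z3] := meetP hf l3; have [i4 z4] := meetP hf l4.
have hfk : affine (fun x => - f a * f x) by apply: affineZ.
have open_seg (x y z : pt) t : inseg x y z -> 0 <= t < 1 -> inseg x y (mix t z x).
  move=> [u [/andP[u0 u1] ->]] /andP[t0 t1]; exists ((1 - t) * u); split.
    by have := mulr_ge0 t0 (ltW u0); rewrite mulr_gt0 ?subr_gt0 //=; lra.
  by rewrite -{2}(mix0 x y) mix_mix mulr0 addr0.
have fa2 : 0 < f a * f a.
  by rewrite -expr2 exprn_even_gt0 //=; apply/eqP => e; move: l1; rewrite e mul0r ltxx.
case: (leP (- f a * f a) (- f a * f a')) => le.
  have key w : f a' * f w < 0 -> noncross a w3 a' w -> 0 < orient a w3 (m a' w) * orient a w3 a'.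
    move=> lw now; have [iw zw] := meetP hf lw.
    apply: (strip_weak hfk hfk); rewrite /= ?zw ?mulr0; try lra.
    by move=> t t01 i; apply: (now _ i); exact: open_seg.
  have := key _ l2 n32; have := key _ l4 n34; move: h2 s4.
  set x := orient a w3 (m a' w2); set y := orient a' w4 _; set z := orient a w3 (m a' w4).
  set v := orient a w3 a'; move=> {}h2 {}s4 k4 k2.
  have : 0 < (x * y) * (z * v) by rewrite mulr_gt0.
  have : 0 < (z * v) * (x * v) by rewrite mulr_gt0.
  have : (z * y) * (x * v) < 0 by rewrite nmulr_rlt0.
  lra.
have ff : 0 < f a' * f a' by rewrite -expr2 exprn_even_gt0 //=; apply/eqP => e; move: l2; rewrite e mul0r ltxx.
have hfk' : affine (fun x => - f a' * f x) by apply: affineZ.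
have le' : - f a' * f a' <= - f a' * f a.
  have : 0 < (f a * f a') * (f a * f a' - f a * f a) by rewrite mulr_gt0 //; lra.
  move: faa; set x := f a; set y := f a' => faa h.
  have : 0 < x ^+ 2 * (y ^+ 2 - x * y) by rewrite (_ : _ * _ = x * y * (x * y - x * x)) //; ring.
  by rewrite pmulr_rgt0; [rewrite expr2; lra | rewrite expr2].
have key w : f a * f w < 0 -> noncross a w a' w2 -> 0 < orient a' w2 (m a w) * orient a' w2 a.
  move=> lw now; have [iw zw] := meetP hf lw.
  apply: (strip_weak hfk' hfk'); rewrite /= ?zw ?mulr0; try lra.
  by move=> t t01 i; apply: (now _ (open_seg _ _ _ _ iw t01) i).
have := key _ l1 n12; have := key _ l3 n32; move: h1 s3.
set x := orient a' w2 (m a w1); set y := orient a w3 _; set z := orient a' w2 (m a w3).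
set v := orient a' w2 a; move=> {}h1 {}s3 k3 k1.
have : 0 < (x * y) * (z * v) by rewrite mulr_gt0.
have : (y * z) * (x * v) < 0 by rewrite nmulr_rlt0.
lra.
Qed.

Lemma meet_sym a w b0 b1 : orient b0 b1 a - orient b0 b1 w != 0 ->
  meet (orient b0 b1) a w = meet (orient a w) b0 b1.
Proof.
move=> nz; have e : orient a w b0 - orient a w b1 = - (orient b0 b1 a - orient b0 b1 w).
  by rewrite /orient; ring.
rewrite /meet e /mix; move: nz; rewrite /orient /= => nz.
by congr pair; field; rewrite ?oppr_eq0 ?nz // /orient.
Qed.
End Fans.

Section Frame.
Variable R : realFieldType.
Notation pt := (R * R)%type.
Variables (L K M : nat).
Implicit Types (P : term -> pt) (k : term -> term -> bool).

(** Signed position relative to the column from A c to W c M: negative on the side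
of the centres B. Likewise for the row from B r to W M r, negative on the side of
the centres A. *)
Definition col_dist P c p := - orient (P (A c)) (P (W c M)) p * orient (P (A c)) (P (W c M)) (P (B 0)).
Definition row_dist P r p := - orient (P (B r)) (P (W M r)) p * orient (P (B r)) (P (W M r)) (P (A 0)).

(** For A s and B t the edges to W s t form two families of fans. A red edge crosses
the blue edges with a smaller B and a larger A. *)
Record fans P k : Prop := Fans {
  fans_drawing : drawing L M.+1 P k;
  fans_uniform : uniform L K M.+1 P k;
  fans_red : forall s t, (s <= M)%N -> (t <= M)%N -> k (W s t) (A s) = true;
  fans_blue : forall s t, (s <= M)%N -> (t <= M)%N -> k (W s t) (B t) = false;
  fans_cross : forall s i l t, (s < i)%N -> (i <= M)%N -> (l < t)%N -> (t <= M)%N ->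
    crossing (P (A s)) (P (W s t)) (P (B l)) (P (W i l)) }.

Lemma affine_col P c : affine (col_dist P c).
Proof.
move=> t a b; rewrite /col_dist affine_orient; ring.
Qed.

Lemma affine_row P c : affine (row_dist P c).
Proof. move=> t a b; rewrite /row_dist affine_orient; ring. Qed.

Lemma col_dist_transpose P c p : col_dist (transpose_place P) c (swap_xy p) = row_dist P c p.
Proof. by rewrite /col_dist /row_dist /transpose_place /= !orient_swap_xy; ring. Qed.

Lemma row_dist_transpose P c p : row_dist (transpose_place P) c (swap_xy p) = col_dist P c p.
Proof. by rewrite /col_dist /row_dist /transpose_place /= !orient_swap_xy; ring. Qed.

Hypothesis L1 : (0 < L)%N.

Lemma fits_A p q c : (c < p)%N -> fits L p q (A c).
Proof. by move=> h; rewrite /fits /= h. Qed.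
Lemma fits_B p q c : (c < q)%N -> fits L p q (B c).
Proof. by move=> h; rewrite /fits /= h. Qed.
Lemma fits_W p q c d : (c < p)%N -> (d < q)%N -> fits L p q (W c d).
Proof. by move=> h1 h2; rewrite /fits /= h1 h2 L1. Qed.

Lemma mono_nth m l : sorted ltn l -> all (fun i => i < m)%N l -> mono (size l) m (nth 0%N l).
Proof.
move=> sl al; split=> [i j lt lj|i li]; last by move/all_nthP: al; apply.
by apply: (sorted_ltn_nth ltn_trans 0%N sl) => //; apply: ltn_trans lt lj.
Qed.

Lemma fans_transpose P k : fans P k -> fans (transpose_place P) (transpose_colour k).
Proof.
move=> [d u kA kB st]; split; [exact: drawing_transpose|exact: uniform_transpose| | |].
- by move=> s t hs ht; rewrite /transpose_colour /= kB.
- by move=> s t hs ht; rewrite /transpose_colour /= kA.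
move=> s i l t si iM lt tM; rewrite /transpose_place /=.
have g x y z : fits L M.+1 M.+1 x -> fits L M.+1 M.+1 y -> fits L M.+1 M.+1 z ->
     x != y -> y != z -> x != z -> orient (P x) (P y) (P z) != 0 by case: d => g _; exact: g.
have e (x y z : term) : orient (P x) (P y) (P z) != 0 ->
    ccw (swap_xy (P x)) (swap_xy (P y)) (swap_xy (P z)) = ~~ ccw (P x) (P y) (P z).
  by move=> nz; rewrite /ccw orient_swap_xy oppr_gt0 -leNgt le_eqVlt (negbTE nz).
have H := st l t s i lt tM si iM.
have [sM lM] : (s <= M)%N /\ (l <= M)%N by split; nlia.
have il : i == s = false by apply/eqP; nlia.
have tl : t == l = false by apply/eqP; nlia.
have il' : s == i = false by apply/eqP; nlia.
have tl' : l == t = false by apply/eqP; nlia.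
rewrite crossingC /crossing !e; first by move: H; rewrite /crossing; do 4!case: (ccw _ _ _).
all: apply: g; rewrite ?fits_A ?fits_B ?fits_W //; rewrite ?termE ?il ?tl ?il' ?tl' ?andbF //.
Qed.

Section Fans.
Variables (P : term -> pt) (k : term -> term -> bool).
Hypothesis F : fans P k.
Hypothesis K8 : (8 <= K)%N.

Lemma gpP x y z : fits L M.+1 M.+1 x -> fits L M.+1 M.+1 y -> fits L M.+1 M.+1 z ->
     x != y -> y != z -> x != z -> orient (P x) (P y) (P z) != 0.
Proof. by case: (fans_drawing F) => g _; exact: g. Qed.

(* Uniformity with relabellings given by increasing lists. *)
Lemma unif sl sl' tl tl' x1 x2 x3 x4 x5 x6 :
  sorted ltn sl -> sorted ltn sl' -> sorted ltn tl -> sorted ltn tl' ->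
  all (fun i => i < M.+1)%N (sl ++ sl' ++ tl ++ tl') ->
  size sl = size sl' -> size tl = size tl' -> (size sl <= K)%N -> (size tl <= K)%N ->
  all (fits L (size sl) (size tl)) [:: x1; x2; x3; x4; x5; x6] ->
  obs P k (relabel (nth 0%N sl) (nth 0%N tl) x1) (relabel (nth 0%N sl) (nth 0%N tl) x2) (relabel (nth 0%N sl) (nth 0%N tl) x3)
    (relabel (nth 0%N sl) (nth 0%N tl) x4) (relabel (nth 0%N sl) (nth 0%N tl) x5) (relabel (nth 0%N sl) (nth 0%N tl) x6) =
  obs P k (relabel (nth 0%N sl') (nth 0%N tl') x1) (relabel (nth 0%N sl') (nth 0%N tl') x2) (relabel (nth 0%N sl') (nth 0%N tl') x3)
    (relabel (nth 0%N sl') (nth 0%N tl') x4) (relabel (nth 0%N sl') (nth 0%N tl') x5) (relabel (nth 0%N sl') (nth 0%N tl') x6).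
Proof.
move=> s1 s2 s3 s4; rewrite !all_cat => /and4P[a1 a2 a3 a4] e1 e2 k1 k2 hl.
apply: (fans_uniform F k1 k2) => //.
- exact: mono_nth.
- by rewrite e1; exact: mono_nth.
- exact: mono_nth.
by rewrite e2; exact: mono_nth.
Qed.

Lemma same_sign (x y : R) : (0 < x) = (0 < y) -> (0 <= x) = (0 <= y) -> x != 0 -> 0 < x * y.
Proof.
case: (ltrgt0P x) => // h; case: (ltrgt0P y) => // h' _ _ _; first exact: mulr_gt0.
by rewrite nmulr_rgt0.
Qed.

Lemma same_sign0 (x y : R) : 0 < x * y -> x != 0.
Proof. by move=> h; apply/eqP => e; move: h; rewrite e mul0r ltxx. Qed.

Ltac gp := apply: gpP; rewrite ?fits_A ?fits_B ?fits_W ?termE //=; nlia.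

Ltac unif_done H :=
  have {H}[] := H ltac:(nlia) ltac:(nlia) ltac:(nlia) ltac:(nlia) ltac:(nlia)
    erefl erefl ltac:(nlia) ltac:(nlia) isT; by [].

Lemma noncross_red s t s' t' : (s <= M)%N -> (t <= M)%N -> (s' <= M)%N -> (t' <= M)%N ->
  (s != s') || (t != t') -> noncross (P (A s)) (P (W s t)) (P (A s')) (P (W s' t')).
Proof.
move=> hs ht hs' ht' ne p /insegC i1 /insegC i2.
case: (fans_drawing F) => _ nc; apply: (nc _ _ _ _ _ _ _ _ _ _ p i1 i2); rewrite ?fits_W //= ?eqxx ?orbT //.
  by rewrite xpair_eqE !termE /=; nlia.
by rewrite !(fans_red F).
Qed.

Lemma noncross_blue s t s' t' : (s <= M)%N -> (t <= M)%N -> (s' <= M)%N -> (t' <= M)%N ->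
  (s != s') || (t != t') -> noncross (P (B t)) (P (W s t)) (P (B t')) (P (W s' t')).
Proof.
move=> hs ht hs' ht' ne p /insegC i1 /insegC i2.
case: (fans_drawing F) => _ nc; apply: (nc _ _ _ _ _ _ _ _ _ _ p i1 i2); rewrite ?fits_W //= ?eqxx ?orbT //.
  by rewrite xpair_eqE !termE /=; nlia.
by rewrite !(fans_blue F).
Qed.

Lemma cross_sign s i l t : (s < i)%N -> (i <= M)%N -> (l < t)%N -> (t <= M)%N ->
  orient (P (B l)) (P (W i l)) (P (A s)) * orient (P (B l)) (P (W i l)) (P (W s t)) < 0 /\
  orient (P (A s)) (P (W s t)) (P (B l)) * orient (P (A s)) (P (W s t)) (P (W i l)) < 0.
Proof.
move=> si iM lt tM; have := fans_cross F si iM lt tM.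
by case/andP; rewrite !ccw_sign //; gp.
Qed.

Definition crossing_point s t i l := meet (orient (P (B l)) (P (W i l))) (P (A s)) (P (W s t)).

Lemma crossing_pointP s t i l : (s < i)%N -> (i <= M)%N -> (l < t)%N -> (t <= M)%N ->
  [/\ inseg (P (A s)) (P (W s t)) (crossing_point s t i l), inseg (P (B l)) (P (W i l)) (crossing_point s t i l)
    & orient (P (B l)) (P (W i l)) (crossing_point s t i l) = 0].
Proof.
move=> si iM lt tM; have [h1 h2] := cross_sign si iM lt tM.
have [i1 z1] := meetP (@affine_orient _ _ _) h1; split=> //.
rewrite /crossing_point meet_sym; first by have [] := meetP (@affine_orient _ _ _) h2.
apply/eqP => e; move: h1; set x := orient _ _ _ in e *; set y := orient _ _ _ in e *.
by rewrite (_ : y = x) -?expr2 ?ltNge ?sqr_ge0 //; lra.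
Qed.

Definition side c t' s t i l := orient (P (A c)) (P (W c t')) (crossing_point s t i l).

(* Uniformity for the observation on points of intersection. *)
Lemma side_unif c t' s t i l c1 t1' s1 t1 i1 l1 :
  [&& (s < i), (c < i), (l < t), (t < t'), (i <= M) & (t' <= M)]%N ->
  [&& (s1 < i1), (c1 < i1), (l1 < t1), (t1 < t1'), (i1 <= M) & (t1' <= M)]%N ->
  (s < c)%N && (s1 < c1)%N || (c < s)%N && (c1 < s1)%N ->
  (0 < side c t' s t i l) = (0 < side c1 t1' s1 t1 i1 l1).
Proof.
move=> h h1 /orP[]/andP[h2 h3].
  have := @unif [:: s; c; i] [:: s1; c1; i1] [:: l; t; t'] [:: l1; t1; t1']
    (A 1%N) (W 1%N 2%N) (A 0%N) (W 0%N 1%N) (B 0%N) (W 2%N 0%N).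
  move=> /=; rewrite !fits_W // => H; unif_done H.
have := @unif [:: c; s; i] [:: c1; s1; i1] [:: l; t; t'] [:: l1; t1; t1']
    (A 0%N) (W 0%N 2%N) (A 1%N) (W 1%N 1%N) (B 0%N) (W 2%N 0%N).
move=> /=; rewrite !fits_W // => H; unif_done H.
Qed.

Lemma same_side_line s s' i l : (s < i)%N -> (s' < i)%N -> (i <= M)%N -> (l < M)%N ->
  0 < orient (P (B l)) (P (W i l)) (P (A s)) * orient (P (B l)) (P (W i l)) (P (A s')).
Proof.
move=> si si' iM lM; have nz j : (j < i)%N -> orient (P (B l)) (P (W i l)) (P (A j)) != 0.
  by move=> ji; gp.
have H := @unif [:: s; i] [:: s'; i] [:: l] [:: l]
  (B 0%N) (W 1%N 0%N) (A 0%N) (A 0%N) (A 0%N) (A 0%N).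
move: H => /=; rewrite !fits_W // => H.
have {H}[] := H ltac:(nlia) ltac:(nlia) ltac:(nlia) ltac:(nlia) ltac:(nlia)
    erefl erefl ltac:(nlia) ltac:(nlia) isT.
by move=> e1 e2 _ _; apply: same_sign => //; exact: nz.
Qed.

Lemma side_nz c t' s t i l : [&& s < i, c < i, l < t, l < t', i <= M, t <= M, t' <= M & c != s]%N ->
  side c t' s t i l != 0.
Proof.
move=> h; have [h1 _] := @cross_sign s i l t ltac:(nlia) ltac:(nlia) ltac:(nlia) ltac:(nlia).
have [h2 _] := @cross_sign c i l t' ltac:(nlia) ltac:(nlia) ltac:(nlia) ltac:(nlia).
have no : noncross (P (A c)) (P (W c t')) (P (A s)) (P (W s t)) by apply: noncross_red; nlia.
have := order_swapW h2 h1 (@same_side_line c s i l ltac:(nlia) ltac:(nlia) ltac:(nlia) ltac:(nlia)) no.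
by apply: contraTneq; rewrite /side /crossing_point => ->; rewrite mul0r ltxx.
Qed.

Let no_alternation4 : (4 <= M)%N -> 0 < side 1 2 0 1 2 0 * side 0 3 1 2 2 0 ->
  0 < side 0 3 1 2 2 0 * side 1 4 0 3 2 0 -> False.
Proof.
move=> M4; have c t1 s1 : (0 < t1)%N -> (t1 <= M)%N -> (s1 < 2)%N ->
    orient (P (B 0)) (P (W 2 0)) (P (A s1)) * orient (P (B 0)) (P (W 2 0)) (P (W s1 t1)) < 0.
  by move=> h1 h2 h3; have [] := @cross_sign s1 2 0 t1 ltac:(nlia) ltac:(nlia) ltac:(nlia) ltac:(nlia).
apply: (@no_alternation R (P (B 0)) (P (W 2 0)) (P (A 0)) (P (A 1))
  (P (W 0 1)) (P (W 1 2)) (P (W 0 3)) (P (W 1 4))).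
- by apply: same_side_line; nlia.
- by apply: c; nlia.
- by apply: c; nlia.
- by apply: c; nlia.
- by apply: c; nlia.
- by apply: noncross_red; nlia.
- by apply: noncross_red; nlia.
- by apply: noncross_red; nlia.
- by gp.
by gp.
Qed.

(** If an edge from A s crossed the blue edge on the same side of the edges from A
c0 and A c1, then by uniformity edges from two centres, taken with increasing second
labels, would cross it in alternation, against [no_alternation]. *)
Lemma fan_between c0 c1 s t t' i l :
  [&& c0 < s, s < c1, c1 < i, i <= M, l < t, t < t' & t' <= M]%N -> (4 <= M)%N ->
  side c0 t' s t i l * side c1 t' s t i l < 0.
Proof.
move=> h M4.
have nz0 : side c0 t' s t i l != 0 by apply: side_nz; nlia.
have nz1 : side c1 t' s t i l != 0 by apply: side_nz; nlia.
suff ne : (0 < side c0 t' s t i l) != (0 < side c1 t' s t i l).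
  move: nz0 nz1 ne; case: ltrgt0P => // h1 _; case: ltrgt0P => // h2 _ _.
    by rewrite pmulr_rlt0.
  by rewrite nmulr_rlt0.
rewrite (@side_unif c0 t' s t i l 0 2 1 1 2 0); [|nlia..].
rewrite (@side_unif c1 t' s t i l 1 2 0 1 2 0); [|nlia..].
apply/eqP => e.
have e1 : (0 < side 0 3 1 2 2 0) = (0 < side 0 2 1 1 2 0) by apply: side_unif; nlia.
have e2 : (0 < side 1 4 0 3 2 0) = (0 < side 1 2 0 1 2 0) by apply: side_unif; nlia.
have n1 : side 1 2 0 1 2 0 != 0 by apply: side_nz; nlia.
have n2 : side 0 3 1 2 2 0 != 0 by apply: side_nz; nlia.
have n3 : side 1 4 0 3 2 0 != 0 by apply: side_nz; nlia.
have pos (x y : R) : x != 0 -> y != 0 -> (0 < x) = (0 < y) -> 0 < x * y.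
  move=> nx ny e0; apply: same_sign => //.
  by rewrite !le_eqVlt !(eq_sym 0) (negbTE nx) (negbTE ny) e0.
apply: no_alternation4 => //.
  by apply: pos n1 n2 _; rewrite e1 e.
by apply: pos n2 n3 _; rewrite e1 e2 e.
Qed.

End Fans.
End Frame.

(** * Columns, rows and cells *)

Section Cells.
Variable R : realFieldType.
Notation pt := (R * R)%type.
Variables (L K M : nat).
Hypothesis L1 : (0 < L)%N.
Hypothesis K8 : (8 <= K)%N.
Hypothesis M8 : (8 <= M)%N.
Implicit Types (P : term -> pt) (k : term -> term -> bool).
Notation fans := (@fans R L K M).
Notation cdist := (col_dist M).
Notation rdist := (row_dist M).

Lemma same_sign_gt0 (x y : R) : x != 0 -> y != 0 -> (0 < x) = (0 < y) -> 0 < x * y.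
Proof.
move=> nx ny e0; apply: same_sign => //.
by rewrite !le_eqVlt !(eq_sym 0) (negbTE nx) (negbTE ny) e0.
Qed.

Section One.
Variables (P : term -> pt) (k : term -> term -> bool).
Hypothesis F : fans P k.

Ltac gp := apply: (gpP F); rewrite ?fits_A ?fits_B ?fits_W ?termE //=; nlia.

Lemma col_side c r c' r' : (c < M)%N -> (r < M)%N -> (c' < M)%N -> (r' < M)%N ->
  0 < orient (P (A c)) (P (W c M)) (P (B r)) * orient (P (A c')) (P (W c' M)) (P (B r')).
Proof.
move=> hc hr hc' hr'.
have H := @unif R L K M P k F [:: c] [:: c'] [:: r; M] [:: r'; M]
  (A 0%N) (W 0%N 1%N) (B 0%N) (A 0%N) (A 0%N) (A 0%N).
move: H => /=; rewrite !fits_W // => H.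
have {H}[] := H isT isT ltac:(nlia) ltac:(nlia) ltac:(nlia)
    erefl erefl ltac:(nlia) ltac:(nlia) isT.
by move=> e1 e2 *; apply: same_sign => //; gp.
Qed.

Lemma col_dist_B c r : (c < M)%N -> (r < M)%N -> cdist P c (P (B r)) < 0.
Proof.
move=> hc hr; rewrite /col_dist mulNr oppr_lt0; apply: col_side => //; nlia.
Qed.

Lemma col_dist_W c r : (c < M)%N -> (r < M)%N -> 0 < cdist P c (P (W M r)).
Proof.
move=> hc hr; have := @cross_sign R L K M L1 P k F K8 c M r M hc ltac:(nlia) hr ltac:(nlia).
case=> _ h; have := @col_side c r c 0 hc hr hc ltac:(nlia).
rewrite /col_dist mulNr oppr_gt0; move: h; set x := orient _ _ (P (B r)); set y := orient _ _ (P (W M r)).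
set z := orient _ _ (P (B 0)) => h1 h2; have nx := same_sign0 h2.
have x2 : 0 < x ^+ 2 by rewrite exprn_even_gt0.
have : (x * y) * (x * z) < 0 by rewrite nmulr_rlt0.
by rewrite (_ : x * y * (x * z) = x ^+ 2 * (y * z)); [rewrite pmulr_rlt0|ring].
Qed.

Lemma col_dist_crossing_point c s t i l s1 t1 i1 l1 :
  [&& (s < i), (c < i), (l < t), (t < M) & (i <= M)]%N ->
  [&& (s1 < i1), (c < i1), (l1 < t1), (t1 < M) & (i1 <= M)]%N ->
  (c < s)%N && (c < s1)%N || (s < c)%N && (s1 < c)%N ->
  0 < cdist P c (crossing_point P s t i l) * cdist P c (crossing_point P s1 t1 i1 l1).
Proof.
move=> h h1 h2; have h3 := @side_unif R L K M L1 P k F K8 c M s t i l c M s1 t1 i1 l1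
  ltac:(nlia) ltac:(nlia) ltac:(nlia).
have n1 := @side_nz R L K M L1 P k F K8 c M s t i l ltac:(nlia).
have n2 := @side_nz R L K M L1 P k F K8 c M s1 t1 i1 l1 ltac:(nlia).
have h4 := same_sign_gt0 n1 n2 h3.
have : orient (P (A c)) (P (W c M)) (P (B 0)) != 0 by gp.
rewrite /col_dist; move: h4; rewrite /side; set x := orient _ _ (crossing_point P s t i l).
set y := orient _ _ (crossing_point P s1 t1 i1 l1); set z := orient _ _ (P (B 0)) => h4 nz.
rewrite (_ : - x * z * (- y * z) = (x * y) * z ^+ 2); last by ring.
by rewrite mulr_gt0 // exprn_even_gt0.
Qed.

Lemma between_cols c0 c1 s t i l :
  [&& c0 < s, s < c1, c1 < i, i <= M, l < t & t < M]%N ->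
  cdist P c0 (crossing_point P s t i l) * cdist P c1 (crossing_point P s t i l) < 0.
Proof.
move=> h; have := @fan_between R L K M L1 P k F K8 c0 c1 s t M i l ltac:(nlia) ltac:(nlia).
have := @col_side c0 0 c1 0 ltac:(nlia) ltac:(nlia) ltac:(nlia) ltac:(nlia).
rewrite /col_dist /side; set x := orient _ _ (P (B 0)); set y := orient (P (A c1)) _ (P (B 0)).
set u := orient _ _ (crossing_point P s t i l); set v := orient (P (A c1)) _ (crossing_point P s t i l).
move=> h1 h2; rewrite (_ : - u * x * (- v * y) = (u * v) * (x * y)); last by ring.
by rewrite nmulr_rlt0.
Qed.

End One.

Section Two.
Variables (P : term -> pt) (k : term -> term -> bool).
Hypothesis F : fans P k.
Let F' := fans_transpose L1 F.

Ltac gp := apply: (gpP F); rewrite ?fits_A ?fits_B ?fits_W ?termE //=; nlia.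

Lemma row_dist_A c r : (c < M)%N -> (r < M)%N -> rdist P r (P (A c)) < 0.
Proof. by move=> hc hr; rewrite -col_dist_transpose; exact: (col_dist_B F' hr hc). Qed.

Lemma row_dist_W c r : (c < M)%N -> (r < M)%N -> 0 < rdist P r (P (W c M)).
Proof. by move=> hc hr; rewrite -col_dist_transpose; exact: (col_dist_W F' hr hc). Qed.

Lemma crossing_point_transpose s t i l : (s < i)%N -> (i <= M)%N -> (l < t)%N -> (t <= M)%N ->
  crossing_point (transpose_place P) l i t s = swap_xy (crossing_point P s t i l).
Proof.
move=> h1 h2 h3 h4; rewrite /crossing_point /transpose_place /= meet_swap_xy -meet_sym //.
have [h _] := cross_sign L1 F K8 h1 h2 h3 h4.
apply/eqP => e; move: h; set x := orient _ _ _ in e *; set y := orient _ _ _ in e *.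
by rewrite (_ : y = x) -?expr2 ?ltNge ?sqr_ge0 //; lra.
Qed.

Lemma row_dist_crossing_point r s t i l s1 t1 i1 l1 :
  [&& (s < i), (r < t), (l < t), (i < M) & (t <= M)]%N ->
  [&& (s1 < i1), (r < t1), (l1 < t1), (i1 < M) & (t1 <= M)]%N ->
  (r < l)%N && (r < l1)%N || (l < r)%N && (l1 < r)%N ->
  0 < rdist P r (crossing_point P s t i l) * rdist P r (crossing_point P s1 t1 i1 l1).
Proof.
move=> h h1 h2; rewrite -!col_dist_transpose -!crossing_point_transpose; [|nlia..].
by apply: (col_dist_crossing_point F'); nlia.
Qed.

Lemma between_rows r0 r1 s t i l :
  [&& r0 < l, l < r1, r1 < t, t <= M, s < i & i < M]%N ->
  rdist P r0 (crossing_point P s t i l) * rdist P r1 (crossing_point P s t i l) < 0.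
Proof.
move=> h; rewrite -!col_dist_transpose -!crossing_point_transpose; [|nlia..].
by apply: (between_cols F'); nlia.
Qed.

End Two.

End Cells.

Section Env.
Variable R : realFieldType.
Notation pt := (R * R)%type.
Variables (L K M : nat).
Hypothesis L1 : (0 < L)%N.
Hypothesis K8 : (8 <= K)%N.
Hypothesis M8 : (8 <= M)%N.
Implicit Types (P : term -> pt) (k : term -> term -> bool).
Notation fans := (@fans R L K M).
Notation cdist := (col_dist M).
Notation rdist := (row_dist M).

Lemma mulr_sq (x y z : R) : 0 < x * y -> z != 0 -> 0 < (- x * z) * (- y * z).
Proof.
move=> h nz; rewrite (_ : - x * z * (- y * z) = (x * y) * z ^+ 2); last by ring.
by rewrite mulr_gt0 // exprn_even_gt0.
Qed.

Section One.
Variables (P : term -> pt) (k : term -> term -> bool).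
Hypothesis F : fans P k.

Ltac gp := apply: (gpP F); rewrite ?fits_A ?fits_B ?fits_W ?termE //=; nlia.

(** The strip lemma with two rows as the borders and a column as the barrier: this
is how red edges are kept in place. *)
Lemma strip_col c r0 r1 x y : (c < M)%N -> (r0 < M)%N -> (r1 < M)%N ->
  0 <= rdist P r0 x -> 0 <= rdist P r0 y -> rdist P r1 x <= 0 -> rdist P r1 y <= 0 ->
  (forall t, 0 <= t <= 1 -> ~ inseg (P (A c)) (P (W c M)) (mix t x y)) ->
  0 < cdist P c x * cdist P c y.
Proof.
move=> hc h0 h1 x0 y0 x1 y1 no.
have d0 := row_dist_A L1 K8 M8 F hc h0; have d1 := row_dist_A L1 K8 M8 F hc h1.
have u0 := row_dist_W L1 K8 M8 F hc h0; have u1 := row_dist_W L1 K8 M8 F hc h1.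
apply: mulr_sq; last by gp.
by apply: (@strip R (rdist P r0) (rdist P r1)) => //; try exact: affine_row; lra.
Qed.

(** The edge that forms the row reaches beyond every column, so between two columns
the row is part of that edge. *)
Lemma on_row r c0 c1 x : (r < M)%N -> (c0 < M)%N -> (c1 < M)%N ->
  0 < cdist P c0 x -> cdist P c1 x < 0 -> rdist P r x = 0 -> inseg (P (B r)) (P (W M r)) x.
Proof.
move=> hr h0 h1 x0 x1 z.
have d0 := col_dist_B L1 K8 M8 F h0 hr; have d1 := col_dist_B L1 K8 M8 F h1 hr.
have u0 := col_dist_W L1 K8 M8 F h0 hr; have u1 := col_dist_W L1 K8 M8 F h1 hr.
apply: (@on_seg R (cdist P c0) (cdist P c1)); try exact: affine_col; try lra.
have nz : orient (P (B r)) (P (W M r)) (P (A 0)) != 0 by gp.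
by move/eqP: z; rewrite /row_dist mulf_eq0 (negbTE nz) orbF oppr_eq0 => /eqP.
Qed.

End One.

Section Two.
Variables (P : term -> pt) (k : term -> term -> bool).
Hypothesis F : fans P k.

Lemma strip_row r c0 c1 x y : (r < M)%N -> (c0 < M)%N -> (c1 < M)%N ->
  0 <= cdist P c0 x -> 0 <= cdist P c0 y -> cdist P c1 x <= 0 -> cdist P c1 y <= 0 ->
  (forall t, 0 <= t <= 1 -> ~ inseg (P (B r)) (P (W M r)) (mix t x y)) ->
  0 < rdist P r x * rdist P r y.
Proof.
move=> hr h0 h1 x0 y0 x1 y1 no; rewrite -!col_dist_transpose.
apply: (strip_col (fans_transpose L1 F) hr h0 h1); rewrite ?row_dist_transpose // => t ht.
by rewrite mix_swap_xy => /inseg_swap_xy; exact: no.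
Qed.

Lemma on_col c r0 r1 x : (c < M)%N -> (r0 < M)%N -> (r1 < M)%N ->
  0 < rdist P r0 x -> rdist P r1 x < 0 -> cdist P c x = 0 -> inseg (P (A c)) (P (W c M)) x.
Proof.
move=> hr h0 h1 x0 x1 z; apply: inseg_swap_xy.
by apply: (on_row (fans_transpose L1 F) hr h0 h1); rewrite ?col_dist_transpose ?row_dist_transpose.
Qed.

End Two.

(** The vertex W i j may be on either side of the column i and of the row j, which
start where its own edges start. So the cell reaches from one neighbouring column
and row to the other. *)
Definition in_cell P i j p :=
  [/\ forall c, (c < M.-1)%N -> (c < i)%N -> 0 < cdist P c p,
      forall c, (c < M.-1)%N -> (i < c)%N -> cdist P c p < 0,
      forall r, (r < M.-1)%N -> (r < j)%N -> 0 < rdist P r p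
    & forall r, (r < M.-1)%N -> (j < r)%N -> rdist P r p < 0].

Lemma in_cell_transpose P i j p : in_cell P i j p -> in_cell (transpose_place P) j i (swap_xy p).
Proof. by case=> h1 h2 h3 h4; split=> c; rewrite ?col_dist_transpose ?row_dist_transpose; auto. Qed.

Section Cells.
Variables (P : term -> pt) (k : term -> term -> bool).
Hypothesis F : fans P k.
Hypothesis short : forall s i t l, (s < i)%N -> (i <= M)%N -> (t < l)%N -> (l <= M)%N ->
  ~~ crossing (P (A s)) (P (W s t)) (P (B l)) (P (W i l)).

Ltac gp := apply: (gpP F); rewrite ?fits_A ?fits_B ?fits_W ?termE //=; nlia.

Section Cell.
Variables s t : nat.
Hypotheses (s2 : (1 < s)%N) (t2 : (1 < t)%N) (sM : (s + 2 < M)%N) (tM : (t + 2 < M)%N).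

Let i := M.-1.
Let p := crossing_point P s t i 1.
Let w := P (W s t).

Let hp : [/\ inseg (P (A s)) w p, inseg (P (B 1)) (P (W i 1)) p
    & orient (P (B 1)) (P (W i 1)) p = 0].
Proof. by apply: (crossing_pointP L1 F K8); rewrite /i; nlia. Qed.

Let w_right c : (c < s)%N -> 0 < cdist P c w.
Proof.
move=> cs; have [_] := @cross_sign R L K M L1 P k F K8 c s t M cs ltac:(nlia) ltac:(nlia) ltac:(nlia).
have : cdist P c (P (B t)) < 0 by apply: (col_dist_B L1 K8 M8 F); nlia.
rewrite /col_dist -/w; set x := orient _ _ (P (B t)); set y := orient _ _ w.
set z := orient _ _ (P (B 0)); rewrite !mulNr oppr_lt0 oppr_gt0 => h1 h2.
have nx := same_sign0 h1; have x2 : 0 < x ^+ 2 by rewrite exprn_even_gt0.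
have : (x * y) * (x * z) < 0 by rewrite nmulr_rlt0.
by rewrite (_ : x * y * (x * z) = x ^+ 2 * (y * z)); [rewrite pmulr_rlt0|ring].
Qed.

Let w_above r : (r < t)%N -> 0 < rdist P r w.
Proof.
move=> rt; have [h _] := @cross_sign R L K M L1 P k F K8 s M r t ltac:(nlia) ltac:(nlia) ltac:(nlia) ltac:(nlia).
have : rdist P r (P (A s)) < 0 by apply: (row_dist_A L1 K8 M8 F); nlia.
move: h; rewrite /row_dist -/w; set x := orient _ _ (P (A s)); set y := orient _ _ w.
set z := orient _ _ (P (A 0)); rewrite !mulNr oppr_lt0 oppr_gt0 => h2 h1.
have nx := same_sign0 h1; have x2 : 0 < x ^+ 2 by rewrite exprn_even_gt0.
have : (x * y) * (x * z) < 0 by rewrite nmulr_rlt0.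
by rewrite (_ : x * y * (x * z) = x ^+ 2 * (y * z)); [rewrite pmulr_rlt0|ring].
Qed.

Let w_nz r : (r < M)%N -> r != t -> rdist P r w != 0.
Proof. by move=> rM rt; rewrite /row_dist mulf_neq0 ?oppr_eq0 //; gp. Qed.

(* The columns on either side of [s] enclose the crossing point. *)
Let p_cols c1 : (s < c1)%N -> (c1 < i)%N -> cdist P 0 p * cdist P c1 p < 0.
Proof. by move=> h1 h2; apply: (between_cols L1 K8 M8 F); rewrite /i in h2 *; nlia. Qed.

Let red_no c x : (c < M)%N -> c != s -> inseg (P (A s)) w x ->
  ~ inseg (P (A c)) (P (W c M)) x.
Proof.
move=> hc cs i1 i2; apply: (noncross_red L1 F K8 _ _ _ _ _ i2 i1); nlia.
Qed.

Let no_row r x : (t < r)%N -> (r < M)%N -> inseg (P (A s)) w x ->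
  ~ inseg (P (B r)) (P (W M r)) x.
Proof.
move=> tr rM i1 i2; have := @short s M t r ltac:(nlia) ltac:(nlia) tr ltac:(nlia).
by apply/negP; rewrite negbK; apply: (inseg_crossing i1 i2); gp.
Qed.

(* No row above [t] separates the crossing point from a point of the edge,
   within a strip of rows. *)
Let escape r r' u z : (t < r)%N -> (r < i)%N -> (r' < i)%N ->
  (forall v, 0 <= v < 1 -> inseg (P (A s)) w (mix v p z)) -> 0 <= u < 1 ->
  rdist P r (mix u p z) = 0 ->
  (0 < rdist P r' p /\ 0 < rdist P r' (mix u p z) /\ rdist P r p < 0) \/
  (rdist P r' p < 0 /\ rdist P r' (mix u p z) < 0 /\ 0 < rdist P r p) -> False.
Proof.
move=> tr ri ri' on hu z0 hcase.
have sub v : 0 <= v <= 1 -> inseg (P (A s)) w (mix v p (mix u p z)).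
  move=> /andP[v0 v1]; rewrite -{1}(mix0 p z) mix_mix mulr0 add0r; apply: on.
  case/andP: hu => u0 u1; rewrite mulr_ge0 //=.
  by apply: le_lt_trans u1; rewrite ler_piMl.
have same c : (c < M)%N -> c != s -> 0 < cdist P c p * cdist P c (mix u p z).
  move=> cM cs; have [hr hr'] : (r < M)%N /\ (r' < M)%N by rewrite /i in ri ri'; nlia.
  have no v : 0 <= v <= 1 -> ~ inseg (P (A c)) (P (W c M)) (mix v p (mix u p z)).
    by move=> hv; apply: red_no => //; exact: sub.
  case: hcase => [[a [b d]]|[a [b d]]].
    by apply: (strip_col F cM hr' hr) => //; rewrite ?z0 ?lexx ?ltW.
  by apply: (strip_col F cM hr hr') => //; rewrite ?z0 ?lexx ?ltW.
have s0 := same 0%N ltac:(nlia) ltac:(nlia).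
have s1 := same s.+1 ltac:(nlia) ltac:(nlia).
have pc := @p_cols s.+1 ltac:(nlia) ltac:(rewrite /i; nlia).
apply: (@no_row r (mix u p z)) => //; first by rewrite /i in ri; nlia.
  by rewrite -{1}(mix1 p (mix u p z)); apply: sub; rewrite ler01 lexx.
have rM : (r < M)%N by rewrite /i in ri; nlia.
case: (ltrgt0P (cdist P 0 (mix u p z))) s0 => [h|h|->]; last by rewrite mulr0 ltxx.
  rewrite pmulr_lgt0 // => h0; move: pc; rewrite pmulr_rlt0 // => h1.
  move: s1; rewrite nmulr_rgt0 // => h2.
  by apply: (on_row F rM _ _ h h2 z0); nlia.
rewrite nmulr_lgt0 // => h0; move: pc; rewrite nmulr_rlt0 // => h1.
move: s1; rewrite pmulr_rgt0 // => h2.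
by apply: (on_row F rM _ _ h2 h z0); nlia.
Qed.

(* Rows beyond [t] and row 0 lie on different sides of the crossing point. *)
Let p_rows r : (t < r)%N -> (r < i)%N -> rdist P 0 p * rdist P r p < 0.
Proof.
move=> tr ri; pose p2 := crossing_point P s i i 1.
have rM : (r < M)%N by rewrite /i in ri; nlia.
have h : rdist P 0 p2 * rdist P r p2 < 0 by apply: (between_rows L1 K8 M8 F); rewrite /i in ri *; nlia.
have h0 : 0 < rdist P 0 p * rdist P 0 p2 by apply: (row_dist_crossing_point L1 K8 M8 F); rewrite /i in ri *; nlia.
have hc c : (c < i)%N -> c != s -> 0 < cdist P c p * cdist P c p2.
  by move=> ci cs; apply: (col_dist_crossing_point L1 K8 M8 F); rewrite /i in ri ci *; nlia.
have pc := @p_cols s.+1 ltac:(nlia) ltac:(rewrite /i; nlia).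
have c0 := hc 0%N ltac:(rewrite /i; nlia) ltac:(nlia).
have c1 := hc s.+1 ltac:(rewrite /i; nlia) ltac:(nlia).
have [_ ip _] := hp.
have [_ ip2 _] : [/\ inseg (P (A s)) (P (W s i)) p2, inseg (P (B 1)) (P (W i 1)) p2
    & orient (P (B 1)) (P (W i 1)) p2 = 0].
  by apply: (crossing_pointP L1 F K8); rewrite /i; nlia.
have no v : 0 <= v <= 1 -> ~ inseg (P (B r)) (P (W M r)) (mix v p p2).
  move=> /andP[v0 v1] ir.
  have ib : inseg (P (B 1)) (P (W i 1)) (mix v p p2).
    case: ip => x [/andP[x0 x1] ->]; case: ip2 => y [/andP[y0 y1] ->].
    exists ((1 - v) * x + v * y); split; last by rewrite mix_mix.
    have e := mulr_ge0 v0 (ltW y0); have e' : 0 <= v * (1 - y) by rewrite mulr_ge0 // subr_ge0 ltW.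
    case: (ltrgtP v 1) v1 => // [v1 _|-> _]; last by lra.
    have : 0 < (1 - v) * x by rewrite mulr_gt0 ?subr_gt0.
    have : 0 < (1 - v) * (1 - x) by rewrite mulr_gt0 ?subr_gt0.
    by move=> f f'; apply/andP; split; lra.
  by apply: (noncross_blue L1 F K8 _ _ _ _ _ ib ir); rewrite /i; nlia.
have hr : 0 < rdist P r p * rdist P r p2.
  have [h00 hs1] : (0 < M)%N /\ (s.+1 < M)%N by nlia.
  case: (ltrgt0P (cdist P 0 p)) c0 pc => [a|a|->]; last by rewrite mul0r ltxx.
    rewrite pmulr_rgt0 // => a2; rewrite pmulr_rlt0 // => b; move: c1; rewrite nmulr_rgt0 // => b2.
    by apply: (strip_row F rM h00 hs1) => //; exact: ltW.
  rewrite nmulr_rgt0 // => a2; rewrite nmulr_rlt0 // => b; move: c1; rewrite pmulr_rgt0 // => b2.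
  by apply: (strip_row F rM hs1 h00) => //; exact: ltW.
move: h h0 hr; set x := rdist P 0 p; set y := rdist P r p; set u := rdist P 0 p2; set v := rdist P r p2.
move=> h h0 hr; have e : (u * v) * ((x * u) * (y * v)) < 0 by rewrite nmulr_rlt0 // mulr_gt0.
have nu : u != 0 by apply: (@same_sign0 _ u x); rewrite mulrC.
have nv : v != 0 by apply: (@same_sign0 _ v y); rewrite mulrC.
have e2 : 0 < (u * v) ^+ 2 by rewrite exprn_even_gt0 // mulf_neq0.
by move: e; rewrite (_ : u * v * (x * u * (y * v)) = (u * v) ^+ 2 * (x * y)); [rewrite pmulr_rlt0|ring].
Qed.

(** Columns before s and rows before t are crossed by an edge that ends in W s t.
For the others, consider the point p where the red edge of W s t crosses the blue
edge from B 1: there the order of columns and rows is known. The red edge avoids the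
columns, and it avoids the rows above t by hypothesis; so if it crossed the
line of such a row outside of the row, it would have left the space between two
columns before, and [escape] excludes this. *)
Lemma W_in_cell : in_cell P s t w.
Proof.
have [ip _ _] := hp.
have iM : (i < M)%N by rewrite /i; nlia.
have toW v : 0 <= v < 1 -> inseg (P (A s)) w (mix v p w) by exact: open_to_end.
have toA v : 0 <= v < 1 -> inseg (P (A s)) w (mix v p (P (A s))).
  by move=> hv; apply: insegC; apply: open_to_end => //; exact: insegC.
have pr r : (t < r)%N -> (r < i)%N -> 0 < rdist P 0 p /\ rdist P r p < 0.
  move=> tr ri; have rM : (r < M)%N by nlia.
  have ra : rdist P r (P (A s)) < 0 by apply: (row_dist_A L1 K8 M8 F); nlia.
  have ra0 : rdist P 0 (P (A s)) < 0 by apply: (row_dist_A L1 K8 M8 F); nlia.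
  have := p_rows tr ri; case: (ltrgt0P (rdist P 0 p)) => [a|a|->]; last by rewrite mul0r ltxx.
    by rewrite pmulr_rlt0.
  rewrite nmulr_rlt0 // => b; exfalso.
  have le : rdist P r p * rdist P r (P (A s)) <= 0 by rewrite ltW // pmulr_rlt0.
  have nz : rdist P r p != 0 by rewrite gt_eqF.
  have [v [/andP[v0 _] z v1]] := exists_zero (@affine_row R M P r) le nz.
  have {}v1 : v < 1 by apply: v1; rewrite lt_eqF.
  have hv : 0 <= v < 1 by rewrite ltW.
  apply: (@escape r 0%N v (P (A s)) tr ri _ toA hv z); first by rewrite /i; nlia.
  right; split=> //; split=> //; apply: mix_gt => //; first exact: affine_row.
  by rewrite !ltW.
have t1i : (t.+1 < i)%N by rewrite /i; nlia.
have p0 : 0 < rdist P 0 p by case: (@pr t.+1).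
have below r : (t < r)%N -> (r < i)%N -> rdist P r w < 0.
  move=> tr ri; have [_ b] := pr r tr ri.
  rewrite ltNge le_eqVlt eq_sym (negbTE (w_nz _ _)) /=; [|nlia|nlia].
  apply/negP => a.
  have le : rdist P r p * rdist P r w <= 0 by rewrite ltW // nmulr_rlt0.
  have nz : rdist P r p != 0 by rewrite lt_eqF.
  have [v [/andP[v0 _] z v1]] := exists_zero (@affine_row R M P r) le nz.
  have {}v1 : v < 1 by apply: v1; rewrite gt_eqF.
  have hv : 0 <= v < 1 by rewrite ltW.
  apply: (@escape r 0%N v w tr ri _ toW hv z); first by rewrite /i; nlia.
  left; split=> //; split=> //; apply: mix_lt => //; first exact: affine_row.
    by rewrite !ltW.
  by apply: w_above; nlia.
have cols c : (c < i)%N -> c != s -> 0 < cdist P c p * cdist P c w.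
  move=> ci cs; have [_ b] := pr t.+1 ltac:(nlia) t1i.
  have w0 : 0 < rdist P 0 w by apply: w_above; nlia.
  have w1 : rdist P t.+1 w < 0 by apply: below; nlia.
  apply: (@strip_col P k F c 0%N t.+1); try nlia; try exact: ltW.
  move=> v /andP[v0 v1]; case: (ltrgtP v 1) v1 => // [v1 _|-> _].
    by apply: red_no => //; [nlia|apply: toW; rewrite v0].
  rewrite mix1 => /inseg_online e.
  have : orient (P (A c)) (P (W c M)) (P (W s t)) != 0 by gp.
  by rewrite e eqxx.
split=> [c cM cs|c cM sc|r rM rt|r rM tr].
- exact: w_right.
- have pc := p_cols sc cM; have h0 := cols 0%N ltac:(rewrite /i; nlia) ltac:(nlia).
  have hc := cols c cM ltac:(nlia).
  have := w_right (ltac:(nlia) : (0 < s)%N); move: h0 => /[swap] w0; rewrite pmulr_lgt0 // => p0'.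
  by move: pc hc; rewrite pmulr_rlt0 // => a; rewrite nmulr_rgt0.
- exact: w_above.
exact: below.
Qed.

End Cell.
End Cells.
End Env.

(** * Leaving the grid *)

Section Corner.
Variable R : realFieldType.
Notation pt := (R * R)%type.
Implicit Types (X Y : pt -> R).

Lemma between (y x p m : pt) : inseg y x p -> inseg y p m ->
  exists s, 0 < s < 1 /\ p = mix s m x.
Proof.
move=> [u [/andP[u0 u1] ->]] [v [/andP[v0 v1] ->]].
have uv : u * v < u by rewrite gtr_pMr.
have d : 0 < 1 - u * v by rewrite subr_gt0; apply: lt_trans uv u1.
exists ((u - u * v) / (1 - u * v)); split.
  apply/andP; split; first by apply: divr_gt0; lra.
  by rewrite ltr_pdivrMr // mul1r; lra.
have -> : mix v y (mix u y x) = mix (v * u) y x.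
  by rewrite -{1}(mix0 y x) mix_mix mulr0 add0r.
rewrite -{3}(mix1 y x) mix_mix mulr1; congr mix.
by field; rewrite gt_eqF.
Qed.

Definition line_of X := forall a b c : pt, X a = 0 -> X b = 0 -> X c = 0 -> orient a b c = 0.

Lemma line_of_orient (a b : pt) k : a != b -> k != 0 -> line_of (fun p => k * orient a b p).
Proof.
move=> ab nk x y z /eqP; rewrite mulf_eq0 (negbTE nk) => /eqP x0.
move=> /eqP; rewrite mulf_eq0 (negbTE nk) => /eqP y0.
move=> /eqP; rewrite mulf_eq0 (negbTE nk) => /eqP z0.
have [u ->] := online ab x0; have [v ->] := online ab y0; have [w ->] := online ab z0.
by rewrite /orient /mix /=; ring.
Qed.

Lemma inseg_opp (f : pt -> R) a b p : affine f -> inseg a b p -> f p = 0 -> f b != 0 ->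
  f a * f b < 0.
Proof.
move=> hf [t [/andP[t0 t1] ->]]; rewrite hf => e nb.
have : 0 < t * f b ^+ 2 by rewrite mulr_gt0 // exprn_even_gt0.
have : (1 - t) * (f a * f b) = - (t * f b ^+ 2) by rewrite mulrA (_ : _ * f a = - (t * f b)) ?expr2; [ring|lra].
by move=> e1 h; have : (1 - t) * (f a * f b) < 0 by [lra]; rewrite pmulr_rlt0 ?subr_gt0.
Qed.

Section Half.
Variables (X Y : pt -> R) (n o p1 p2 q1 x1 x2 : pt) (s t : R).
Hypotheses (aX : affine X) (aY : affine Y) (lX : line_of X) (lY : line_of Y).
Hypotheses (s01 : 0 < s < 1) (ep2 : p2 = mix s n x2) (t01 : 0 < t < 1) (eq1 : q1 = mix t n x1).
Hypotheses (Yp1 : Y p1 = 0) (Yp2 : Y p2 = 0) (Xp : X p1 < X p2) (Xp2 : X p2 < 0).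
Hypotheses (Xq1 : X q1 = 0) (Yq1 : Y q1 < 0) (Xo : X o = 0) (Yo : Y o = 0).
Hypotheses (X1 : 0 < X x1) (X2 : 0 < X x2) (Y1 : 0 < Y x1) (Y2 : 0 < Y x2).
Hypotheses (no : forall p, inseg p1 x1 p -> ~ inseg n x2 p) (nx : ~ inseg p1 x1 x2).

(* The line n x2 separates p1 from the point o where X = Y = 0, and q1, hence x1, is on
   the side of o. So p1 x1 crosses that line, and as the edges do not cross, it does so
   beyond x2. *)
Lemma overtake : X x2 < X x1 /\ Y x2 < Y x1.
Proof.
case/andP: (s01) => s0 s1; case/andP: (t01) => t0 t1.
have Yn : Y n < 0.
  move: Yp2; rewrite ep2 aY => e; have h : 0 < s * Y x2 by rewrite mulr_gt0.
  have : (1 - s) * Y n < 0 by lra.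
  by rewrite pmulr_rlt0 ?subr_gt0.
have Xn : X n < 0.
  move: Xp2; rewrite ep2 aX => e; have h : 0 < s * X x2 by rewrite mulr_gt0.
  have : (1 - s) * X n < 0 by lra.
  by rewrite pmulr_rlt0 ?subr_gt0.
have nn : n != x2 by apply/eqP => e; move: Yn; rewrite e ltNge ltW.
pose f := orient n x2; have af : affine f by exact: affine_orient.
have fp2 : f p2 = 0 by rewrite ep2 af /f orient_l orient_r; ring.
have fo : f o != 0.
  apply/eqP => /(online nn)[u e]; move: Yo Xo; rewrite e aY aX => h1 h2.
  have h3 := Yp2; rewrite ep2 aY in h3.
  have e1 : (u - s) * (Y x2 - Y n) = 0 by lra.
  have eu : u = s.
    by move/eqP: e1; rewrite mulf_eq0 !subr_eq0 => /orP[/eqP//|/eqP e2]; move: Yn; rewrite -e2 => /(lt_trans Y2); rewrite ltxx.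
  by move: Xp2; rewrite ep2 aX -eu h2 ltxx.
have f1 : f p1 * f o < 0.
  apply: (inseg_opp af _ fp2 fo); apply: (on_seg aX aX); rewrite ?Xo //; last exact: lY.
    exact: lt_trans Xp2.
  exact: lt_trans Xp2.
have [i z] := @meetP R X p2 x2 aX ltac:(by rewrite nmulr_rlt0).
set m := meet X p2 x2 in i z.
have Ym : 0 < Y m.
  by case: i => u [/andP[u0 u1] ->]; rewrite aY Yp2 mulr0 add0r mulr_gt0.
have fm : f m = 0.
  by case: i => u [_ ->]; rewrite af fp2 (orient_r _ _ : f x2 = 0); ring.
have f2 : 0 < f q1 * f o.
  have [u [/andP[u0 u1] e]] : inseg q1 m o.
    apply: (on_seg aY aY); rewrite ?Yo //; last exact: lX.
      exact: lt_trans Ym.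
    exact: lt_trans Ym.
  have : f o = (1 - u) * f q1 by rewrite e af fm; ring.
  move=> e'; have nz : f q1 != 0 by apply: contraNneq fo => h; rewrite e' h mulr0.
  have h : 0 < f q1 ^+ 2 by rewrite exprn_even_gt0.
  by rewrite e' mulrCA -expr2 mulr_gt0 ?subr_gt0.
have f3 : f p1 * f x1 < 0.
  have e : f q1 = t * f x1 by rewrite eq1 af (orient_l _ _ : f n = 0); ring.
  have : (f p1 * f o) * (f q1 * f o) < 0 by rewrite nmulr_rlt0.
  rewrite e (_ : f p1 * f o * (t * f x1 * f o) = t * f o ^+ 2 * (f p1 * f x1)); last by ring.
  by rewrite pmulr_rlt0 // mulr_gt0 // exprn_even_gt0.
have nz : f p1 != 0 by apply/eqP => e; move: f3; rewrite e mul0r ltxx.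
have nz' : f x1 != 0 by apply/eqP => e; move: f3; rewrite e mulr0 ltxx.
have [u [/andP[u0 _] fz /(_ nz') u1]] := exists_zero af (ltW f3) nz.
set p := mix u p1 x1 in fz.
have ip : inseg p1 x1 p by exists u; rewrite u0 u1.
have [v e] := online nn fz.
have Yp : Y p = u * Y x1 by rewrite aY Yp1; ring.
have Yp_gt : 0 < Y p by rewrite Yp mulr_gt0.
have Ye : Y p = (1 - v) * Y n + v * Y x2 by rewrite e aY.
have Xe : X p = (1 - v) * X n + v * X x2 by rewrite e aX.
have vs : s < v.
  have h : 0 < (v - s) * (Y x2 - Y n) by move: Yp2; rewrite ep2 aY => h; lra.
  by move: h; rewrite pmulr_lgt0 ?subr_gt0 //; apply: lt_trans Yn _.
have v1 : 1 < v.
  rewrite ltNge le_eqVlt; apply/negP => /orP[/eqP ev|lt].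
    by apply: nx; rewrite (_ : x2 = p) // e ev mix1.
  by apply: (no ip); exists v; rewrite e (lt_trans s0 vs) lt.
have hX : 0 < (v - 1) * (X x2 - X n) by rewrite mulr_gt0 ?subr_gt0 // (lt_trans Xn).
have hY : 0 < (v - 1) * (Y x2 - Y n) by rewrite mulr_gt0 ?subr_gt0 // (lt_trans Yn).
have hX1 : 0 < (1 - u) * X x1 by rewrite mulr_gt0 ?subr_gt0.
have hY1 : 0 < (1 - u) * Y x1 by rewrite mulr_gt0 ?subr_gt0.
have Xp' : X p = (1 - u) * X p1 + u * X x1 by rewrite aX.
have hp1 : 0 < (1 - u) * (- X p1) by rewrite mulr_gt0 ?subr_gt0 // oppr_gt0 (lt_trans Xp).
by split; lra.
Qed.

End Half.

(** [overtake] applies to both pairs of edges, with the coordinates exchanged, so each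
of x1 and x2 would be farther out than the other. *)
Lemma double_crossing X Y (n o p1 p2 q1 q2 x1 x2 : pt) s t :
  affine X -> affine Y -> line_of X -> line_of Y ->
  0 < s < 1 -> p2 = mix s n x2 -> 0 < t < 1 -> q1 = mix t n x1 ->
  Y p1 = 0 -> Y p2 = 0 -> X p1 < X p2 -> X p2 < 0 ->
  X q1 = 0 -> X q2 = 0 -> Y q2 < Y q1 -> Y q1 < 0 -> X o = 0 -> Y o = 0 ->
  0 < X x1 -> 0 < X x2 -> 0 < Y x1 -> 0 < Y x2 ->
  (forall p, inseg p1 x1 p -> ~ inseg n x2 p) -> ~ inseg p1 x1 x2 ->
  (forall p, inseg q2 x2 p -> ~ inseg n x1 p) -> ~ inseg q2 x2 x1 -> False.
Proof.
move=> aX aY lX lY s01 ep2 t01 eq1 Yp1 Yp2 Xp Xp2 Xq1 Xq2 Yq Yq1 Xo Yo X1 X2 Y1 Y2 n1 n2 n3 n4.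
have [h _] := overtake aX aY lX lY s01 ep2 t01 eq1 Yp1 Yp2 Xp Xp2 Xq1 Yq1 Xo Yo X1 X2 Y1 Y2 n1 n2.
have [_ h'] := overtake aY aX lY lX t01 eq1 s01 ep2 Xq2 Xq1 Yq Yq1 Yp2 Xp2 Yo Xo Y2 Y1 X2 X1 n3 n4.
by have := lt_trans h h'; rewrite ltxx.
Qed.

(** The edge y2 p2 leaves at the top, and the edge z1 q1 leaves at the right, starting
further left and further up; so the first has to get past the second. The column
Xc = 0 is used to compare the two: its points [u] and [w], on the row Yr = 0 and on
the top row, are on different sides of z1 q1, and y2 and p2 lie with them. *)
Lemma inner_crossing (Xc X Yr Y : pt -> R) (y2 p2 z1 q1 u w : pt) :
  affine Xc -> affine X -> affine Yr -> affine Y -> line_of Xc ->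
  Xc z1 < 0 -> X z1 < 0 -> 0 < Yr z1 -> Y z1 < 0 ->
  0 < Xc q1 -> X q1 = 0 -> 0 < Yr q1 -> Y q1 < 0 ->
  0 < Xc y2 -> X y2 < 0 -> Yr y2 < 0 ->
  0 < Xc p2 -> X p2 < 0 -> Y p2 = 0 ->
  Xc u = 0 -> X u < 0 -> Yr u = 0 -> Y u < 0 ->
  Xc w = 0 -> X w < 0 -> Y w = 0 -> 0 < Yr w ->
  exists n, inseg y2 p2 n /\ inseg z1 q1 n.
Proof.
move=> aXc aX aYr aY lXc zc z1' zr zy qc q0 qr qy yc yx yr pc px py uc ux ur uy wc wx wy wr.
pose f := orient z1 q1; have af : affine f by exact: affine_orient.
have onr p : inseg z1 q1 p -> 0 < Yr p.
  by case=> v [/andP[v0 v1] ->]; apply: mix_lt => //; rewrite !ltW.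
have ony p : inseg z1 q1 p -> Y p < 0.
  by case=> v [/andP[v0 v1] ->]; apply: mix_gt => //; rewrite !ltW.
have h1 : 0 < f y2 * f u.
  apply: (strip aXc aX); rewrite ?uc ?q0 //; try exact: lt_trans zc _.
  move=> v /andP[v0 v1] /onr; rewrite aYr ur.
  have : 0 <= (1 - v) * - Yr y2 by rewrite mulr_ge0 ?subr_ge0 // oppr_ge0 ltW.
  lra.
have h2 : 0 < f p2 * f w.
  apply: (strip aXc aX); rewrite ?wc ?q0 //; try exact: lt_trans zc _.
  by move=> v /andP[v0 v1] /ony; rewrite aY py wy; lra.
have [iv vz] := @meetP R Xc z1 q1 aXc ltac:(by rewrite nmulr_rlt0).
set v := meet _ _ _ in iv vz.
have nw : f w != 0 by apply/eqP => e; move: h2; rewrite e mulr0 ltxx.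
have h3 : f u * f w < 0.
  apply: (@inseg_opp f u w v af _ (inseg_online iv) nw).
  apply: (on_seg aYr aY); rewrite ?ur ?wy //; [exact: onr|exact: ony|exact: lXc].
have h4 : f y2 * f p2 < 0.
  have : (f y2 * f u) * ((f p2 * f w) * (f u * f w)) < 0.
    by rewrite pmulr_rlt0 // nmulr_llt0.
  rewrite (_ : f y2 * f u * (f p2 * f w * (f u * f w)) = (f u * f w) ^+ 2 * (f y2 * f p2)); last by ring.
  by rewrite pmulr_rlt0 // exprn_even_gt0 //=; apply/eqP => e; move: h3; rewrite e ltxx.
have [i z] := meetP af h4; exists (meet f y2 p2); split=> //.
have [s [/andP[s0 s1] e]] := i.
have s01 : 0 <= s <= 1 by rewrite !ltW.
apply: (on_seg aXc aX) => //; rewrite ?q0 //.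
- exact: lt_trans zc _.
- by apply: lt_trans zc _; rewrite e; apply: mix_lt.
by rewrite e; apply: mix_gt.
Qed.

Definition along (X f g : pt -> R) := forall p q, X p = 0 -> X q = 0 -> f p < f q -> g p < g q.

(** Two copies of a vertex x that leave the grid beyond the same corner o, by an edge
y x that crosses the row Y = 0 at p and an edge z x that crosses the column X = 0 at
q. The column Xc = 0 and the row Yr = 0 separate the copies. By [inner_crossing] the
two edges of different colours y2 x2 and z1 x1 cross in a point n inside the grid,
and from there [double_crossing] takes over. *)
Lemma corner (X Xc Y Yr : pt -> R) (o u w y1 z1 x1 p1 q1 y2 z2 x2 p2 q2 : pt) :
  affine X -> affine Xc -> affine Y -> affine Yr -> line_of X -> line_of Y -> line_of Xc ->
  along X Yr Y -> along X Y Yr -> along Y Xc X -> along Y X Xc -> along Xc Yr Y -> along Xc Y Yr ->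
  X o = 0 -> Y o = 0 -> Xc u = 0 -> Yr u = 0 -> Xc w = 0 -> Y w = 0 ->
  (forall p q, Xc p = 0 -> 0 < Yr p -> Y p < 0 -> q = u \/ q = w -> 0 <= Yr q -> Y q <= 0 -> 0 < X p * X q) ->
  (forall p, X p = 0 -> 0 < Yr p -> Y p < 0 -> 0 < Yr o -> 0 < Xc p * Xc o) ->
  inseg y1 x1 p1 -> inseg y2 x2 p2 -> inseg z1 x1 q1 -> inseg z2 x2 q2 ->
  [/\ Y p1 = 0, Xc p1 < 0 & X p1 < 0] -> [/\ Y p2 = 0, 0 < Xc p2 & X p2 < 0] ->
  [/\ X q1 = 0, 0 < Yr q1 & Y q1 < 0] -> [/\ X q2 = 0, Yr q2 < 0 & Y q2 < 0] ->
  0 < X x1 -> 0 < X x2 -> 0 < Y x1 -> 0 < Y x2 ->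
  [/\ Xc z1 < 0, X z1 < 0, 0 < Yr z1 & Y z1 < 0] -> [/\ 0 < Xc y2, X y2 < 0 & Yr y2 < 0] ->
  noncross y1 x1 y2 x2 -> noncross z1 x1 z2 x2 -> ~ inseg y1 x1 x2 -> ~ inseg z2 x2 x1 -> False.
Proof.
move=> aX aXc aY aYr lX lY lXc mX mX' mY mY' mC mC' Xo Yo Xcu Yru Xcw Yw strC strX.
move=> ip1 ip2 iq1 iq2 [Yp1 cp1 Xp1] [Yp2 cp2 Xp2] [Xq1 rq1 Yq1] [Xq2 rq2 Yq2].
move=> X1 X2 Y1 Y2 [cz1 Xz1 rz1 Yz1] [cy2 Xy2 ry2] nR nB e1 e2.
have Xp : X p1 < X p2 by apply: mY => //; lra.
have Yq : Y q2 < Y q1 by apply: mX => //; lra.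
have co : Xc p2 < Xc o by apply: mY' => //; rewrite Xo.
have ro : Yr q1 < Yr o by apply: mX' => //; rewrite Yo.
have cq1 : 0 < Xc q1.
  by have := strX q1 Xq1 rq1 Yq1 ltac:(lra); rewrite pmulr_lgt0 //; lra.
have [iv Xcv] := @meetP R Xc z1 q1 aXc ltac:(by rewrite nmulr_rlt0).
set v := meet _ _ _ in iv Xcv.
have [t [/andP[t0 t1] ev]] := iv.
have Yv : Y v < 0 by rewrite ev; apply: mix_gt => //; rewrite !ltW.
have rv : 0 < Yr v by rewrite ev; apply: mix_lt => //; rewrite !ltW.
have Xv : X v < 0 by rewrite ev aX Xq1 mulr0 addr0 pmulr_rlt0 ?subr_gt0.
have Yu : Y u < Y v by apply: mC => //; rewrite Yru.
have rw : Yr v < Yr w by apply: mC' => //; rewrite Yw.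
have Xu : X u < 0.
  by have := strC v u Xcv rv Yv (or_introl erefl) ltac:(lra) ltac:(lra); rewrite nmulr_rgt0.
have Xw : X w < 0.
  by have := strC v w Xcv rv Yv (or_intror erefl) ltac:(lra) ltac:(lra); rewrite nmulr_rgt0.
have [n [in1 in2]] : exists n, inseg y2 p2 n /\ inseg z1 q1 n.
  by apply: (@inner_crossing Xc X Yr Y y2 p2 z1 q1 u w) => //; lra.
have [s [s01 ep2]] := between ip2 in1; have [s' [s01' eq1]] := between iq1 in2.
apply: (@double_crossing X Y n o p1 p2 q1 q2 x1 x2 s s') => //.
- move=> p i j; apply: (nR p); first by apply: sub_seg ip1 i.
  by apply: sub_seg j; apply/insegC/(sub_seg (insegC ip2))/insegC.
- by move=> i; apply: e1; apply: sub_seg ip1 i.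
- move=> p i j; apply: (nB p); last by apply: sub_seg iq2 i.
  by apply: sub_seg j; apply/insegC/(sub_seg (insegC iq1))/insegC.
by move=> i; apply: e2; apply: sub_seg iq2 i.
Qed.

End Corner.

Section Requests.
Variable R : realFieldType.
Notation pt := (R * R)%type.
Variables (L K n : nat).
Hypothesis L1 : (0 < L)%N.
Hypothesis K8 : (8 <= K)%N.
Hypothesis n4 : (4 <= n)%N.
Implicit Types (P : term -> pt) (k : term -> term -> bool).
Notation M := n.+4.
Notation T := n.+2.
Notation cdist := (col_dist M).
Notation rdist := (row_dist M).
Notation in_cell := (@in_cell R M).
Notation fans := (@fans R L K M).

Let M8 : (8 <= M)%N. Proof. by []. Qed.

(** Terms whose labels avoid the first two and the last three ones, which are
reserved for the extreme columns and rows, and as ends of columns and rows. *)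
Definition inner_term x :=
  [&& depth x <= L, all (fun i => 1 < i < T) (labels true x) & all (fun i => 1 < i < T) (labels false x)]%N.

Lemma inner_fits x : inner_term x -> fits L M.+1 M.+1 x.
Proof.
move=> /and3P[h h1 h2]; rewrite /fits h /=.
by apply/andP; split; [move: h1|move: h2]; apply: sub_all => i; clear; lia.
Qed.

Lemma inner_W x c d : (d >= T)%N || (c >= T)%N || (c < 2)%N || (d < 2)%N ->
  inner_term x -> x != W c d.
Proof.
move=> h /and3P[_ h1 h2]; apply/eqP => e; move: h h1 h2; rewrite e /= !andbT; clear; lia.
Qed.

Lemma inner_B x d : (d >= T)%N || (d < 2)%N -> inner_term x -> x != B d.
Proof. by move=> h /and3P[_ h1 h2]; apply/eqP => e; move: h h1 h2; rewrite e /= !andbT; clear; lia. Qed.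

Lemma inner_transpose x : inner_term (transpose x) = inner_term x.
Proof.
rewrite /inner_term depth_transpose; congr andb; rewrite andbC.
by congr andb; apply: eq_all_r => i; rewrite labels_transpose.
Qed.

Lemma inner_child x y : inner_term x -> child x y -> inner_term y.
Proof.
case: x => // a b; rewrite /inner_term /= !all_cat.
move=> /and3P[h /andP[h1 h2] /andP[h3 h4]] /orP[]/eqP->; rewrite ?h1 ?h2 ?h3 ?h4 !andbT.
  by apply: leq_trans h; rewrite ltnW // ltnS leq_maxl.
by apply: leq_trans h; rewrite ltnW // ltnS leq_maxr.
Qed.

Section One.
Variables (P : term -> pt) (k : term -> term -> bool).
Hypothesis F : fans P k.

Ltac gp := apply: (gpP F); rewrite ?fits_A ?fits_B ?fits_W ?termE //=; nlia.

Lemma edge_noncross x y x' y' : fits L M.+1 M.+1 x -> fits L M.+1 M.+1 x' -> child x y -> child x' y' ->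
  (x, y) != (x', y') -> k x y = k x' y' -> noncross (P y) (P x) (P y') (P x').
Proof.
move=> h h' c c' ne e p /insegC i /insegC i'.
by case: (fans_drawing F) => _ nc; apply: (nc _ _ _ _ h h' c c' ne e p i i').
Qed.

Lemma row_dist_neq0 r x : (r < M)%N -> fits L M.+1 M.+1 x -> x != B r -> x != W M r -> rdist P r (P x) != 0.
Proof.
move=> rM lx xb xw; rewrite mulf_neq0 ?oppr_eq0 //; last by gp.
apply: (gpP F); rewrite ?fits_B ?fits_W ?termE //; try nlia; by rewrite eq_sym.
Qed.

Lemma order_on_col c r r' p q : (c < M)%N -> (r < M)%N -> (r' < M)%N ->
  cdist P c p = 0 -> cdist P c q = 0 -> rdist P r p < rdist P r q -> rdist P r' p < rdist P r' q.
Proof.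
move=> cM rM rM' zp zq.
have d := row_dist_A L1 K8 M8 F cM rM; have d' := row_dist_A L1 K8 M8 F cM rM'.
have u := row_dist_W L1 K8 M8 F cM rM; have u' := row_dist_W L1 K8 M8 F cM rM'.
have nz : orient (P (A c)) (P (W c M)) (P (B 0)) != 0 by gp.
have z x : cdist P c x = 0 -> orient (P (A c)) (P (W c M)) x = 0.
  by move=> /eqP; rewrite mulf_eq0 (negbTE nz) orbF oppr_eq0 => /eqP.
by apply: (mono_line (@affine_row R M P r) (@affine_row R M P r') (lt_trans d u) (lt_trans d' u')); apply: z.
Qed.

Lemma line_col c : (c < M)%N -> line_of (cdist P c).
Proof.
move=> cM; have nz : orient (P (A c)) (P (W c M)) (P (B 0)) != 0 by gp.
have ne : P (A c) != P (W c M).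
  by apply/eqP => e; move: nz; rewrite e /orient !subrr !mul0r subrr eqxx.
move=> a b d h1 h2 h3.
have z x : cdist P c x = 0 -> orient (P (A c)) (P (W c M)) (P (B 0)) * orient (P (A c)) (P (W c M)) x = 0.
  by move=> e; rewrite mulrC -[LHS]opprK -mulNr -[- _ * _]/(cdist P c x) e oppr0.
exact: (line_of_orient ne nz (z _ h1) (z _ h2) (z _ h3)).
Qed.

Definition grid_point c r := meet (rdist P r) (P (A c)) (P (W c M)).

Lemma grid_pointP c r : (c < M)%N -> (r < M)%N ->
  [/\ inseg (P (A c)) (P (W c M)) (grid_point c r), rdist P r (grid_point c r) = 0 & cdist P c (grid_point c r) = 0].
Proof.
move=> cM rM; have d := row_dist_A L1 K8 M8 F cM rM; have u := row_dist_W L1 K8 M8 F cM rM.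
have [i z] := @meetP R (rdist P r) (P (A c)) (P (W c M)) (@affine_row R M P r) ltac:(by rewrite nmulr_rlt0).
by split=> //; rewrite /col_dist (inseg_online i) oppr0 mul0r.
Qed.

(** A red edge does not cross the column, so [strip_col] applies. The edge may end
inside the grid, at P x, or be cut off at a border, at p. *)
Lemma keep_col c r0 r1 x y p : (c < M)%N -> (r0 < M)%N -> (r1 < M)%N ->
  fits L M.+1 M.+1 x -> child x y -> k x y = true -> (x, y) != (W c M, A c) ->
  y != A c -> y != W c M -> x != A c -> x != W c M ->
  p = P x \/ inseg (P y) (P x) p ->
  0 <= rdist P r0 (P y) -> 0 <= rdist P r0 p -> rdist P r1 (P y) <= 0 -> rdist P r1 p <= 0 ->
  0 < cdist P c (P y) * cdist P c p.
Proof.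
move=> cM hr0 hr1 lx cxy kxy ne ya yw xa xw hp y0 p0 y1 p1.
apply: (strip_col L1 K8 M8 F cM hr0 hr1) => // t /andP[t0 t1].
have ly := fits_child lx cxy.
have off (z : term) : fits L M.+1 M.+1 z -> z != A c -> z != W c M -> ~ inseg (P (A c)) (P (W c M)) (P z).
  move=> lz za zw /inseg_online e.
  have : orient (P (A c)) (P (W c M)) (P z) != 0.
    by apply: (gpP F); rewrite ?fits_A ?fits_W ?termE // ?(eq_sym _ z) ?ltnS // ltnW.
  by rewrite e eqxx.
have no : noncross (P y) (P x) (P (A c)) (P (W c M)).
  by apply: edge_noncross => //; rewrite ?fits_W ?kxy ?(fans_red F) //= ?eqxx // ?ltnS // ltnW.
case: (ltrgtP t 0) t0 => // [t0|->] _; last by rewrite mix0; apply: off.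
case: hp => [->|[u [/andP[u0 u1] ep]]].
  case: (ltrgtP t 1) t1 => // [t1|->] _; last by rewrite mix1; apply: off.
  by apply: no; exists t; rewrite t0 t1.
apply: no; exists (t * u); rewrite mulr_gt0 //=; split.
  by apply: le_lt_trans u1; rewrite ler_piMl // ltW.
by rewrite ep -{1}(mix0 (P y) (P x)) mix_mix mulr0 add0r.
Qed.

End One.

(** Directions are booleans, so that one statement covers the four borders and the
four corners of the grid: [true] stands for increasing labels. *)
Definition sg (b : bool) (x : R) := if b then x else - x.
Definition signed_col P b c p := sg b (cdist P c p).
Definition signed_row P b r p := sg b (rdist P r p).
Definition extreme (b : bool) := if b then T else 0%N.
Definition before (b : bool) (i j : nat) := if b then (i < j)%N else (j < i)%N.

Lemma sg_eq0 b x : (sg b x == 0) = (x == 0).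
Proof. by case: b => //=; rewrite oppr_eq0. Qed.

Lemma mulr_sg b x y : sg b x * sg b y = x * y.
Proof. by case: b => //=; rewrite mulrNN. Qed.

Lemma affine_signed_col P b c : affine (signed_col P b c).
Proof. by move=> t p q; rewrite /signed_col affine_col; case: b => //=; ring. Qed.

Lemma affine_signed_row P b c : affine (signed_row P b c).
Proof. by move=> t p q; rewrite /signed_row affine_row; case: b => //=; ring. Qed.

Lemma signed_col_transpose P b c p : signed_col (transpose_place P) b c (swap_xy p) = signed_row P b c p.
Proof. by rewrite /signed_col col_dist_transpose. Qed.

Lemma signed_row_transpose P b c p : signed_row (transpose_place P) b c (swap_xy p) = signed_col P b c p.
Proof. by rewrite /signed_row row_dist_transpose. Qed.

Lemma orient_transpose_eq0 (a b c : pt) : orient (swap_xy a) (swap_xy b) (swap_xy c) = 0 -> orient a b c = 0.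
Proof. by rewrite orient_swap_xy => /eqP; rewrite oppr_eq0 => /eqP. Qed.

(** The edge from y to x leaves the grid across its extreme row in direction b. The
lines of the two extreme rows may meet, so x may be beyond both; the second condition
says that this row is passed first. *)
Definition vertical_exit P b x y :=
  0 < signed_row P b (extreme b) (P x) /\
  signed_row P (~~ b) (extreme (~~ b)) (meet (signed_row P b (extreme b)) (P y) (P x)) <= 0.
Definition horizontal_exit P b x y :=
  0 < signed_col P b (extreme b) (P x) /\
  signed_col P (~~ b) (extreme (~~ b)) (meet (signed_col P b (extreme b)) (P y) (P x)) <= 0.

Lemma meet_ext (f g : pt -> R) a b : f =1 g -> meet f a b = meet g a b.
Proof. by move=> e; rewrite /meet !e. Qed.

Lemma vexit_transpose P b x y : vertical_exit (transpose_place P) b (transpose x) (transpose y) <-> horizontal_exit P b x y.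
Proof.
rewrite /vertical_exit /horizontal_exit /transpose_place !transposeK signed_row_transpose.
suff -> : meet (signed_row (transpose_place P) b (extreme b)) (swap_xy (P y)) (swap_xy (P x)) = swap_xy (meet (signed_col P b (extreme b)) (P y) (P x)).
  by rewrite signed_row_transpose.
by rewrite /meet !signed_row_transpose.
Qed.

(* If the segment passes both lines, it passes one of them first. *)
Lemma leave (f g : pt -> R) y x : affine f -> affine g -> f y < 0 -> g y < 0 ->
  (0 < f x) || (0 < g x) -> (0 < f x /\ g (meet f y x) <= 0) \/ (0 < g x /\ f (meet g y x) <= 0).
Proof.
move=> af ag fy gy; case: (ltP 0 (f x)) => /= fx gx; last first.
  right; split=> //; have [[t [/andP[t0 t1] ->]] _] := @meetP R g y x ag ltac:(by rewrite nmulr_rlt0).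
  rewrite af; have : (1 - t) * f y < 0 by rewrite pmulr_rlt0 ?subr_gt0.
  have : t * f x <= 0 by rewrite pmulr_rle0.
  lra.
have [le|gt] := leP (g (meet f y x)) 0; [by left|right].
have [[t [/andP[t0 t1] e]] z] := @meetP R f y x af ltac:(by rewrite nmulr_rlt0).
have gx' : 0 < g x.
  rewrite -(pmulr_rgt0 _ t0); move: gt; rewrite e ag => h.
  have : (1 - t) * g y < 0 by rewrite pmulr_rlt0 ?subr_gt0.
  lra.
split=> //; have [[s [/andP[s0 s1] es]] zs] := @meetP R g y x ag ltac:(by rewrite nmulr_rlt0).
rewrite es af; move: z zs gt; rewrite e es !af !ag => z zs gt.
have st : 0 < (t - s) * (g x - g y) by lra.
have {}st : s < t by move: st; rewrite pmulr_lgt0 ?subr_gt0 //; lra.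
have : 0 < (t - s) * (f x - f y) by rewrite mulr_gt0 ?subr_gt0 //; lra.
lra.
Qed.

Section Answer.
Variables (P : term -> pt) (k : term -> term -> bool).
Hypothesis F : fans P k.

(** [keep_col] for edges that start in a cell, with the extreme rows as the strip. *)
Lemma keep_red c x y i j p : inner_term x -> child x y -> k x y = true ->
  (1 < i < T)%N -> (1 < j < T)%N -> in_cell P i j (P y) -> (c < M)%N ->
  p = P x \/ inseg (P y) (P x) p -> 0 <= rdist P 0 p -> rdist P T p <= 0 ->
  0 < cdist P c (P y) * cdist P c p.
Proof.
move=> ix cxy kxy hi hj [h1 h2 h3 h4] cM hp p0 pT.
have iy := inner_child ix cxy.
have y0 : 0 < rdist P 0 (P y) by apply: h3; nlia.
have yT : rdist P T (P y) < 0 by apply: h4; nlia.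
have xw : x != W c M by apply: inner_W ix; nlia.
apply: (@keep_col P k F c 0%N T x y p cM) => //; try exact: ltW.
- exact: inner_fits.
- by rewrite xpair_eqE (negbTE xw).
- by apply/eqP => e; move: y0; rewrite e ltNge ltW // (row_dist_A L1 K8 M8 F).
- by apply: inner_W iy; nlia.
by apply/eqP => e; move: cxy; rewrite e.
Qed.

Lemma signed_row_neq0 b x : inner_term x -> signed_row P b (extreme b) (P x) != 0.
Proof.
move=> ix; rewrite /signed_row sg_eq0; apply: (row_dist_neq0 F); rewrite ?inner_fits //; first by case: b.
  by apply: inner_B ix; case: b => /=; nlia.
by apply: inner_W ix; case: b => /=; nlia.
Qed.
End Answer.

Section Answers.
Variables (P : term -> pt) (k : term -> term -> bool).
Hypothesis F : fans P k.

Lemma keep_blue r x y i j p : inner_term x -> child x y -> k x y = false ->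
  (1 < i < T)%N -> (1 < j < T)%N -> in_cell P i j (P y) -> (r < M)%N ->
  p = P x \/ inseg (P y) (P x) p -> 0 <= cdist P 0 p -> cdist P T p <= 0 ->
  0 < rdist P r (P y) * rdist P r p.
Proof.
move=> ix cxy kxy hi hj hc rM hp p0 pT.
have hs : transpose_place P (transpose y) = swap_xy (P y) by rewrite /transpose_place transposeK.
have := @keep_red _ _ (fans_transpose L1 F) r (transpose x) (transpose y) j i (swap_xy p).
rewrite hs !col_dist_transpose !row_dist_transpose; apply; rewrite ?inner_transpose ?child_transpose // /transpose_colour ?transposeK ?kxy //.
  exact: in_cell_transpose.
rewrite /transpose_place transposeK; case: hp => [->|h]; [by left|right].
by apply: inseg_swap_xy; rewrite !swap_xyK.
Qed.

Lemma signed_col_neq0 b x : inner_term x -> signed_col P b (extreme b) (P x) != 0.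
Proof.
move=> ix; have := @signed_row_neq0 _ _ (fans_transpose L1 F) b (transpose x).
by rewrite /transpose_place transposeK inner_transpose signed_row_transpose => ->.
Qed.

Lemma in_cell_same i j i' j' p p' q : in_cell P i j p -> in_cell P i' j' p' ->
  (forall c, (c < M)%N -> 0 < cdist P c p * cdist P c q) ->
  (forall r, (r < M)%N -> 0 < rdist P r p' * rdist P r q) -> in_cell P i j' q.
Proof.
move=> [h1 h2 _ _] [_ _ h3 h4] hc hr; split=> c cM ci.
- by have := hc c (ltnW cM); rewrite pmulr_rgt0 // h1.
- by have := hc c (ltnW cM); rewrite nmulr_rgt0 // h2.
- by have := hr c (ltnW cM); rewrite pmulr_rgt0 // h3.
by have := hr c (ltnW cM); rewrite nmulr_rgt0 // h4.
Qed.

Lemma in_grid i j p : (1 < i < T)%N -> (1 < j < T)%N -> in_cell P i j p ->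
  (forall b, signed_col P b (extreme b) p < 0) /\ (forall b, signed_row P b (extreme b) p < 0).
Proof.
move=> hi hj [h1 h2 h3 h4]; split=> -[]; rewrite /signed_col /signed_row /= ?oppr_lt0;
  by [apply: h2; nlia|apply: h1; nlia|apply: h4; nlia|apply: h3; nlia].
Qed.

(** If x is between the extreme rows, its red edge has kept the column of y, thus x
is between the extreme columns, and its blue edge has kept the row of z; and vice
versa. Otherwise the red edge leaves across an extreme row, and the blue edge across
an extreme column. *)
Lemma answer x y z i1 j1 i2 j2 : inner_term x -> child x y -> child x z ->
  k x y = true -> k x z = false ->
  (1 < i1 < T)%N -> (1 < j1 < T)%N -> (1 < i2 < T)%N -> (1 < j2 < T)%N ->
  in_cell P i1 j1 (P y) -> in_cell P i2 j2 (P z) ->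
  in_cell P i1 j2 (P x) \/
  (vertical_exit P true x y \/ vertical_exit P false x y) /\ (horizontal_exit P true x z \/ horizontal_exit P false x z).
Proof.
move=> ix cy cz ky kz hi1 hj1 hi2 hj2 hy hz.
case: (hy) => y1 y2 y3 y4; case: (hz) => z1 z2 z3 z4.
have [yh yv] := in_grid hi1 hj1 hy; have [zh zv] := in_grid hi2 hj2 hz.
have eM b : (extreme b < M)%N by case: b.
have col c : (c < M)%N -> signed_row P true (extreme true) (P x) < 0 -> signed_row P false (extreme false) (P x) < 0 -> 0 < cdist P c (P y) * cdist P c (P x).
  move=> cM a b; apply: (keep_red F ix cy ky hi1 hj1 hy cM); [by left| |exact: ltW].
  by move: b; rewrite /signed_row /= oppr_lt0 => /ltW.
have row r : (r < M)%N -> signed_col P true (extreme true) (P x) < 0 -> signed_col P false (extreme false) (P x) < 0 -> 0 < rdist P r (P z) * rdist P r (P x).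
  move=> rM a b; apply: (keep_blue ix cz kz hi2 hj2 hz rM); [by left| |exact: ltW].
  by move: b; rewrite /signed_col /= oppr_lt0 => /ltW.
have inX b : signed_row P true (extreme true) (P x) < 0 -> signed_row P false (extreme false) (P x) < 0 -> signed_col P b (extreme b) (P x) < 0.
  by move=> h h'; have := col _ (eM b) h h'; rewrite -(mulr_sg b) nmulr_rgt0 //; exact: yh.
have inY b : signed_col P true (extreme true) (P x) < 0 -> signed_col P false (extreme false) (P x) < 0 -> signed_row P b (extreme b) (P x) < 0.
  by move=> h h'; have := row _ (eM b) h h'; rewrite -(mulr_sg b) nmulr_rgt0 //; exact: zv.
have nY b := signed_row_neq0 F b ix; have nX b := signed_col_neq0 b ix.
have sgn (u v : R) : u != 0 -> v != 0 -> (u < 0 /\ v < 0) \/ (0 < u) || (0 < v).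
  by case: ltrgt0P => // _ _; case: ltrgt0P => // _ _; by [right|left].
have same : signed_row P true (extreme true) (P x) < 0 -> signed_row P false (extreme false) (P x) < 0 ->
    signed_col P true (extreme true) (P x) < 0 -> signed_col P false (extreme false) (P x) < 0 -> in_cell P i1 j2 (P x).
  by move=> *; apply: (in_cell_same hy hz) => *; [exact: col|exact: row].
case: (sgn _ _ (nY true) (nY false)) => [[v1 v2]|v].
  by left; apply: same => //; exact: inX.
case: (sgn _ _ (nX true) (nX false)) => [[h1 h2]|h].
  by left; apply: same => //; exact: inY.
right; split.
  exact: (@leave (signed_row P true (extreme true)) (signed_row P false (extreme false)) (P y) (P x) (@affine_signed_row P true _) (@affine_signed_row P false _) (yv true) (yv false) v).
exact: (@leave (signed_col P true (extreme true)) (signed_col P false (extreme false)) (P z) (P x) (@affine_signed_col P true _) (@affine_signed_col P false _) (zh true) (zh false) h).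
Qed.

Lemma along_col c b r r' : (c < M)%N -> (r < M)%N -> (r' < M)%N ->
  forall b', along (signed_col P b' c) (signed_row P b r) (signed_row P b r').
Proof.
move=> hc hr hr' b' p q /eqP; rewrite sg_eq0 => /eqP zp /eqP; rewrite sg_eq0 => /eqP zq.
by case: b; rewrite /signed_row /= ?ltrN2; apply: (order_on_col F hc).
Qed.

Lemma line_signed_col b c : (c < M)%N -> line_of (signed_col P b c).
Proof.
move=> cM p q s /eqP; rewrite sg_eq0 => /eqP zp /eqP; rewrite sg_eq0 => /eqP zq.
by move=> /eqP; rewrite sg_eq0 => /eqP zs; exact: (line_col F cM).
Qed.

Lemma strip_cols v r c c' p q b b' : (r < M)%N -> (r != extreme v) -> (c < M)%N -> (c' < M)%N -> c != c' ->
  signed_col P b c p = 0 -> 0 < signed_row P v r p -> signed_row P v (extreme v) p < 0 ->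
  inseg (P (A c)) (P (W c M)) q -> 0 <= signed_row P v r q -> signed_row P v (extreme v) q <= 0 ->
  0 < signed_col P b' c' p * signed_col P b' c' q.
Proof.
move=> hr re hc hc' cc /eqP; rewrite sg_eq0 => /eqP zp rp yp iq rq yq.
have ip : inseg (P (A c)) (P (W c M)) p.
  case: v re rp yp {rq yq} => re; rewrite /signed_row /= ?oppr_gt0 ?oppr_lt0 => rp yp.
    exact: (on_col L1 K8 M8 F hc hr _ rp yp zp).
  exact: (on_col L1 K8 M8 F hc _ hr yp rp zp).
have no t : 0 <= t <= 1 -> ~ inseg (P (A c')) (P (W c' M)) (mix t p q).
  move=> /andP[t0 t1] i; have ne : (W c M, A c) != (W c' M, A c').
    by rewrite xpair_eqE !termE (negbTE cc).
  have lW d : (d < M)%N -> fits L M.+1 M.+1 (W d M) by move=> hd; rewrite fits_W ?ltnS // ltnW.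
  have chW d : child (W d M) (A d) by rewrite /= eqxx.
  have kW : k (W c M) (A c) = k (W c' M) (A c') by rewrite !(fans_red F) // ltnW.
  apply: (edge_noncross F (lW c hc) (lW c' hc') (chW c) (chW c') ne kW _ i).
  case: (ltrgtP t 1) t1 => // [t1 _|-> _]; last by rewrite mix1.
  case: (ltrgtP t 0) t0 => // [t0 _|-> _]; last by rewrite mix0.
  case: ip iq => [s [/andP[s0 s1] ->]] [s' [/andP[s0' s1'] ->]].
  exists ((1 - t) * s + t * s'); rewrite mix_mix; split=> //.
  have h1 : 0 < (1 - t) * s by rewrite mulr_gt0 ?subr_gt0.
  have h2 : 0 < t * s' by rewrite mulr_gt0.
  have h3 : 0 < (1 - t) * (1 - s) by rewrite mulr_gt0 ?subr_gt0.
  have h4 : 0 < t * (1 - s') by rewrite mulr_gt0 ?subr_gt0.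
  by apply/andP; split; lra.
rewrite mulr_sg; case: v re rp yp rq yq => re; rewrite /signed_row /= ?oppr_gt0 ?oppr_lt0 ?oppr_ge0 ?oppr_le0 => rp yp rq yq.
  by apply: (strip_col L1 K8 M8 F hc' hr (_ : (T < M)%N)) => //; exact: ltW.
by apply: (@strip_col R L K M L1 K8 M8 P k F c' 0%N r) => //; exact: ltW.
Qed.

Lemma same_col v b c x y i j : inner_term x -> child x y -> k x y = true ->
  (1 < i < T)%N -> (1 < j < T)%N -> in_cell P i j (P y) -> vertical_exit P v x y -> (c < M)%N ->
  0 < signed_col P b c (P y) * signed_col P b c (meet (signed_row P v (extreme v)) (P y) (P x)).
Proof.
move=> ix cxy kxy hi hj hy [e1 e2] cM; rewrite mulr_sg.
have [_ /(_ v) yv] := in_grid hi hj hy.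
have [ip zp] := @meetP R (signed_row P v (extreme v)) (P y) (P x) (@affine_signed_row P v _) ltac:(by rewrite nmulr_rlt0).
set p := meet _ _ _ in e2 ip zp *.
apply: (keep_red F ix cxy kxy hi hj hy cM); [by right| |]; case: v {yv e1 ip} @p e2 zp => p e2 zp.
- by move: e2; rewrite /signed_row /= oppr_le0.
- by move/eqP: zp; rewrite /signed_row /= oppr_eq0 => /eqP->.
- by move: zp; rewrite /signed_row /= => ->.
by move: e2; rewrite /signed_row.
Qed.

End Answers.

Section Corners.
Variables (P : term -> pt) (k : term -> term -> bool).
Hypothesis F : fans P k.
Let F' := fans_transpose L1 F.

Lemma line_of_transpose (X X' : pt -> R) : (forall p, X' (swap_xy p) = X p) -> line_of X' -> line_of X.
Proof.
move=> e l a b c h1 h2 h3; apply: orient_transpose_eq0; apply: l; by rewrite e.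
Qed.

Lemma line_signed_row b r : (r < M)%N -> line_of (signed_row P b r).
Proof.
move=> hr; apply: (@line_of_transpose (signed_row P b r) (signed_col (transpose_place P) b r)); last exact: (line_signed_col F').
by move=> p; rewrite signed_col_transpose.
Qed.

Lemma along_row r b c c' : (r < M)%N -> (c < M)%N -> (c' < M)%N ->
  forall b', along (signed_row P b' r) (signed_col P b c) (signed_col P b c').
Proof.
move=> hr hc hc' b' p q; have := @along_col _ _ F' r b c c' hr hc hc' b' (swap_xy p) (swap_xy q).
by rewrite !signed_col_transpose !signed_row_transpose.
Qed.

Lemma same_row v b r x z i j : inner_term x -> child x z -> k x z = false ->
  (1 < i < T)%N -> (1 < j < T)%N -> in_cell P i j (P z) -> horizontal_exit P v x z -> (r < M)%N ->
  0 < signed_row P b r (P z) * signed_row P b r (meet (signed_col P v (extreme v)) (P z) (P x)).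
Proof.
move=> ix cxz kxz hi hj hz e rM.
have hs u : transpose_place P (transpose u) = swap_xy (P u) by rewrite /transpose_place transposeK.
have := @same_col _ _ F' v b r (transpose x) (transpose z) j i.
rewrite !hs inner_transpose child_transpose /transpose_colour !transposeK kxz.
have -> : meet (signed_row (transpose_place P) v (extreme v)) (swap_xy (P z)) (swap_xy (P x)) =
   swap_xy (meet (signed_col P v (extreme v)) (P z) (P x)) by rewrite /meet !signed_row_transpose.
rewrite !signed_col_transpose; apply=> //; [exact: in_cell_transpose|exact/vexit_transpose].
Qed.

Lemma in_cell_signed_col b c i j p : in_cell P i j p -> (c < M.-1)%N ->
  (before b c i -> 0 < signed_col P b c p) /\ (before b i c -> signed_col P b c p < 0).
Proof.
move=> [h1 h2 _ _] cM; case: b; rewrite /signed_col /= ?oppr_gt0 ?oppr_lt0; split=> h;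
  by [apply: h1|apply: h2].
Qed.

Lemma in_cell_signed_row b c i j p : in_cell P i j p -> (c < M.-1)%N ->
  (before b c j -> 0 < signed_row P b c p) /\ (before b j c -> signed_row P b c p < 0).
Proof.
move=> [_ _ h1 h2] cM; case: b; rewrite /signed_row /= ?oppr_gt0 ?oppr_lt0; split=> h;
  by [apply: h1|apply: h2].
Qed.

(** The exceptional case of [answer], with the corner given by its two
directions. *)
Record beyond h v x y z i j i' j' : Prop := Beyond {
  beyond_inner : inner_term x;
  beyond_red : child x y /\ k x y = true;
  beyond_blue : child x z /\ k x z = false;
  beyond_col : (1 < i < T)%N && (1 < i' < T)%N;
  beyond_row : (1 < j < T)%N && (1 < j' < T)%N;
  beyond_cells : in_cell P i j (P y) /\ in_cell P i' j' (P z);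
  beyond_exits : vertical_exit P v x y /\ horizontal_exit P h x z }.

(** [corner], with the column [c] and the row [r] between the two copies. Their
positions are such that the inner edges of different colours have to cross: copy 1
is behind c and beyond r with respect to the corner (h, v), copy 2 is beyond c and
behind r. *)
Lemma no_corner h v c r x1 y1 z1 x2 y2 z2 i1 j1 i1' j1' i2 j2 i2' j2' :
  beyond h v x1 y1 z1 i1 j1 i1' j1' -> beyond h v x2 y2 z2 i2 j2 i2' j2' ->
  x1 != x2 -> y1 != x2 -> z2 != x1 -> (1 < c < T)%N -> (1 < r < T)%N ->
  [&& before h i1 c, before h i1' c, before h c i2 & before h c i2'] ->
  [&& before v r j1, before v r j1', before v j2 r & before v j2' r] -> False.
Proof.
move=> [in1 [cy1 ky1] [cz1 kz1] /andP[ci1 ci1'] /andP[cj1 cj1'] [hy1 hz1] [v1 h1]].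
move=> [in2 [cy2 ky2] [cz2 kz2] /andP[ci2 ci2'] /andP[cj2 cj2'] [hy2 hz2] [v2 h2]].
move=> nx ny nz hc hr /and4P[b1 b1' b2 b2'] /and4P[d1 d1' d2 d2'].
have eM b : (extreme b < M)%N by case: b.
have near i : (1 < i < T)%N -> [/\ (i < M)%N, (i < M.-1)%N & forall b, i != extreme b].
  by move=> hi; split=> [||[]]; rewrite /extreme; clear -hi; lia.
have [cM cM' /(_ h)] := near c hc; rewrite eq_sym => ce.
have [rM rM' re] := near r hr.
pose X := signed_col P h (extreme h); pose Xc := signed_col P h c; pose Y := signed_row P v (extreme v); pose Yr := signed_row P v r.
have [go1 go2 go3] := grid_pointP F (eM h) (eM v).
have [gu1 gu2 gu3] := grid_pointP F cM rM.
have [gw1 gw2 gw3] := grid_pointP F cM (eM v).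
set o := grid_point P (extreme h) (extreme v) in go1 go2 go3.
set u := grid_point P c r in gu1 gu2 gu3; set w := grid_point P c (extreme v) in gw1 gw2 gw3.
have e0 b : sg b 0 = 0 by case: b; rewrite /= ?oppr0.
have inX x i j (hi : (1 < i < T)%N) (hj : (1 < j < T)%N) (hx : in_cell P i j x) :
  X x < 0 /\ Y x < 0 by have [a b] := in_grid hi hj hx; split; [exact: a|exact: b].
have [Xy1 Yy1] := inX _ _ _ ci1 cj1 hy1; have [Xz1 Yz1] := inX _ _ _ ci1' cj1' hz1.
have [Xy2 Yy2] := inX _ _ _ ci2 cj2 hy2; have [Xz2 Yz2] := inX _ _ _ ci2' cj2' hz2.
have yc1 : Xc (P y1) < 0 by apply: (in_cell_signed_col _ hy1 cM').2.
have zc1 : Xc (P z1) < 0 by apply: (in_cell_signed_col _ hz1 cM').2.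
have yc2 : 0 < Xc (P y2) by apply: (in_cell_signed_col _ hy2 cM').1.
have yr2 : Yr (P y2) < 0 by apply: (in_cell_signed_row _ hy2 rM').2.
have zr2 : Yr (P z2) < 0 by apply: (in_cell_signed_row _ hz2 rM').2.
have zr1 : 0 < Yr (P z1) by apply: (in_cell_signed_row _ hz1 rM').1.
pose p1 := meet Y (P y1) (P x1); pose p2 := meet Y (P y2) (P x2).
pose q1 := meet X (P z1) (P x1); pose q2 := meet X (P z2) (P x2).
have [ip1 Yp1] := @meetP R Y (P y1) (P x1) (@affine_signed_row P v _) ltac:(by rewrite nmulr_rlt0 //; case: v1).
have [ip2 Yp2] := @meetP R Y (P y2) (P x2) (@affine_signed_row P v _) ltac:(by rewrite nmulr_rlt0 //; case: v2).
have [iq1 Xq1] := @meetP R X (P z1) (P x1) (@affine_signed_col P h _) ltac:(by rewrite nmulr_rlt0 //; case: h1).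
have [iq2 Xq2] := @meetP R X (P z2) (P x2) (@affine_signed_col P h _) ltac:(by rewrite nmulr_rlt0 //; case: h2).
have cp1 := same_col F h in1 cy1 ky1 ci1 cj1 hy1 v1; have cp2 := same_col F h in2 cy2 ky2 ci2 cj2 hy2 v2.
have rq1 := same_row v in1 cz1 kz1 ci1' cj1' hz1 h1; have rq2 := same_row v in2 cz2 kz2 ci2' cj2' hz2 h2.
have nin a b x : inner_term a -> child a b -> inner_term x -> a != x -> b != x -> ~ inseg (P b) (P a) (P x).
  move=> ia cab ix ne ne' /inseg_online e0'.
  have : orient (P b) (P a) (P x) != 0.
    apply: (gpP F) ne ne'; rewrite ?inner_fits //; first exact: inner_child ia cab.
    by apply: contraTneq (child_depth cab) => ->; rewrite ltnn.
  by rewrite e0' eqxx.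
have strC p q : Xc p = 0 -> 0 < Yr p -> Y p < 0 -> q = u \/ q = w -> 0 <= Yr q -> Y q <= 0 -> 0 < X p * X q.
  move=> Xp Yrp Yp hq rq Yq; apply: (strip_cols F h rM (re v) cM (eM h) _ Xp Yrp Yp _ rq Yq); first by rewrite eq_sym.
  by case: hq => ->.
have strX p : X p = 0 -> 0 < Yr p -> Y p < 0 -> 0 < Yr o -> 0 < Xc p * Xc o.
  move=> Xp Yrp Yp ro; apply: (strip_cols F h rM (re v) (eM h) cM ce Xp Yrp Yp go1); first exact: ltW.
  by rewrite /signed_row go2 e0.
have zX : X o = 0 by rewrite /X /signed_col go3 e0.
have zY : Y o = 0 by rewrite /Y /signed_row go2 e0.
have zu : Xc u = 0 by rewrite /Xc /signed_col gu3 e0.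
have zu' : Yr u = 0 by rewrite /Yr /signed_row gu2 e0.
have zw : Xc w = 0 by rewrite /Xc /signed_col gw3 e0.
have zw' : Y w = 0 by rewrite /Y /signed_row gw2 e0.
have P1 : [/\ Y p1 = 0, Xc p1 < 0 & X p1 < 0].
  by split=> //; [have := cp1 c cM|have := cp1 _ (eM h)]; rewrite nmulr_rgt0.
have P2 : [/\ Y p2 = 0, 0 < Xc p2 & X p2 < 0].
  by split=> //; [have := cp2 c cM; rewrite pmulr_rgt0|have := cp2 _ (eM h); rewrite nmulr_rgt0].
have Q1 : [/\ X q1 = 0, 0 < Yr q1 & Y q1 < 0].
  by split=> //; [have := rq1 r rM; rewrite pmulr_rgt0|have := rq1 _ (eM v); rewrite nmulr_rgt0].
have Q2 : [/\ X q2 = 0, Yr q2 < 0 & Y q2 < 0].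
  by split=> //; [have := rq2 r rM|have := rq2 _ (eM v)]; rewrite nmulr_rgt0.
have nR : noncross (P y1) (P x1) (P y2) (P x2).
  by apply: (edge_noncross F) => //; rewrite ?inner_fits ?ky1 ?ky2 // xpair_eqE (negbTE nx).
have nB : noncross (P z1) (P x1) (P z2) (P x2).
  by apply: (edge_noncross F) => //; rewrite ?inner_fits ?kz1 ?kz2 // xpair_eqE (negbTE nx).
apply: (@corner R X Xc Y Yr o u w (P y1) (P z1) (P x1) p1 q1 (P y2) (P z2) (P x2) p2 q2) => //.
- exact: affine_signed_col.
- exact: affine_signed_col.
- exact: affine_signed_row.
- exact: affine_signed_row.
- exact: (line_signed_col F).
- exact: line_signed_row.
- exact: (line_signed_col F).
- exact: (along_col F).
- exact: (along_col F).
- exact: along_row.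
- exact: along_row.
- exact: (along_col F).
- exact: (along_col F).
- by case: h1.
- by case: h2.
- by case: v1.
- by case: v2.
- exact: nin.
by apply: nin => //; rewrite eq_sym.
Qed.

End Corners.

End Requests.

(** * Common neighbours of placed vertices *)

Section K33terms.
Variable R : realFieldType.
Notation pt := (R * R)%type.
Variables (L N : nat) (P : term -> pt) (k : term -> term -> bool).
Hypothesis D : drawing L N P k.
Variables (u v : nat -> term) (w : nat -> nat -> term).
Hypotheses (lw : forall i j, (i < 3)%N -> (j < 3)%N -> fits L N N (w i j))
  (wu : forall i j, (i < 3)%N -> (j < 3)%N -> child (w i j) (u i))
  (wv : forall i j, (i < 3)%N -> (j < 3)%N -> child (w i j) (v j)).
Hypotheses (uI : forall i j, (i < 3)%N -> (j < 3)%N -> u i = u j -> i = j)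
  (vI : forall i j, (i < 3)%N -> (j < 3)%N -> v i = v j -> i = j)
  (wI : forall i j i' j', (i < 3)%N -> (j < 3)%N -> (i' < 3)%N -> (j' < 3)%N ->
     w i j = w i' j' -> i = i' /\ j = j')
  (uv : forall i j, (i < 3)%N -> (j < 3)%N -> u i <> v j)
  (wu' : forall i j l, (i < 3)%N -> (j < 3)%N -> (l < 3)%N -> w i j <> u l)
  (wv' : forall i j l, (i < 3)%N -> (j < 3)%N -> (l < 3)%N -> w i j <> v l).

Definition K33term (i : nat) : term :=
  if (i < 3)%N then u i else if (i < 6)%N then v (i - 3)%N else w ((i - 6) %/ 3)%N ((i - 6) %% 3)%N.

Lemma K33term_inj i j : (i < 15)%N -> (j < 15)%N -> K33term i = K33term j -> i = j.
Proof.
have d l : (l < 15)%N -> ((l - 6) %/ 3 < 3)%N by move=> h; rewrite ltn_divLR //; lia.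
have m l : (l %% 3 < 3)%N by rewrite ltn_mod.
have s l : (l < 6)%N -> (l - 3 < 3)%N by lia.
rewrite /K33term => hi hj; case: (ltnP i 3) => i3; case: (ltnP j 3) => j3.
- exact: uI.
- case: (ltnP j 6) => j6; first by move/uv; case=> //; exact: s.
  by move=> e; exfalso; apply: (@wu' _ _ _ (d j hj) (m _) i3); first [exact: e|exact: esym e].
- case: (ltnP i 6) => i6; first by move/esym/uv; case=> //; exact: s.
  by move=> e; exfalso; apply: (@wu' _ _ _ (d i hi) (m _) j3); first [exact: e|exact: esym e].
case: (ltnP i 6) => i6; case: (ltnP j 6) => j6.
- by move/(vI (s _ i6) (s _ j6)); lia.
- by move=> e; exfalso; apply: (@wv' _ _ _ (d j hj) (m _) (s _ i6)); first [exact: e|exact: esym e].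
- by move=> e; exfalso; apply: (@wv' _ _ _ (d i hi) (m _) (s _ j6)); first [exact: e|exact: esym e].
case/(wI (d _ hi) (m _) (d _ hj) (m _)) => e1 e2.
have := divn_eq (i - 6) 3; rewrite e1 e2 -divn_eq; lia.
Qed.

Lemma K33_generic : generic 15 (P \o K33term).
Proof.
have l i : (i < 15)%N -> fits L N N (K33term i).
  move=> hi; rewrite /K33term; case: (ltnP i 3) => i3.
    by apply: fits_child (wu i3 (isT : (0 < 3)%N)); exact: lw.
  case: (ltnP i 6) => i6; first by apply: fits_child (wv (isT : (0 < 3)%N) (_ : (i - 3 < 3)%N)); [apply: lw => //|]; lia.
  by apply: lw; [rewrite ltn_divLR //; lia|rewrite ltn_mod].
have n i j : (i < 15)%N -> (j < 15)%N -> i != j -> K33term i != K33term j.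
  by move=> hi hj; apply: contraNneq => /(K33term_inj hi hj) ->.
by move=> i j m hi hj hm ij jm im; apply: D.1; rewrite ?l ?n.
Qed.

(** With a single colour no two of the nine bent edges would cross. *)
Lemma K33_one_colour c :
  (forall i j, (i < 3)%N -> (j < 3)%N -> k (w i j) (u i) = c) ->
  (forall i j, (i < 3)%N -> (j < 3)%N -> k (w i j) (v j) = c) -> False.
Proof.
move=> ku kv; have odd := K33_odd K33_generic.
have no x y x' y' : child x y -> child x' y' -> fits L N N x -> fits L N N x' -> k x y = c -> k x' y' = c ->
    uniq [:: x; y; x'; y'] -> crossing (P y) (P x) (P y') (P x') = false.
  move=> cx cx' lx lx' kx kx'; rewrite /= !inE !negb_or => /and4P[/and3P[h1 h2 h3] /andP[h4 h5] h6 _].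
  apply/negP => /crossing_inseg; have ly := fits_child lx cx; have ly' := fits_child lx' cx'.
  case; try by apply: D.1; rewrite // eq_sym.
  move=> p [/insegC i1 /insegC i2]; apply: (D.2 x y x' y') i1 i2 => //; last by rewrite kx kx'.
  by rewrite xpair_eqE (negbTE h2).
have wne i j i' j' : (i < 3)%N -> (j < 3)%N -> (i' < 3)%N -> (j' < 3)%N -> i != i' -> w i j != w i' j'.
  by move=> h1 h2 h3 h4; apply: contraNneq => /(wI h1 h2 h3 h4)[->].
have pc i j i' j' : (i < 3)%N -> (j < 3)%N -> (i' < 3)%N -> (j' < 3)%N -> i != i' -> j != j' ->
    path_crossings (P (u i)) (P (v j)) (P (w i j)) (P (u i')) (P (v j')) (P (w i' j')) = false.
  move=> hi hj hi' hj' ni nj; have nw := wne i j i' j' hi hj hi' hj' ni.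
  have nu : u i != u i' by apply: contraNneq ni => /uI ->.
  have nv : v j != v j' by apply: contraNneq nj => /vI ->.
  have n1 a b l : (a < 3)%N -> (b < 3)%N -> (l < 3)%N -> (w a b == u l) = false.
    by move=> *; apply/eqP; exact: wu'.
  have n2 a b l : (a < 3)%N -> (b < 3)%N -> (l < 3)%N -> (w a b == v l) = false.
    by move=> *; apply/eqP; exact: wv'.
  have n3 a b : (a < 3)%N -> (b < 3)%N -> (u a == v b) = false.
    by move=> *; apply/eqP; exact: uv.
  rewrite /path_crossings !no //; try by [exact: wu|exact: wv|exact: lw|exact: ku|exact: kv].
  all: rewrite /= ?inE ?(eq_sym (u _) (w _ _)) ?(eq_sym (v _) (w _ _)) ?(eq_sym (v _) (u _)).
  all: rewrite ?n1 ?n2 ?n3 //= ?(negbTE nw) ?(negbTE nu) ?(negbTE nv) //.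
by move: odd; rewrite /= /K33term /= !pc.
Qed.
End K33terms.

Section Families.
Variable R : realFieldType.
Notation pt := (R * R)%type.
Variables (L K n : nat).
Hypothesis L1 : (0 < L)%N.
Hypothesis K8 : (8 <= K)%N.
Hypothesis n4 : (4 <= n)%N.
Implicit Types (P : term -> pt) (k : term -> term -> bool).
Notation M := n.+4.
Notation T := n.+2.
Notation in_cell := (@in_cell R M).
Notation fans := (@fans R L K M).
Notation extr := (extreme n).
Notation srow := (@signed_row R n).
Notation vexit := (@vertical_exit R n).
Notation hexit := (@horizontal_exit R n).

Record env P k : Prop := Env {
  env_fans : fans P k;
  env_cell : forall s t, (1 < s < T)%N -> (1 < t < T)%N -> in_cell P s t (P (W s t)) }.

Lemma env_transpose P k : env P k -> env (transpose_place P) (transpose_colour k).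
Proof.
move=> [F c]; split; first exact: fans_transpose.
move=> s t hs ht; rewrite -[transpose_place P _]/(swap_xy (P (W t s))); apply: in_cell_transpose; exact: c.
Qed.

(** An increasing choice of [p] labels that avoid the reserved ones. *)
Definition label_places p s := [&& sorted ltn s, all (fun i => 1 < i < T)%N s & size s == p].

Definition at_places (sl tl : seq nat) x := relabel (nth 0%N sl) (nth 0%N tl) x.

(** Adds the reserved labels, so that extreme columns and rows are named by a term
and uniformity applies to the position of a vertex with respect to them. *)
Definition pad (s : seq nat) := [:: 0%N; 1%N] ++ s ++ [:: T; T.+1; T.+2].
Definition up x := relabel (addn 2) (addn 2) x.

Lemma at_up p q sl tl x : label_places p sl -> label_places q tl -> fits L p q x ->
  at_places (pad sl) (pad tl) (up x) = at_places sl tl x.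
Proof.
move=> /and3P[_ _ /eqP es] /and3P[_ _ /eqP et] /and3P[_ /allP h1 /allP h2].
rewrite /at_places relabel_comp; apply: relabel_ext => i hi /=; rewrite nth_cat.
  by rewrite es h1.
by rewrite et h2.
Qed.

Lemma up_fits p q x : fits L p q x -> fits L (p + 5) (q + 5) (up x).
Proof. by move=> h; apply: fits_relabel h _ _ => i; clear; lia. Qed.

Lemma places_mono p s : label_places p s -> mono (p + 5) M.+1 (nth 0%N (pad s)).
Proof.
move=> /and3P[so al /eqP e]; have -> : (p + 5 = size (pad s))%N by rewrite /pad /= size_cat e /=; lia.
apply: mono_nth.
  rewrite /pad /= (path_sortedE ltn_trans) all_cat /= !andbT; apply/andP; split.
    by move: al; apply: sub_all => i /andP[].
  rewrite sorted_pairwise; last exact: ltn_trans.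
  rewrite pairwise_cat /= !ltnS !leqnn !leqnSn /= !andbT -(sorted_pairwise ltn_trans) so andbT.
  by apply/allrelP => x y /(allP al) hx; rewrite !inE => hy; lia.
rewrite /pad /= all_cat /= !ltnS !leqnSn /=; apply/andP; split; last by lia.
by move: al; apply: sub_all => i; lia.
Qed.

Section One.
Variables (P : term -> pt) (k : term -> term -> bool).
Hypothesis F : fans P k.
Variables (p q : nat) (hp : (p + 5 <= K)%N) (hq : (q + 5 <= K)%N).

Lemma obs_pad sl sl' tl tl' x1 x2 x3 x4 x5 x6 :
  label_places p sl -> label_places p sl' -> label_places q tl -> label_places q tl' ->
  all (fits L (p + 5) (q + 5)) [:: x1; x2; x3; x4; x5; x6] ->
  let a := at_places (pad sl) (pad tl) in let a' := at_places (pad sl') (pad tl') in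
  obs P k (a x1) (a x2) (a x3) (a x4) (a x5) (a x6) =
  obs P k (a' x1) (a' x2) (a' x3) (a' x4) (a' x5) (a' x6).
Proof. by move=> h1 h2 h3 h4 hl; apply: (fans_uniform F hp hq) hl; apply: places_mono. Qed.

Lemma colour_uniform sl sl' tl tl' x y :
  label_places p sl -> label_places p sl' -> label_places q tl -> label_places q tl' -> fits L p q x -> fits L p q y ->
  k (at_places sl tl x) (at_places sl tl y) = k (at_places sl' tl' x) (at_places sl' tl' y).
Proof.
move=> h1 h2 h3 h4 lx ly; rewrite -!(at_up h1 h3) // -!(at_up h2 h4) //.
have := @obs_pad sl sl' tl tl' (up x) (up y) (up x) (up x) (up x) (up x) h1 h2 h3 h4.
by rewrite /= !up_fits // => /(_ isT) [].
Qed.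

(* Equality of signs. *)
Let ss (x y : R) := ((0 < x) = (0 < y)) /\ ((0 <= x) = (0 <= y)).

Let ssM x y x' y' : ss x x' -> ss y y' -> ss (x * y) (x' * y').
Proof.
rewrite /ss; case: (ltrgt0P x) => hx; case: (ltrgt0P x') => hx' [] // _ _;
  rewrite ?hx ?hx' ?mul0r ?ltxx ?lexx // => -[].
  by rewrite !pmulr_rgt0 // !pmulr_rge0.
rewrite !nmulr_rgt0 // !nmulr_rge0 //; case: (ltrgt0P y) => hy; case: (ltrgt0P y') => hy' //=.
Qed.

Let ssN x y : ss x y -> ss (- x) (- y).
Proof.
rewrite /ss !oppr_gt0 !oppr_ge0; case: (ltrgt0P x) => hx; case: (ltrgt0P y) => hy [] //=.
Qed.

Let ss_sg b x y : ss x y -> ss (sg b x) (sg b y).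
Proof. by case: b => //=; exact: ssN. Qed.

Lemma meetZ c (f : pt -> R) a b : c != 0 -> meet (fun p => c * f p) a b = meet f a b.
Proof. by move=> nc; rewrite /meet -mulrBr invfM mulrACA divff // mul1r. Qed.

(** An exit is expressed by an orientation and by the position of a point of
intersection, all of padded terms; so it happens for all choices of labels or for
none. *)
Lemma vexit_uniform b sl sl' tl tl' x y :
  label_places p sl -> label_places p sl' -> label_places q tl -> label_places q tl' -> fits L p q x -> fits L p q y ->
  vexit P b (at_places sl tl x) (at_places sl tl y) -> vexit P b (at_places sl' tl' x) (at_places sl' tl' y).
Proof.
move=> h1 h2 h3 h4 lx ly.
pose e (b : bool) := if b then q.+2 else 0%N.
pose C b := B (e b); pose D b := W (p + 4)%N (e b).
have lC c : fits L (p + 5) (q + 5) (C c) by apply: fits_B; rewrite /e; case: c; lia.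
have lD c : fits L (p + 5) (q + 5) (D c) by apply: fits_W => //; [lia|rewrite /e; case: c; lia].
have aC s t c : label_places p s -> label_places q t -> at_places (pad s) (pad t) (C c) = B (extr c).
  move=> _ /and3P[_ _ /eqP et]; rewrite /C /e /at_places /=; case: c => //=.
  by rewrite nth_cat et ltnn subnn.
have aD s t c : label_places p s -> label_places q t -> at_places (pad s) (pad t) (D c) = W M (extr c).
  move=> /and3P[_ _ /eqP es] /and3P[_ _ /eqP et]; rewrite /D /e /at_places /=; congr (Join (A _) (B _)).
    by rewrite addn4 /= nth_cat es -(addn2 p) addKn ltnNge leq_addr.
  by case: c => //=; rewrite nth_cat et ltnn subnn.
have sp c z : fits L (p + 5) (q + 5) z ->
    ss (orient (P (B (extr c))) (P (W M (extr c))) (P (at_places (pad sl) (pad tl) z)))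
       (orient (P (B (extr c))) (P (W M (extr c))) (P (at_places (pad sl') (pad tl') z))).
  move=> lz; have := @obs_pad sl sl' tl tl' (C c) (D c) z z z z h1 h2 h3 h4.
  by rewrite /= lC lD lz !aC // !aD // => /(_ isT)[].
have sm c c' z w : fits L (p + 5) (q + 5) z -> fits L (p + 5) (q + 5) w ->
    let m a b := meet (orient (P (B (extr c'))) (P (W M (extr c')))) (P (at_places a b z)) (P (at_places a b w)) in
    ss (orient (P (B (extr c))) (P (W M (extr c))) (m (pad sl) (pad tl)))
       (orient (P (B (extr c))) (P (W M (extr c))) (m (pad sl') (pad tl'))).
  move=> lz lw; have := @obs_pad sl sl' tl tl' (C c) (D c) z w (C c') (D c') h1 h2 h3 h4.
  by rewrite /= !lC !lD lz lw !aC // !aD // => /(_ isT)[].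
have sa c : ss (orient (P (B (extr c))) (P (W M (extr c))) (P (A 0))) (orient (P (B (extr c))) (P (W M (extr c))) (P (A 0))).
  by [].
have em c a1 a2 : meet (srow P c (extr c)) a1 a2 = meet (orient (P (B (extr c))) (P (W M (extr c)))) a1 a2.
  set f := orient (P (B (extr c))) (P (W M (extr c))).
  have nz : f (P (A 0)) != 0.
    by apply: (gpP F); rewrite ?fits_A ?fits_B ?fits_W ?termE // ?ltnS //= /extreme; case: (c) => //=; lia.
  rewrite -(@meetZ (sg c (- f (P (A 0)))) f); last by case: c @f nz => f; rewrite /= ?opprK ?oppr_eq0.
  by apply: meet_ext => z; rewrite /signed_row /row_dist -/f; case: c @f nz => f _ /=; ring.
rewrite /vertical_exit -!(at_up h1 h3) // -!(at_up h2 h4) // !em.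
have s1 := ss_sg b (ssM (ssN (sp b _ (up_fits lx))) (sa b)).
have s2 := ss_sg (~~ b) (ssM (ssN (sm (~~ b) b _ _ (up_fits ly) (up_fits lx))) (sa (~~ b))).
move: s1 s2; rewrite /signed_row /row_dist /ss => -[s1 _] [s2 _].
by rewrite s1 !leNgt s2.
Qed.

End One.

Section Two.
Variables (P : term -> pt) (k : term -> term -> bool).
Hypothesis F : fans P k.
Variables (p q : nat) (hp : (p + 5 <= K)%N) (hq : (q + 5 <= K)%N).

Lemma at_transpose sl tl x : transpose (at_places sl tl x) = at_places tl sl (transpose x).
Proof. by rewrite /at_places relabel_transpose. Qed.

Lemma hexit_uniform b sl sl' tl tl' x y :
  label_places p sl -> label_places p sl' -> label_places q tl -> label_places q tl' -> fits L p q x -> fits L p q y ->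
  hexit P b (at_places sl tl x) (at_places sl tl y) -> hexit P b (at_places sl' tl' x) (at_places sl' tl' y).
Proof.
move=> h1 h2 h3 h4 lx ly /vexit_transpose; rewrite !at_transpose => h; apply/vexit_transpose; rewrite !at_transpose.
by apply: (vexit_uniform (fans_transpose L1 F) hq hp) h; rewrite ?fits_transpose.
Qed.

End Two.

End Families.

Section Facts.
Variable R : realFieldType.
Notation pt := (R * R)%type.
Variables (L K n : nat).
Hypothesis L1 : (0 < L)%N.
Hypothesis K8 : (8 <= K)%N.
Hypothesis n4 : (4 <= n)%N.
Implicit Types (P : term -> pt) (k : term -> term -> bool).
Notation M := n.+4.
Notation T := n.+2.
Notation in_cell := (@in_cell R M).
Notation inner := (inner_term L n).
Notation places := (label_places n).
Notation env := (@env R L K n).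
Notation beyond := (@beyond R L n).
Notation vexit := (@vertical_exit R n).
Notation hexit := (@horizontal_exit R n).

Lemma at_child sl tl x y : child x y -> child (at_places sl tl x) (at_places sl tl y).
Proof. exact: child_relabel. Qed.

Lemma places_nth p s i : places p s -> (i < p)%N -> (1 < nth 0%N s i < T)%N.
Proof. by move=> /and3P[_ /all_nthP h /eqP e] ip; apply: h; rewrite e. Qed.

Lemma inner_at p q sl tl x : fits L p q x -> places p sl -> places q tl -> inner (at_places sl tl x).
Proof.
move=> /and3P[d /allP h1 /allP h2] hs ht.
rewrite /inner_term depth_relabel d !labels_relabel !all_map /=; apply/andP; split; apply/allP => i hi /=.
  by apply: places_nth hs _; exact: h1.
by apply: places_nth ht _; exact: h2.
Qed.

Lemma places_iota p a : (1 < a)%N -> (a + p <= T)%N -> places p (iota a p).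
Proof.
move=> a1 ap; rewrite /label_places size_iota eqxx iota_ltn_sorted andbT /=.
by apply/allP => i; rewrite mem_iota; move: a1 ap; clear; lia.
Qed.

Lemma at_inj p q sl tl sl' tl' x : fits L p q x -> places p sl -> places p sl' ->
  at_places sl tl x = at_places sl' tl' x -> {in labels true x, nth 0%N sl =1 nth 0%N sl'} /\
  {in labels false x, nth 0%N tl =1 nth 0%N tl'}.
Proof.
move=> _ _ _ e; have l b := congr1 (labels b) e.
have {l} l b := l b; split=> i hi.
  by move: (l true); rewrite !labels_relabel => /eq_in_map; apply.
by move: (l false); rewrite !labels_relabel => /eq_in_map; apply.
Qed.

Lemma labels_nil x : labels true x = [::] -> labels false x = [::] -> False.
Proof.
elim: x => [[] i|x IHx y IHy] //= h h'; apply: IHx.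
  by case: (labels true x) h.
by case: (labels false x) h'.
Qed.

Section One.
Variables (P : term -> pt) (k : term -> term -> bool).
Hypothesis E : env P k.

(** The colour of an edge, and the cell of a vertex, for every choice of labels:
[x] is in the column of the [i]-th A-label and in the row of the [j]-th B-label. *)
Definition joined c p q x y := forall sl tl, places p sl -> places q tl ->
  k (at_places sl tl x) (at_places sl tl y) = c.

Definition placed p q i j x := forall sl tl, places p sl -> places q tl ->
  in_cell P (nth 0%N sl i) (nth 0%N tl j) (P (at_places sl tl x)).

Variables (p q : nat) (hp : (p + 5 <= K)%N) (hq : (q + 5 <= K)%N).
Hypotheses (pn : (3 * p <= n)%N) (qn : (3 * q <= n)%N).

(** If the edges of z left the grid, then they would do so for every choice of labels
and beyond the same corner. Choosing two copies diagonally to that corner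
contradicts [no_corner]. *)
Lemma settle z x y i1 j1 i2 j2 : fits L p q z -> child z x -> child z y ->
  joined true p q z x -> joined false p q z y ->
  [&& i1 < p, j1 < q, i2 < p & j2 < q]%N ->
  placed p q i1 j1 x -> placed p q i2 j2 y -> placed p q i1 j2 z.
Proof.
move=> lz cx cy kx ky /and4P[hi1 hj1 hi2 hj2] px py sl tl hs ht.
have F := env_fans E.
have lx := fits_child lz cx; have ly := fits_child lz cy.
have rs i s : places p s -> (i < p)%N -> (1 < nth 0%N s i < T)%N by exact: places_nth.
have rt i s : places q s -> (i < q)%N -> (1 < nth 0%N s i < T)%N by exact: places_nth.
case: (answer L1 K8 n4 F (inner_at lz hs ht) (at_child sl tl cx) (at_child sl tl cy)
  (kx _ _ hs ht) (ky _ _ hs ht) (rs _ _ hs hi1) (rt _ _ ht hj1) (rs _ _ hs hi2) (rt _ _ ht hj2)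
  (px _ _ hs ht) (py _ _ hs ht)) => // -[hv hh]; exfalso.
have {hv} [v hv] : exists v, vexit P v (at_places sl tl z) (at_places sl tl x).
  by case: hv; [exists true|exists false].
have {hh} [h hh] : exists h, hexit P h (at_places sl tl z) (at_places sl tl y).
  by case: hh; [exists true|exists false].
pose blk (b : bool) m := if b then iota 2 m else iota (m + 3) m.
have hb b m : (3 * m <= n)%N -> places m (blk b m).
  by move=> hm; case: b; apply: places_iota; lia.
have bey b c : beyond P k h v (at_places (blk b p) (blk c q) z) (at_places (blk b p) (blk c q) x) (at_places (blk b p) (blk c q) y)
    (nth 0%N (blk b p) i1) (nth 0%N (blk c q) j1) (nth 0%N (blk b p) i2) (nth 0%N (blk c q) j2).
  have hbp := hb b p pn; have hcq := hb c q qn; split.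
  - exact: inner_at lz _ _.
  - by split; [exact: at_child|exact: kx].
  - by split; [exact: at_child|exact: ky].
  - by rewrite !rs.
  - by rewrite !rt.
  - by split; [exact: px|exact: py].
  split; first exact: (vexit_uniform L1 K8 n4 F hp hq hs hbp ht hcq lz lx hv).
  exact: (hexit_uniform L1 K8 n4 F hp hq hs hbp ht hcq lz ly hh).
have bl b m i : (i < m)%N -> (if b then nth 0%N (blk b m) i < m + 2 else m + 2 < nth 0%N (blk b m) i)%N.
  by move=> im; rewrite /blk; case: b; rewrite nth_iota //; lia.
have bl' b m i : (i < m)%N -> before b (nth 0%N (blk b m) i) (m + 2) /\ before b (m + 2) (nth 0%N (blk (~~ b) m) i).
  by move=> im; have := bl b m i im; have := bl (~~ b) m i im; case: b.
have dep a b u w s t s' t' : child u w -> at_places a b w != at_places s t u /\ at_places s' t' w != at_places a b u.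
  move=> /child_depth d; split; apply: contraTneq d => e.
    by rewrite -(depth_relabel (nth 0%N a) (nth 0%N b) w) -/(at_places a b w) e depth_relabel ltnn.
  by rewrite -(depth_relabel (nth 0%N s') (nth 0%N t') w) -/(at_places s' t' w) e depth_relabel ltnn.
have c2 m : (3 * m <= n)%N -> (0 < m)%N -> (1 < m + 2 < T)%N by lia.
have p0 : (0 < p)%N by apply: leq_ltn_trans hi1.
have q0 : (0 < q)%N by apply: leq_ltn_trans hj1.
apply: (no_corner L1 K8 n4 F (bey h (~~ v)) (bey (~~ h) v) _ _ _ (c2 p pn p0) (c2 q qn q0)).
- apply/eqP => /(at_inj lz (hb _ _ pn) (hb _ _ pn)) [e1 e2].
  have no m l s s' : {in l, nth 0%N s =1 nth 0%N s'} -> (forall i, i \in l -> (i < m)%N) ->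
     (forall i, (i < m)%N -> nth 0%N s i <> nth 0%N s' i) -> l = [::].
    by case: l => // a l e lm ne; case: (ne a); [apply: lm|apply: e]; rewrite mem_head.
  have far b m i : (i < m)%N -> nth 0%N (blk b m) i <> nth 0%N (blk (~~ b) m) i.
    by move=> im; have := bl b m i im; have := bl (~~ b) m i im; case: b => /= h1 h2; clear -h1 h2; lia.
  have far' b m i : (i < m)%N -> nth 0%N (blk (~~ b) m) i <> nth 0%N (blk b m) i.
    by move=> /(far b) ne /esym.
  case/and3P: lz => _ /allP l1 /allP l2; apply: (@labels_nil z).
    by apply: (no p _ _ _ e1 l1) => i; exact: far.
  by apply: (no q _ _ _ e2 l2) => i; exact: far'.
- exact: (dep _ _ _ _ _ _ [::] [::] cx).1.
- exact: (dep _ _ _ _ _ _ [::] [::] cy).1.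
- by rewrite !(bl' h p _ _).1 ?(bl' h p _ _).2.
have := bl' v; rewrite -{1 2}(negbK v) => _.
by case: (v) (bl' v) => b; rewrite !(b q _ _).1 ?(b q _ _).2.
Qed.

Definition disj x y :=
  ~~ has [in labels true x] (labels true y) && ~~ has [in labels false x] (labels false y).

(* As x and y have no labels in common, there are three copies of x and three
   copies of y whose labels are interleaved in the same way for each of the nine
   pairs. *)
Let copies (b : bool) x i j m := [seq 3 * l + 2 + (if l \in labels b x then i else j) | l <- iota 0 m]%N.

Let copies_places b x i j m : (i < 3)%N -> (j < 3)%N -> (3 * m <= n)%N -> places m (copies b x i j m).
Proof.
move=> hi hj hm; rewrite /label_places size_map size_iota eqxx andbT; apply/andP; split.
  apply: (@homo_sorted _ _ _ ltn ltn); last exact: iota_ltn_sorted.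
  move=> a c /= ac; case: (a \in _); case: (c \in _); clear -hi hj ac; lia.
rewrite all_map; apply/allP => l; rewrite mem_iota add0n => /= lm.
by case: (l \in _); clear -hi hj hm lm; lia.
Qed.

Let nth_copies b x i j m l : (l < m)%N ->
  nth 0%N (copies b x i j m) l = (3 * l + 2 + (if l \in labels b x then i else j))%N.
Proof. by move=> lm; rewrite (nth_map 0%N) ?size_iota // nth_iota. Qed.

(** Three copies of x, three of y, and their nine common neighbours form a K33 with
bent edges of a single colour. *)
Lemma two_colours x y c : fits L p q (Join x y) -> disj x y ->
  joined c p q (Join x y) x -> joined c p q (Join x y) y -> False.
Proof.
move=> lz /andP[d1 d2] jx jy; have [lx ly] := fits_Join lz.
have D := fans_drawing (env_fans E).
pose a i j z := at_places (copies true x i j p) (copies false x i j q) z.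
have labt z l : fits L p q z -> l \in labels true z -> (l < p)%N by case/and3P=> _ /allP h _ /h.
have labf z l : fits L p q z -> l \in labels false z -> (l < q)%N by case/and3P=> _ _ /allP h /h.
have ax i j j' : a i j x = a i j' x.
  by apply: relabel_ext => l hl; [have h := labt _ _ lx hl|have h := labf _ _ lx hl]; rewrite !nth_copies // hl.
have dj b l : l \in labels b y -> (l \in labels b x) = false.
  by case: b => hl; apply/negP => hx; [case/hasP: d1|case/hasP: d2]; exists l.
have ay i i' j : a i j y = a i' j y.
  by apply: relabel_ext => l hl; [have h := labt _ _ ly hl|have h := labf _ _ ly hl]; rewrite !nth_copies // (dj _ _ hl).
have ne z : (exists l, l \in labels true z) \/ (exists l, l \in labels false z).
  case e : (labels true z) => [|l s]; last by left; exists l; rewrite mem_head.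
  case e' : (labels false z) => [|l s]; last by right; exists l; rewrite mem_head.
  by case: (labels_nil e e').
have pl b i j m : (i < 3)%N -> (j < 3)%N -> (3 * m <= n)%N -> places m (copies b x i j m) by exact: copies_places.
have ainj z i j i' j' : fits L p q z -> a i j z = a i' j' z ->
    exists b l, l \in labels b z /\ (if l \in labels b x then i = i' else j = j').
  move=> l0 e; have e' b := congr1 (labels b) e.
  have {e'} et := e' true; have ef := congr1 (labels false) e; move: et ef.
  rewrite !labels_relabel => /eq_in_map et /eq_in_map ef.
  case: (ne z) => -[l hl]; [exists true|exists false]; exists l; split=> //.
    by have := et l hl; rewrite !nth_copies ?(labt z) //; case: (l \in _) => /addnI.
  by have := ef l hl; rewrite !nth_copies ?(labf z) //; case: (l \in _) => /addnI.
have xI i i' j j' : a i j x = a i' j' x -> i = i'.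
  by case/(ainj _ _ _ _ _ lx) => b [l [->]].
have yI i i' j j' : a i j y = a i' j' y -> j = j'.
  by case/(ainj _ _ _ _ _ ly) => b [l [/dj->]].
have dep i j i' j' z : (z == x) || (z == y) -> a i j (Join x y) <> a i' j' z.
  move=> hz e; have d : (depth z < depth (Join x y))%N by apply: child_depth.
  by move: (congr1 depth e) d; rewrite !depth_relabel => ->; rewrite ltnn.
have xy i j : (i < 3)%N -> (j < 3)%N -> a i 0%N x <> a 0%N j y.
  move=> hi hj e; have et := congr1 (labels true) e; have ef := congr1 (labels false) e; move: et ef.
  rewrite !labels_relabel => et ef.
  have clash b l l' : l \in labels b x -> l' \in labels b y -> (3 * l + 2 + i = 3 * l' + 2 + j)%N -> False.
    by move=> h /dj h' e3; move: h'; rewrite (_ : l' = l) ?h //; clear -hi hj e3; lia.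
  case: (ne x) => -[l hl].
    have := map_f (nth 0%N (copies true x i 0 p)) hl; rewrite et => /mapP[l' hl'].
    rewrite !nth_copies ?(labt x _ lx hl) ?(labt y _ ly hl') // hl (dj true) //=; exact: (clash true _ _ hl hl').
  have := map_f (nth 0%N (copies false x i 0 q)) hl; rewrite ef => /mapP[l' hl'].
  rewrite !nth_copies ?(labf x _ lx hl) ?(labf y _ ly hl') // hl (dj false) //=; exact: (clash false _ _ hl hl').
apply: (@K33_one_colour R L M.+1 P k D (fun i => a i 0%N x) (fun j => a 0%N j y) (fun i j => a i j (Join x y)) _ _ _ _ _ _ _ _ _ c).
- by move=> i j hi hj; apply: inner_fits; exact: (inner_at lz (pl true _ _ _ hi hj pn) (pl false _ _ _ hi hj qn)).
- by move=> i j hi hj; rewrite (ax i 0%N j); apply: at_child; rewrite /= eqxx.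
- by move=> i j hi hj; rewrite (ay 0%N i j); apply: at_child; rewrite /= eqxx orbT.
- by move=> i j _ _; exact: xI.
- by move=> i j _ _; exact: yI.
- by move=> i j i' j' _ _ _ _ [/xI e1 /yI e2].
- exact: xy.
- by move=> i j l _ _ _; apply: dep; rewrite eqxx.
- by move=> i j l _ _ _; apply: dep; rewrite eqxx orbT.
- by move=> i j hi hj; rewrite (ax i 0%N j); apply: jx; exact: pl.
by move=> i j hi hj; rewrite (ay 0%N i j); apply: jy; exact: pl.
Qed.

Lemma joined_dec x y : fits L p q x -> fits L p q y -> exists c, joined c p q x y.
Proof.
move=> lx ly; exists (k (at_places (iota 2 p) (iota 2 q) x) (at_places (iota 2 p) (iota 2 q) y)) => sl tl hs ht.
apply: (colour_uniform L1 K8 n4 (env_fans E) hp hq) => //; apply: places_iota => //.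
  by move: pn; clear; lia.
by move: qn; clear; lia.
Qed.

(** The way in which vertices are forced into new positions. Which of the two
alternatives holds is up to the drawing. *)
Theorem request x y i1 j1 i2 j2 : fits L p q (Join x y) -> disj x y ->
  [&& i1 < p, j1 < q, i2 < p & j2 < q]%N ->
  placed p q i1 j1 x -> placed p q i2 j2 y ->
  [/\ joined true p q (Join x y) x, joined false p q (Join x y) y & placed p q i1 j2 (Join x y)] \/
  [/\ joined false p q (Join x y) x, joined true p q (Join x y) y & placed p q i2 j1 (Join x y)].
Proof.
move=> lz d /and4P[hi1 hj1 hi2 hj2] px py; have [lx ly] := fits_Join lz.
have cx : child (Join x y) x by rewrite /= eqxx.
have cy : child (Join x y) y by rewrite /= eqxx orbT.
have [c jx] := joined_dec lz lx; have [c' jy] := joined_dec lz ly.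
case: c c' jx jy => -[] jx jy; try by case: (two_colours lz d jx jy).
  by left; split=> //; apply: (settle lz cx cy jx jy _ px py); rewrite hi1 hj1 hi2 hj2.
by right; split=> //; apply: (settle lz cy cx jy jx _ py px); rewrite hi1 hj1 hi2 hj2.
Qed.

End One.
End Facts.

(* Linear arithmetic on inequalities between natural numbers only. *)
Ltac nat_lia :=
  repeat match goal with H : ?t |- _ =>
    lazymatch t with
    | is_true (leq _ _) => fail
    | is_true (andb (leq _ _) (leq _ _)) => fail
    | is_true (orb _ _) => fail
    | is_true (_ != _ :> nat) => fail
    | _ = _ => fail
    | _ => clear H
    end end; lia.

(** * Winding paths *)

Section Hook.
Variable R : realFieldType.
Notation pt := (R * R)%type.
Variables (x : nat -> pt) (b b' : nat -> pt) (g g' : pt -> R).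
Let f i := orient (b i) (b' i).

Hypotheses (ag : affine g) (ag' : affine g').
Hypothesis below : forall i r, (0 < i < 6)%N -> (r <= i)%N -> f i (x r) < 0.
Hypothesis above : forall i r, (0 < i < 6)%N -> (i < r <= 6)%N -> 0 < f i (x r).
Hypothesis region : forall r, (0 < r <= 6)%N -> 0 < g (x r) /\ 0 < g' (x r).
Hypothesis parallel : forall i j p, (0 < i)%N -> (i < j)%N -> (j < 6)%N -> 0 < g p -> 0 < g' p ->
  (f i p = 0 -> f j p < 0) /\ (f j p = 0 -> 0 < f i p).
Hypothesis gp : forall i j l, (i <= 6)%N -> (j <= 6)%N -> (l <= 6)%N -> i != j -> j != l -> i != l ->
  orient (x i) (x j) (x l) != 0.

Let edges : seq (nat * nat) := [:: (0, 3); (3, 4); (3, 5); (2, 4); (1, 5); (2, 6)]%N.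

Hypothesis nc : forall e e' : nat * nat, e \in edges -> e' \in edges -> e != e' ->
  noncross (x e.1) (x e.2) (x e'.1) (x e'.2).
Hypothesis same_turn : 0 < orient (x 2) (x 4) (x 3) * orient (x 1) (x 5) (x 3).

Let X i (e : nat * nat) := meet (f i) (x e.1) (x e.2).
Let crosses i (e : nat * nat) := [&& e \in edges, e.1 <= i, i < e.2 & 0 < i < 6]%N.
Let side i e e' := orient (x e'.1) (x e'.2) (X i e).

Let af i : affine (f i). Proof. exact: affine_orient. Qed.

Let le6 (e : nat * nat) : e \in edges -> (e.1 < e.2 <= 6)%N.
Proof. by rewrite !inE => /or4P[||| /or3P[||]]/eqP->. Qed.

Let XP i (e : nat * nat) : crosses i e -> inseg (x e.1) (x e.2) (X i e) /\ f i (X i e) = 0.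
Proof.
move=> /and4P[he h1 h2 hi]; have /andP[_ e6] := le6 he.
by apply: (meetP (af i)); rewrite nmulr_rlt0; [apply: above => //; rewrite h2|apply: below].
Qed.

Let X_below i j (e : nat * nat) : crosses i e -> (e.2 <= j)%N -> (j < 6)%N -> f j (X i e) < 0.
Proof.
move=> c ej j6; have [[t [/andP[t0 t1] ->]] _] := XP c; case/and4P: c => he h1 h2 hi.
by apply: mix_gt; rewrite ?ltW //; apply: below; nat_lia.
Qed.

Let X_above i j (e : nat * nat) : crosses i e -> (0 < j)%N -> (j < e.1)%N -> 0 < f j (X i e).
Proof.
move=> c j0 ej; have [[t [/andP[t0 t1] ->]] _] := XP c; case/and4P: c => he h1 h2 hi.
by have := le6 he; move=> h; apply: mix_lt; rewrite ?ltW //; apply: above; clear -h h1 h2 hi j0 ej; nat_lia.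
Qed.

Let X_parallel i j (e : nat * nat) : crosses i e -> (0 < e.1)%N -> (0 < j < 6)%N -> (i < j)%N && (f j (X i e) < 0) || (j < i)%N && (0 < f j (X i e)) || (i == j).
Proof.
move=> c e0 hj; have [[t [/andP[t0 t1] eX]] z] := XP c; case/and4P: c => he h1 h2 /andP[i0 i6].
have h6 := le6 he.
have [[r1 r1'] [r2 r2']] : (0 < g (x e.1) /\ 0 < g' (x e.1)) /\ (0 < g (x e.2) /\ 0 < g' (x e.2)).
  by split; apply: region; nat_lia.
have p1 : 0 < g (X i e) by rewrite eX; apply: mix_lt; rewrite ?ltW.
have p2 : 0 < g' (X i e) by rewrite eX; apply: mix_lt; rewrite ?ltW.
case/andP: hj => j0 j6; case: (ltngtP i j) => //= lt.
  by rewrite orbF (parallel i0 lt j6 p1 p2).1.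
by rewrite orbF (parallel j0 lt i6 p1 p2).2.
Qed.

(* The strip lemma between the lines [i] and [j]: while the edge [e] is between
   them, it stays on the same side of the edge [e'], which crosses both. *)
Let piece i j (e e' : nat * nat) p q : (0 < i)%N -> (i < j)%N -> (j < 6)%N -> e \in edges -> e' \in edges -> e != e' ->
  (e'.1 <= i)%N -> (j < e'.2)%N -> inseg (x e.1) (x e.2) p ->
  inseg (x e.1) (x e.2) q \/ (exists r, [/\ q = x r, r = e.1 \/ r = e.2, r != e'.1 & r != e'.2]) ->
  0 <= f i p -> 0 <= f i q -> f j p <= 0 -> f j q <= 0 ->
  0 < orient (x e'.1) (x e'.2) p * orient (x e'.1) (x e'.2) q.
Proof.
move=> i0 ij j6 he he' ne l' u' ip iq pi qi pj qj.
have h6 := le6 he'.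
have a1 : f i (x e'.1) < 0 by apply: below; nat_lia.
have a2 : 0 < f i (x e'.2) by apply: above; nat_lia.
have a3 : f j (x e'.1) < 0 by apply: below; nat_lia.
have a4 : 0 < f j (x e'.2) by apply: above; nat_lia.
apply: (strip (af i) (af j)); try lra.
move=> t /andP[t0 t1].
have open u v s : inseg (x e.1) (x e.2) u -> inseg (x e.1) (x e.2) v \/ v = x e.1 \/ v = x e.2 -> 0 <= s < 1 ->
    inseg (x e.1) (x e.2) (mix s u v).
  move=> iu iv /andP[s0 s1]; case: iv => [[w [/andP[w0 w1] ->]]|[->|->]]; last 2 first.
  - by apply: insegC; apply: open_to_end; rewrite ?s0 //; exact: insegC.
  - by apply: open_to_end; rewrite ?s0.
  case: iu => [w' [/andP[w0' w1'] ->]]; rewrite mix_mix; exists ((1 - s) * w' + s * w); split=> //.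
  have h1 : 0 < (1 - s) * w' by rewrite mulr_gt0 ?subr_gt0.
  have h2 : 0 <= s * w by rewrite mulr_ge0 // ltW.
  have h3 : 0 < (1 - s) * (1 - w') by rewrite mulr_gt0 ?subr_gt0.
  have h4 : 0 <= s * (1 - w) by rewrite mulr_ge0 // subr_ge0 ltW.
  by apply/andP; split; lra.
have off := nc he he' ne.
case: (ltrgtP t 1) t1 => // [t1 _|-> _].
  apply: off; apply: open => //; last by rewrite t0.
  by case: iq => [|[r [-> [->|->]]]]; auto.
rewrite mix1; case: iq => [iq|[r [-> hr n1 n2]]]; first exact: off.
move=> /inseg_online o; have : orient (x e'.1) (x e'.2) (x r) != 0.
  by have := le6 he; case: hr n1 n2 => -> n1 n2 h; apply: gp => //; nat_lia.
by rewrite o eqxx.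
Qed.

Let ri i j (e e' : nat * nat) r : (0 < i)%N -> (i < r <= j)%N -> (j < 6)%N -> e \in edges -> e' \in edges -> e != e' ->
  (e'.1 <= i)%N -> (j < e'.2)%N -> (r == e.1) || (r == e.2) -> crosses (if r == e.1 then j else i) e ->
  0 < side (if r == e.1 then j else i) e e' * orient (x e'.1) (x e'.2) (x r).
Proof.
move=> i0 /andP[ir rj] j6 he he' ne l' u' hr; have /andP[lt e6] := le6 he.
have nr : r != e'.1 /\ r != e'.2 by split; nat_lia.
have fr : 0 <= f i (x r) by apply/ltW/above; move: hr => /orP[]/eqP; nat_lia.
have fr' : f j (x r) <= 0 by apply/ltW/below; nat_lia.
case: eqP hr => [er _ c|_ /= /eqP er c].
  have [ip z] := XP c; apply: (piece i0 _ j6 he he' ne l' u' ip); rewrite ?z //; try nat_lia.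
    by right; exists r; case: nr; split; auto.
  by apply/ltW/X_above => //; nat_lia.
have [ip z] := XP c; apply: (piece i0 _ j6 he he' ne l' u' ip); rewrite ?z //; try nat_lia.
  by right; exists r; case: nr; split; auto.
by apply/ltW/X_below => //; nat_lia.
Qed.

Let s i e e' := 0 < side i e e'.

Let pos_eq (u v : R) : 0 < u * v -> (0 < u) = (0 < v).
Proof.
case: (ltrgt0P u) => hu; last by rewrite hu mul0r ltxx.
  by rewrite pmulr_rgt0.
by rewrite nmulr_rgt0 // => h; rewrite ltNge ltW.
Qed.

(* Edges that share an endpoint [r] are on the same side of an edge that passes
   by. *)
Let turn i j (e1 e2 e' : nat * nat) r : (0 < i)%N -> (i < r <= j)%N -> (j < 6)%N -> e1 \in edges -> e2 \in edges -> e' \in edges ->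
  e1 != e' -> e2 != e' -> (e'.1 <= i)%N -> (j < e'.2)%N ->
  (r == e1.1) || (r == e1.2) -> (r == e2.1) || (r == e2.2) ->
  crosses (if r == e1.1 then j else i) e1 -> crosses (if r == e2.1 then j else i) e2 ->
  s (if r == e1.1 then j else i) e1 e' = s (if r == e2.1 then j else i) e2 e'.
Proof.
move=> i0 rj j6 h1 h2 he' n1 n2 l' u' r1 r2 c1 c2; rewrite /s.
by rewrite (pos_eq (ri i0 rj j6 h1 he' n1 l' u' r1 c1)) (pos_eq (ri i0 rj j6 h2 he' n2 l' u' r2 c2)).
Qed.

(* [piece] for two edges that reach across the strip. *)
Let along i j (e e' : nat * nat) : (i < j)%N -> crosses i e -> crosses j e -> crosses i e' -> crosses j e' ->
  (0 < e.1)%N -> e != e' -> s i e e' = s j e e'.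
Proof.
move=> ij ci cj ci' cj' e0 ne; apply: pos_eq; have [ip zp] := XP ci; have [iq zq] := XP cj.
case/and4P: (ci) => he h1 h2 /andP[i0 i6]; case/and4P: (cj) => _ h3 h4 /andP[j0 j6].
case/and4P: ci' => he' h1' h2' _; case/and4P: cj' => _ h3' h4' _.
have hj : (0 < j < 6)%N by rewrite j0.
have hi : (0 < i < 6)%N by rewrite i0.
have := X_parallel ci e0 hj; rewrite ij (ltn_eqF ij) (ltnNge j) (ltnW ij) /= !orbF => a.
have := X_parallel cj e0 hi; rewrite ij (gtn_eqF ij) (ltnNge j) (ltnW ij) /= !orbF => c.
by apply: (piece i0 ij j6 he he' ne) => //; first [by left|by rewrite zp|by rewrite zq|exact: ltW].
Qed.

Let swap i (e e' : nat * nat) : crosses i e -> crosses i e' -> e != e' -> s i e e' = ~~ s i e' e.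
Proof.
move=> /and4P[he h1 h2 hi] /and4P[he' h1' h2' _] ne.
have /andP[_ e6] := le6 he; have /andP[_ e6'] := le6 he'.
have g0 : (i < e.2 <= 6)%N by rewrite h2.
have g1 : (i < e'.2 <= 6)%N by rewrite h2'.
have := @order_swap R (b i) (b' i) (x e.1) (x e.2) (x e'.1) (x e'.2)
  (below hi h1) (above hi g0) (below hi h1') (above hi g1) (nc he he' ne).
rewrite -/(f i) -/(X i e) -/(X i e') -/(side i e e') -/(side i e' e) /s.
case: (ltrgt0P (side i e e')) => h; last by rewrite h mulr0 ltxx.
  by rewrite pmulr_llt0 // => h'; rewrite -leNgt ltW.
by rewrite nmulr_llt0 // => ->.
Qed.

(** The points 0, ..., 6 are d, z', z, u, v, v', y, for two copies v z and v' z' of a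
part of the red path d u v z y; the line i separates the points up to i from those
beyond. The paths z v u and z' v' u turn to the same side, so the edge d u passes
z v and z' v' on the same side. As v is joined to u, the edge z v runs between d u
and z' v'. The edge z y starts with z v and is enclosed by d u, u v' and v' z'; but
y lies beyond v'. In the proof [s i e e'] tells the side of the edge e' on which the
edge e crosses the line i. *)
Lemma hook : False.
Proof.
pose d := (0, 3)%N; pose a1 := (3, 4)%N; pose a2 := (3, 5)%N.
pose h1 := (2, 4)%N; pose h2 := (1, 5)%N; pose c := (2, 6)%N.
have start (e e' : nat * nat) : crosses 3 e -> e.2 = e'.2 -> s 3 e e' = (0 < orient (x e'.1) (x e'.2) (x e.1)).
  move=> /XP[[t [/andP[t0 t1] e1]] _] e2; rewrite /s /side e1 affine_orient e2 orient_r mulr0 addr0.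
  by rewrite pmulr_rgt0 // subr_gt0.
have t : s 3 a1 h1 = s 3 a2 h2 by rewrite !start //; exact: pos_eq.
have p1 : s 2 d h1 = s 3 a1 h1 by exact: (@turn 2 3 d a1 h1 3).
have p2 : s 2 d h2 = s 3 a1 h2 by exact: (@turn 2 3 d a1 h2 3).
have p2' : s 2 d h2 = s 3 a2 h2 by exact: (@turn 2 3 d a2 h2 3).
have p3 : s 2 d c = s 3 a2 c by exact: (@turn 2 3 d a2 c 3).
have v1 : s 3 h1 h2 = s 3 a1 h2 by exact: (@turn 3 4 h1 a1 h2 4).
have v2 : s 3 h2 c = s 3 a2 c by exact: (@turn 3 5 h2 a2 c 5).
have z : s 2 h1 d = s 2 c d by exact: (@turn 1 2 h1 c d 2).
have z' : s 2 h1 h2 = s 2 c h2 by exact: (@turn 1 2 h1 c h2 2).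
have m1 : s 2 h1 h2 = s 3 h1 h2 by exact: along.
have m2 : s 2 h2 c = s 3 h2 c by exact: along.
have w1 : s 2 h1 d = ~~ s 2 d h1 by exact: swap.
have w2 : s 2 c d = ~~ s 2 d c by exact: swap.
have w3 : s 2 c h2 = ~~ s 2 h2 c by exact: swap.
have e1 : s 2 d h1 = s 2 d h2 by rewrite p1 t -p2'.
have e2 : s 2 d c = s 2 d h1 by rewrite -[LHS]negbK -w2 -z w1 negbK.
have e3 : s 2 c h2 = s 2 d h2 by rewrite -z' m1 v1 -p2.
have e4 : s 2 c h2 = ~~ s 2 d c by rewrite w3 m2 v2 -p3.
by move: e4; rewrite e3 e2 e1; case: (s 2 d h2).
Qed.
End Hook.

Section Hooks.
Variable R : realFieldType.
Notation pt := (R * R)%type.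
Variables (L K n : nat).
Hypothesis L1 : (0 < L)%N.
Hypothesis K8 : (8 <= K)%N.
Hypothesis n4 : (4 <= n)%N.
Implicit Types (P : term -> pt) (k : term -> term -> bool).
Notation M := n.+4.
Notation T := n.+2.
Notation cdist := (col_dist M).
Notation rdist := (row_dist M).
Notation in_cell := (@in_cell R M).
Notation places := (label_places n).
Notation placed := (@placed R n).
Notation joined := (joined n).
Notation env := (@env R L K n).
Notation srow := (@signed_row R n).

Section Rows.
Variables (P : term -> pt) (k : term -> term -> bool).
Hypothesis E : env P k.
Let F := env_fans E.
Let M8 : (8 <= M)%N. Proof. by move: n4; clear; lia. Qed.
Let TM : (T < M)%N. Proof. by clear; lia. Qed.

Let in_region p := 0 < cdist P 0 p /\ cdist P T p < 0.

Let cut c s r := meet (rdist P r) (P (A c)) (P (W c s)).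

Let cutP c s r : (1 < c < T)%N -> (1 < s < T)%N -> (r < s)%N ->
  [/\ inseg (P (A c)) (P (W c s)) (cut c s r), rdist P r (cut c s r) = 0 & in_region (cut c s r)].
Proof.
move=> hc hs rs; have [cM sM] : (c < M)%N /\ (s < M)%N by clear -hc hs; lia.
have rM : (r < M)%N by apply: ltn_trans sM.
have [h1 h2 h3 h4] := env_cell E hc hs.
have lo : rdist P r (P (A c)) < 0 by exact: (row_dist_A L1 K8 M8 F cM rM).
have hi : 0 < rdist P r (P (W c s)) by apply: h3 => //; clear -rs hs; lia.
have [ip z] := @meetP R (rdist P r) (P (A c)) (P (W c s)) (@affine_row R M P r) ltac:(by rewrite nmulr_rlt0).
rewrite -/(cut c s r) in ip z; split=> //.
have loT : rdist P T (P (A c)) < 0 by exact: (row_dist_A L1 K8 M8 F cM).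
have hiT : rdist P T (P (W c s)) < 0 by apply: h4 => //; case/andP: hs.
have cT : rdist P T (cut c s r) < 0.
  by case: ip => t [/andP[t0 t1] ->]; apply: mix_gt; rewrite ?ltW //; exact: affine_row.
have same c' : (c' < M)%N -> c' != c -> 0 < cdist P c' (cut c s r) * cdist P c' (P (W c s)).
  move=> hc' ne; apply: (strip_col L1 K8 M8 F hc' rM TM); [by rewrite z|exact: ltW|exact: ltW|exact: ltW|].
  move=> t /andP[t0 t1]; case: (ltrgtP t 1) t1 => // [t1 _|-> _].
    have lW d e : (d < M)%N -> (e <= M)%N -> fits L M.+1 M.+1 (W d e) by move=> hd he; rewrite fits_W ?ltnS // ltnW.
    have chW d e : child (W d e) (A d) by rewrite /= eqxx.
    have kW : k (W c s) (A c) = k (W c' M) (A c') by rewrite !(fans_red F) // ltnW.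
    apply: (edge_noncross F (lW c s cM (ltnW sM)) (lW c' M hc' (leqnn _)) (chW _ _) (chW _ _) _ kW).
      by rewrite xpair_eqE !termE eq_sym (negbTE ne).
    by apply: open_to_end; rewrite ?t0.
  rewrite mix1 => /inseg_online e.
  have : orient (P (A c')) (P (W c' M)) (P (W c s)) != 0.
    by apply: (gpP F); rewrite ?fits_A ?fits_W ?termE ?(negbTE ne) // ?ltnS // ltnW.
  by rewrite e eqxx.
split.
  have := same 0%N isT _; rewrite pmulr_lgt0; first by apply; clear -hc; lia.
  by apply: h1; clear -hc; lia.
have := same T _ _; rewrite nmulr_lgt0; first by apply; clear -hc; lia.
by apply: h2; clear -hc; lia.
Qed.

Let on_the_row r p : (r < M)%N -> in_region p -> rdist P r p = 0 -> inseg (P (B r)) (P (W M r)) p.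
Proof. by move=> rM [h1 h2] z; exact: (on_row L1 K8 M8 F rM (_ : (0 < M)%N) TM h1 h2 z). Qed.

Let same_row_side r r' p q : (r < M)%N -> (r' < M)%N -> r != r' -> in_region p -> in_region q ->
  rdist P r p = 0 -> rdist P r q = 0 -> 0 < rdist P r' p * rdist P r' q.
Proof.
move=> hr hr' ne [p1 p2] [q1 q2] zp zq; have iq := on_the_row hr (conj q1 q2) zq.
have := @strip_cols R L K n L1 K8 n4 (transpose_place P) (transpose_colour k) (fans_transpose L1 F) true 0%N r r' (swap_xy p) (swap_xy q) true true isT isT hr hr' ne.
rewrite !signed_col_transpose !signed_row_transpose; apply=> //; try exact: ltW.
by apply: inseg_swap_xy; rewrite /transpose_place !swap_xyK.
Qed.

(** Rows do not cross inside the grid, so it suffices to compare them at one point of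
each. The red edge from A 2 to W 2 (r + 1) crosses the row r and ends in a cell below
the row r'; and where the red edge of W 2 (r' + 1) crosses r', it has crossed r
before. *)
Lemma rows_apart r r' p : (0 < r)%N -> (r.+1 < r')%N -> (r' < n.+1)%N -> 0 < cdist P 0 p -> cdist P T p < 0 ->
  (rdist P r p = 0 -> rdist P r' p < 0) /\ (rdist P r' p = 0 -> 0 < rdist P r p).
Proof.
move=> r0 rr rn p1 p2; have ip : in_region p by [].
have [rM rM'] : (r < M)%N /\ (r' < M)%N by clear -rr rn; lia.
have ne : r != r' by clear -rr; lia.
have hc : (1 < 2 < T)%N by clear -n4; lia.
have low q : in_region q -> rdist P r q = 0 -> rdist P r' q < 0.
  have hs : (1 < r.+1 < T)%N by clear -r0 rr rn; lia.
  move=> iq zq; have [[t [/andP[t0 t1] e]] z reg] := cutP hc hs (ltnSn r).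
  have := same_row_side rM rM' ne iq reg zq z; rewrite nmulr_lgt0 // e.
  have [_ _ _ h4] := env_cell E hc hs.
  apply: mix_gt; rewrite ?ltW //; [exact: affine_row|exact: (row_dist_A L1 K8 M8 F)|apply: h4 => //; clear -rn; lia].
split; first exact: low.
have hs : (1 < r'.+1 < T)%N by clear -r0 rr rn; lia.
move=> zp; have [[t [/andP[t0 t1] e]] z reg] := cutP hc hs (ltnSn r').
have rs : (r < r'.+1)%N by clear -rr; lia.
have [[t' [/andP[t0' t1'] e']] z' reg'] := cutP hc hs rs.
have := same_row_side rM' rM ltac:(by rewrite eq_sym) ip reg zp z; rewrite pmulr_lgt0 //.
have := low _ reg' z'; move: z z'; rewrite e e' !affine_row.
have lo := row_dist_A L1 K8 M8 F (isT : (2 < M)%N) rM; have lo' := row_dist_A L1 K8 M8 F (isT : (2 < M)%N) rM'.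
have [_ _ h3 _] := env_cell E hc hs.
have hi : 0 < rdist P r (P (W 2 r'.+1)) by apply: h3 => //; clear -rn rr; lia.
have hi' : 0 < rdist P r' (P (W 2 r'.+1)) by apply: h3 => //; clear -rn rr; lia.
move: lo lo' hi hi'; set a := rdist P r _; set b := rdist P r' _; set c := rdist P r _; set d := rdist P r' _ => ha hb hc' hd z z' l.
have h : 0 < (t - t') * (d - b) by lra.
have {}h : 0 < t - t' by move: h; rewrite pmulr_lgt0 //; lra.
have : 0 < (t - t') * (c - a) by rewrite mulr_gt0 //; lra.
lra.
Qed.
End Rows.

(** The line of a row, directed so that [srow b r] is positive on its left: [hook] is
stated in terms of orientations. *)
Definition row_line P b r : pt * pt :=
  let s := (P (B r), P (W M r)) in
  if 0 < sg b (- orient s.1 s.2 (P (A 0))) then s else (s.2, s.1).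

Section Gadget.
Variables (P : term -> pt) (k : term -> term -> bool).
Hypothesis E : env P k.
Let F := env_fans E.
Let M8 : (8 <= M)%N. Proof. by move: n4; clear; lia. Qed.

Lemma row_lineP b r q : (r < M)%N ->
  let o := orient (row_line P b r).1 (row_line P b r).2 q in
  [/\ (0 < o) = (0 < srow P b r q), (o < 0) = (srow P b r q < 0) & o = 0 -> srow P b r q = 0].
Proof.
move=> rM; rewrite /row_line /signed_row /row_dist; set o := orient (P (B r)) (P (W M r)).
have nz : o (P (A 0)) != 0 by apply: (gpP F); rewrite ?fits_A ?fits_B ?fits_W ?termE // ?ltnS // ltnW.
have -> : sg b (- o q * o (P (A 0))) = sg b (- o (P (A 0))) * o q by case: b => /=; ring.
have nz' : sg b (- o (P (A 0))) != 0 by rewrite sg_eq0 oppr_eq0.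
case: (ltrgt0P (sg b (- o (P (A 0))))) nz' => // h _ /=.
  by rewrite pmulr_rgt0 // pmulr_rlt0 //; split=> //; rewrite -/(o q) => ->; rewrite mulr0.
have -> : orient (P (W M r)) (P (B r)) q = - o q by rewrite /o [LHS]orientC.
rewrite oppr_gt0 oppr_lt0 nmulr_rgt0 // nmulr_rlt0 //; split=> // /eqP.
by rewrite oppr_eq0 => /eqP ->; rewrite mulr0.
Qed.

Variables (p q : nat) (hp : (p + 5 <= K)%N) (hq : (q + 5 <= K)%N).
Hypotheses (pn : (3 * p <= n)%N) (qn : (5 * q + 3 <= n)%N).

Let shift (b : bool) c m := if b then (c + m)%N else (c - m)%N.

(* In the first copy the labels are five apart, which leaves room for the lines
   of [hook]. In the second copy the row of v is moved outwards by two, and so is that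
   of z, to the other side; all else keeps its row. *)
Let row2 b jv jz l := if l == jv then shift b (5 * l + 7) 2
  else if l == jz then shift (~~ b) (5 * l + 7) 2 else (5 * l + 7)%N.
Let rows1 := [seq (5 * l + 7)%N | l <- iota 0 q].
Let rows2 b jv jz := [seq row2 b jv jz l | l <- iota 0 q].

Let rows1_places : places q rows1.
Proof.
rewrite /label_places size_map size_iota eqxx andbT; apply/andP; split.
  apply: (@homo_sorted _ _ _ ltn ltn); last exact: iota_ltn_sorted.
  by move=> a c /=; clear; lia.
rewrite all_map; apply/allP => l; rewrite mem_iota add0n => /= lm.
by clear -lm qn; lia.
Qed.

Let rows2_places b jv jz : places q (rows2 b jv jz).
Proof.
rewrite /label_places size_map size_iota eqxx andbT; apply/andP; split.
  apply: (@homo_sorted _ _ _ ltn ltn); last exact: iota_ltn_sorted.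
  move=> a c /= ac; rewrite /row2 /shift; case: b => /=; do ?case: eqP => _; clear -ac; lia.
rewrite all_map; apply/allP => l; rewrite mem_iota add0n => /= lm.
by rewrite /row2 /shift; case: b => /=; do ?case: eqP => _; clear -lm qn; lia.
Qed.

Let nth_rows1 l : (l < q)%N -> nth 0%N rows1 l = (5 * l + 7)%N.
Proof. by move=> lm; rewrite (nth_map 0%N) ?size_iota // nth_iota. Qed.
Let nth_rows2 b jv jz l : (l < q)%N -> nth 0%N (rows2 b jv jz) l = row2 b jv jz l.
Proof. by move=> lm; rewrite (nth_map 0%N) ?size_iota // nth_iota. Qed.

Let lines b jz ju jv jy := [:: 0%N; shift (~~ b) (5 * jz + 7) 1; shift (~~ b) (5 * ju + 7) 2;
  shift b (5 * ju + 7) 2; shift b (5 * jv + 7) 1; shift (~~ b) (5 * jy + 7) 2].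
Let ranks b jd jz ju jv jy := [:: (5 * jd + 7)%N; shift (~~ b) (5 * jz + 7) 2; (5 * jz + 7)%N; (5 * ju + 7)%N;
  (5 * jv + 7)%N; shift b (5 * jv + 7) 2; (5 * jy + 7)%N].

Let ranks_lines b jd jz ju jv jy i r : (r = 0%N -> before b jd jz) -> before b jz ju -> before b ju jv -> before b jv jy ->
  (0 < i < 6)%N -> (r <= 6)%N ->
  if (r <= i)%N then before b (nth 0%N (ranks b jd jz ju jv jy) r) (nth 0%N (lines b jz ju jv jy) i)
  else before b (nth 0%N (lines b jz ju jv jy) i) (nth 0%N (ranks b jd jz ju jv jy) r).
Proof.
rewrite /before /lines /ranks /shift; clear.
case: b => /= h1 h2 h3 h4; move: i => [|[|[|[|[|[|i]]]]]] // _; move: r h1 => [h1|[|[|[|[|[|[|r]]]]]]] // _; try (have := h1 erefl); move=> /=; lia.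
Qed.

Let lines_apart b jz ju jv jy i j : before b jz ju -> before b ju jv -> before b jv jy ->
  (jz < q)%N -> (ju < q)%N -> (jv < q)%N -> (jy < q)%N -> (0 < i)%N -> (i < j)%N -> (j < 6)%N ->
  let a := nth 0%N (lines b jz ju jv jy) i in let c := nth 0%N (lines b jz ju jv jy) j in
  [/\ (1 < a < n.+1)%N, (1 < c < n.+1)%N & if b then (a.+1 < c)%N else (c.+1 < a)%N].
Proof.
rewrite /before /lines /shift; move: qn; clear => qn.
case: b => /= h1 h2 h3 h4 h5 h6 h7; move: i => [|[|[|[|[|[|i]]]]]] // _; move: j => [|[|[|[|[|[|j]]]]]] // _ _ /=; split; lia.
Qed.

(** [hook] for two copies of v and z. They can be moved independently of u, as their
rows are given by labels that do not occur in u, and the two copies of the path z v u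
turn to the same side by uniformity. The path may start at a leaf A i, which is
below all rows. *)
Theorem no_winding b d u v z y iu ju iv jv iz jz iy jy :
  fits L p q y -> [&& child u d, child v u, child z v & child y z] ->
  joined k true p q u d -> joined k true p q v u -> joined k true p q z v -> joined k true p q y z ->
  placed P p q iu ju u -> placed P p q iv jv v -> placed P p q iz jz z -> placed P p q iy jy y ->
  (exists i j, [&& i < p, j < q & before b j jz]%N /\ placed P p q i j d) \/
    b /\ (exists2 i, (i < p)%N & d = A i) ->
  [&& iu < p, iv < p, iz < p & iy < p]%N -> [&& ju < q, jv < q, jz < q & jy < q]%N ->
  [&& before b jz ju, before b ju jv & before b jv jy] ->
  jv \notin labels false u -> jz \notin labels false v -> False.
Proof.
move=> ly /and4P[cd cu cv cz] jd ju' jv' jz' pu pv pz py pd /and4P[hiu hiv hiz hiy] /and4P[hju hjv hjz hjy].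
move=> /and3P[bz bu bv] nu nv.
have lz := fits_child ly cz; have lv := fits_child lz cv; have lu := fits_child lv cu; have ld := fits_child lu cd.
pose sl := iota 2 p; have hsl : places p sl by apply: places_iota => //; move: pn; clear; lia.
pose a1 := at_places sl rows1; pose a2 := at_places sl (rows2 b jv jz).
have h1 := rows1_places; have h2 := rows2_places b jv jz.
have sub x w l : child x w -> l \in labels false w -> l \in labels false x.
  by case: x => //= s t /orP[]/eqP->; rewrite mem_cat => ->; rewrite ?orbT.
have nzu : jz \notin labels false u by apply: contra nv; exact: sub.
have shared w : fits L p q w -> jv \notin labels false w -> jz \notin labels false w -> a2 w = a1 w.
  move=> /and3P[_ _ /allP lw] n1 n2; apply: relabel_ext => l hl //.
  rewrite nth_rows1 ?lw // nth_rows2 ?lw // /row2.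
  have e1 : (l == jv) = false by apply: contraNF n1 => /eqP <-.
  by rewrite e1; case: eqP => // e; rewrite -e hl in n2.
have su : a2 u = a1 u by exact: shared.
pose t i := nth (a1 d) [:: a1 d; a2 z; a1 z; a1 u; a1 v; a2 v; a1 y] i.
pose ln i := nth 0%N (lines b jz ju jv jy) i.
have lt_ i : (i <= 6)%N -> fits L M.+1 M.+1 (t i).
  move=> hi; apply: inner_fits.
  by case: i hi => [|[|[|[|[|[|[|i]]]]]]] // _; apply: (inner_at _ hsl) => //; eassumption.
have lnM i : (0 < i < 6)%N -> (1 < ln i < n.+1)%N.
  move=> /andP[i0 i6]; case: (ltnP i 5) => i5.
    by case: (lines_apart bz bu bv hjz hju hjv hjy i0 i5 isT).
  by case: (lines_apart bz bu bv hjz hju hjv hjy (isT : 0 < 1)%N (leq_trans (isT : 2 <= 5)%N i5) i6).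
have nzv : jz != jv by move: bz bu; rewrite /before; case: (b); clear; lia.
have cells jj r : (0 < r <= 6)%N -> exists2 c, (1 < c < T)%N & in_cell P c (nth 0%N (ranks b jj jz ju jv jy) r) (P (t r)).
  move=> hr; have c1 i j w : (i < p)%N -> (j < q)%N -> placed P p q i j w ->
      exists2 c, (1 < c < T)%N & in_cell P c (5 * j + 7) (P (a1 w)).
    move=> hi hj pw; exists (nth 0%N sl i); first exact: places_nth hsl hi.
    by rewrite -nth_rows1 //; exact: pw.
  have c2 i j w : (i < p)%N -> (j < q)%N -> placed P p q i j w ->
      exists2 c, (1 < c < T)%N & in_cell P c (row2 b jv jz j) (P (a2 w)).
    move=> hi hj pw; exists (nth 0%N sl i); first exact: places_nth hsl hi.
    by rewrite -nth_rows2 //; exact: pw.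
  have z2 := c2 _ _ _ hiz hjz pz; rewrite /row2 (negbTE nzv) eqxx in z2.
  have v2 := c2 _ _ _ hiv hjv pv; rewrite /row2 eqxx in v2.
  have z1 := c1 _ _ _ hiz hjz pz; have v1 := c1 _ _ _ hiv hjv pv.
  have u1 := c1 _ _ _ hiu hju pu; have y1 := c1 _ _ _ hiy hjy py.
  by case: r hr => [|[|[|[|[|[|[|r]]]]]]].
have sgn i r : (0 < i < 6)%N -> (r <= 6)%N ->
    if (r <= i)%N then srow P b (ln i) (P (t r)) < 0 else 0 < srow P b (ln i) (P (t r)).
  move=> hi hr; have lM : (ln i < M.-1)%N by have := lnM i hi; clear; lia.
  have use jj c j : (r = 0%N -> before b jj jz) -> nth 0%N (ranks b jj jz ju jv jy) r = j -> in_cell P c j (P (t r)) ->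
      if (r <= i)%N then srow P b (ln i) (P (t r)) < 0 else 0 < srow P b (ln i) (P (t r)).
    move=> bd ej cl; have := ranks_lines bd bz bu bv hi hr; rewrite ej.
    by have [s1 s2] := in_cell_signed_row b cl lM; case: ifP => _; [exact: s2|exact: s1].
  case: (posnP r) => [r0|r0]; last first.
    have [|c hc cl] := cells 0%N r; first by rewrite r0.
    by apply: use (_ : r = 0%N -> _) erefl cl => e; rewrite e in r0.
  rewrite r0 /=; case: pd => [[i' [j' [/and3P[hi' hj' bd] pd]]]|[eb [i' hi' ed]]].
    have := use j' (nth 0%N sl i') (5 * j' + 7)%N (fun=> bd); rewrite r0 /= => -> //.
    by rewrite -nth_rows1 //; exact: pd.
  rewrite eb /signed_row /t /= ed; apply: (row_dist_A L1 K8 M8 F); last by move: lM; clear; lia.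
  by have := places_nth hsl hi'; clear; lia.
have lnM' i : (0 < i < 6)%N -> (ln i < M)%N by move=> /lnM; clear; lia.
have reg r : (0 < r <= 6)%N -> 0 < cdist P 0 (P (t r)) /\ 0 < - cdist P T (P (t r)).
  move=> hr; have [c hc [cl1 cl2 _ _]] := cells 0%N r hr.
  by rewrite oppr_gt0; split; [apply: cl1|apply: cl2] => //; move: hc; clear; lia.
have ne i j : (i < j)%N -> (j <= 6)%N -> t i <> t j.
  move=> ij j6 e; case: (ltnP (maxn i 1) j) => h; last first.
    have [i0 j1] : i = 0%N /\ j = 1%N by move: h ij; rewrite /maxn; case: ifP; clear; lia.
    move: e; rewrite i0 j1 /t /= => /(congr1 depth); rewrite !depth_relabel.
    by have := ltn_trans (child_depth cd) (ltn_trans (child_depth cu) (child_depth cv)); clear; lia.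
  have hl : (0 < maxn i 1 < 6)%N by move: h j6; clear; lia.
  have := sgn _ i hl ltac:(by move: ij j6; clear; lia); have := sgn _ j hl j6.
  by rewrite e leq_maxl leqNgt h /= => h3 h4; move: (lt_trans h3 h4); rewrite ltxx.
have tI i j : (i <= 6)%N -> (j <= 6)%N -> t i = t j -> i = j.
  by move=> hi hj e; case: (ltngtP i j) => // lt; [case: (ne i j lt hj e)|case: (ne j i lt hi (esym e))].
pose edges : seq (nat * nat) := [:: (0, 3); (3, 4); (3, 5); (2, 4); (1, 5); (2, 6)]%N.
have red (e : nat * nat) : e \in edges -> exists i j, [/\ e = (i, j) \/ e = (j, i), (i <= 6)%N && (j <= 6)%N, child (t i) (t j) & k (t i) (t j) = true].
  rewrite !inE => /or4P[||| /or3P[||]]/eqP->.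
  - by exists 3%N, 0%N; split; [right|..|exact: at_child|exact: jd].
  - by exists 4%N, 3%N; split; [right|..|exact: at_child|exact: ju'].
  - by exists 5%N, 3%N; rewrite /t /= -su; split; [right|..|exact: at_child|exact: ju'].
  - by exists 2%N, 4%N; split; [left|..|exact: at_child|exact: jv'].
  - by exists 1%N, 5%N; split; [left|..|exact: at_child|exact: jv'].
  by exists 6%N, 2%N; split; [right|..|exact: at_child|exact: jz'].
have lt_edge (e : nat * nat) : e \in edges -> (e.1 < e.2)%N.
  by rewrite !inE => /or4P[||| /or3P[||]]/eqP->.
have ncC (a c a' c' : pt) : noncross a c a' c' -> noncross c a a' c'.
  by move=> h o /insegC; exact: h.
have ncC' (a c a' c' : pt) : noncross a c a' c' -> noncross a c c' a'.
  by move=> h o i1 /insegC; exact: h.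
have nc (e e' : nat * nat) : e \in edges -> e' \in edges -> e != e' ->
    noncross (P (t e.1)) (P (t e.2)) (P (t e'.1)) (P (t e'.2)).
  move=> he he' ee; have l := lt_edge e he; have l' := lt_edge e' he'.
  have [i [j [hij /andP[hi hj] c kr]]] := red e he; have [i' [j' [hij' /andP[hi' hj'] c' kr']]] := red e' he'.
  have np : (t i, t j) != (t i', t j').
    apply/eqP => -[/(tI _ _ hi hi') ei /(tI _ _ hj hj') ej]; move: ee l l'; rewrite ei ej in hij.
    case: hij => ->; case: hij' => ->; rewrite ?eqxx //= => _; clear; lia.
  have := edge_noncross F (lt_ i hi) (lt_ i' hi') c c' np ltac:(by rewrite kr kr').
  case: hij => -> /=; case: hij' => -> //= h; [exact/ncC/ncC'|exact: ncC|exact: ncC'].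
have gpt i j l : (i <= 6)%N -> (j <= 6)%N -> (l <= 6)%N -> i != j -> j != l -> i != l ->
    orient (P (t i)) (P (t j)) (P (t l)) != 0.
  move=> hi hj hl ij jl il; apply: (gpP F) (lt_ i hi) (lt_ j hj) (lt_ l hl) _ _ _.
  - by apply: contraNneq ij => /(tI _ _ hi hj) ->.
  - by apply: contraNneq jl => /(tI _ _ hj hl) ->.
  by apply: contraNneq il => /(tI _ _ hi hl) ->.
have turn : 0 < orient (P (t 2)) (P (t 4)) (P (t 3)) * orient (P (t 1)) (P (t 5)) (P (t 3)).
  have n1 := gpt 2%N 4%N 3%N isT isT isT isT isT isT; have n2 := gpt 1%N 5%N 3%N isT isT isT isT isT isT.
  apply: same_sign_gt0 => //.
  have := @obs_pad R L K n L1 K8 n4 P k F p q hp hq sl sl rows1 (rows2 b jv jz) (up z) (up v) (up u) (up u) (up u) (up u) hsl hsl h1 h2.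
  rewrite /= !up_fits // => /(_ isT).
  rewrite !(@at_up L n p q sl rows1 _ hsl h1) // !(@at_up L n p q sl (rows2 b jv jz) _ hsl h2) // -/(a2 u) su => -[].
  by [].
apply: (@hook R (P \o t) (fun i => (row_line P b (ln i)).1) (fun i => (row_line P b (ln i)).2) (cdist P 0) (fun o => - cdist P T o)) => //.
- exact: affine_col.
- by move=> s o o'; rewrite affine_col; ring.
- move=> i r hi ri; have [_ -> _] := row_lineP b (P (t r)) (lnM' i hi).
  by have := sgn i r hi ltac:(by move: ri hi; clear; lia); rewrite ri.
- move=> i r hi /andP[ri r6]; have [-> _ _] := row_lineP b (P (t r)) (lnM' i hi).
  by have := sgn i r hi r6; rewrite leqNgt ri.
- move=> i j o i0 ij j6 g1 g2.
  have [hi hj] : (0 < i < 6)%N /\ (0 < j < 6)%N by move: i0 ij j6; clear; lia.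
  have [rj1 rj2 rj3] := row_lineP b o (lnM' j hj); have [ri1 ri2 ri3] := row_lineP b o (lnM' i hi).
  rewrite rj2 ri1; have [ra rb apart] := lines_apart bz bu bv hjz hju hjv hjy i0 ij j6.
  rewrite oppr_gt0 in g2; rewrite -/(ln i) -/(ln j) in ra rb apart.
  case/andP: ra rb => ra1 ra2 /andP[rb1 rb2].
  have sg0 c r : srow P c r o = 0 -> rdist P r o = 0 by move/eqP; rewrite sg_eq0 => /eqP.
  case: (b) apart ri3 rj3 => apart ri3 rj3.
    have [d1 d2] := rows_apart E (ltnW ra1) apart rb2 g1 g2.
    by split; [move/ri3/sg0|move/rj3/sg0].
  have [d1 d2] := rows_apart E (ltnW rb1) apart ra2 g1 g2.
  by rewrite {1 2}/signed_row /= oppr_gt0 oppr_lt0; split; [move/ri3/sg0|move/rj3/sg0].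
Qed.

End Gadget.

End Hooks.

(** * Forcing a winding path *)

Section Zigzag.
Variable R : realFieldType.
Notation pt := (R * R)%type.
Variables (L K n : nat).
Hypothesis L1 : (0 < L)%N.
Hypothesis K8 : (8 <= K)%N.
Hypothesis n4 : (4 <= n)%N.
Implicit Types (P : term -> pt) (k : term -> term -> bool).
Notation M := n.+4.
Notation places := (label_places n).
Notation placed := (@placed R n).
Notation joined := (joined n).
Notation env := (@env R L K n).

Section Transport.
Variables (P : term -> pt) (k : term -> term -> bool).

(** Terms are described with as few labels as they need. To relate two of them, both
are put into a larger arrangement, in which the [p] labels of the one take the
places listed in [l]. *)
Definition into p' p (l : seq nat) := [&& sorted ltn l, all (fun i => i < p')%N l & size l == p].

Lemma into_lt p' p l i : into p' p l -> (i < p)%N -> (nth 0%N l i < p')%N.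
Proof. by move=> /and3P[_ /all_nthP h /eqP e] ip; apply: h; rewrite e. Qed.

Lemma into_ltn p' p l i j : into p' p l -> (i < p)%N -> (j < p)%N ->
  (nth 0%N l i < nth 0%N l j)%N = (i < j)%N.
Proof.
move=> /and3P[s al /eqP e] hi hj; apply: (@mono_lt p p') => //.
by rewrite -e; apply: mono_nth.
Qed.

Lemma into_inj p' p l i j : into p' p l -> (i < p)%N -> (j < p)%N ->
  nth 0%N l i = nth 0%N l j -> i = j.
Proof.
move=> h hi hj e; case: (ltngtP i j) => // lt.
  by move: (into_ltn h hi hj); rewrite e ltnn lt.
by move: (into_ltn h hj hi); rewrite e ltnn lt.
Qed.

Lemma into_before p' p l b i j : into p' p l -> (i < p)%N -> (j < p)%N ->
  before b (nth 0%N l i) (nth 0%N l j) = before b i j.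
Proof. by move=> h hi hj; case: b => /=; rewrite (into_ltn h). Qed.

Lemma into_places p' p l sl : into p' p l -> places p' sl -> places p (map (nth 0%N sl) l).
Proof.
move=> /and3P[s al e] /and3P[ss sa /eqP es]; rewrite /label_places size_map e andbT; apply/andP; split.
  move: al; elim: l s {e} => //= a l IH s /andP[la al]; rewrite (path_sortedE ltn_trans).
  move: s; rewrite (path_sortedE ltn_trans) => /andP[s1 s2]; apply/andP; split; last first.
    by apply: IH al; move: s2; case: (l).
  rewrite all_map; apply/allP => i hi /=; apply: (sorted_ltn_nth ltn_trans 0%N ss); rewrite ?inE ?es //.
    exact: (allP al).
  exact: (allP s1).
rewrite all_map; apply/allP => i hi /=; apply: (allP sa); apply: mem_nth; rewrite es; exact: (allP al).
Qed.

Lemma at_at p q p' q' l m sl tl x : into p' p l -> into q' q m -> fits L p q x ->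
  at_places sl tl (at_places l m x) = at_places (map (nth 0%N sl) l) (map (nth 0%N tl) m) x.
Proof.
move=> /and3P[_ _ /eqP e] /and3P[_ _ /eqP e'] /and3P[_ /allP h1 /allP h2].
by rewrite /at_places relabel_comp; apply: relabel_ext => i hi /=; rewrite (nth_map 0%N) ?e ?e' ?h1 ?h2.
Qed.

Lemma into_fits d p q p' q' l m x : into p' p l -> into q' q m -> fits d p q x -> fits d p' q' (at_places l m x).
Proof. by move=> hl hm lx; apply: fits_relabel lx _ _ => i; exact: into_lt. Qed.

Lemma into_joined c p q p' q' l m x y : into p' p l -> into q' q m -> fits L p q x -> fits L p q y ->
  joined k c p q x y -> joined k c p' q' (at_places l m x) (at_places l m y).
Proof.
move=> hl hm lx ly j sl tl hs ht.
by rewrite !(at_at _ _ hl hm) //; apply: j; [exact: into_places hl hs|exact: into_places hm ht].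
Qed.

Lemma into_placed p q p' q' l m i j x : into p' p l -> into q' q m -> fits L p q x ->
  (i < p)%N -> (j < q)%N ->
  placed P p q i j x -> placed P p' q' (nth 0%N l i) (nth 0%N m j) (at_places l m x).
Proof.
move=> hl hm lx ip jq px sl tl hs ht; rewrite (at_at _ _ hl hm) //.
have := px _ _ (into_places hl hs) (into_places hm ht).
case/and3P: hl => _ _ /eqP e; case/and3P: hm => _ _ /eqP e'.
by rewrite !(nth_map 0%N) ?e ?e'.
Qed.

Lemma at_labels b l m x : labels b (at_places l m x) = map (nth 0%N (if b then l else m)) (labels b x).
Proof. by rewrite /at_places labels_relabel; case: b. Qed.

Lemma at_labels_sub b p q p' q' l m x : into p' p l -> into q' q m -> fits L p q x ->
  {subset labels b (at_places l m x) <= if b then l else m}.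
Proof.
move=> /and3P[_ _ /eqP e] /and3P[_ _ /eqP e'] /and3P[_ /allP h1 /allP h2] i.
by rewrite at_labels; case: b => /mapP[a ha ->]; apply: mem_nth; rewrite ?e ?e' ?h1 ?h2.
Qed.

(** The term z ends a red path that would wind if its next vertex were placed
beyond the row jv, in the direction b. *)
Definition winds b p q z jv := exists d u v iu ju iv iz jz,
  [/\ [&& child u d, child v u & child z v],
      [/\ joined k true p q u d, joined k true p q v u & joined k true p q z v],
      [/\ placed P p q iu ju u, placed P p q iv jv v & placed P p q iz jz z],
      (exists i j, [&& i < p, j < q & before b j jz]%N /\ placed P p q i j d) \/
        b /\ (exists2 i, (i < p)%N & d = A i) &
      [&& iu < p, iv < p, iz < p, ju < q, jv < q & jz < q]%N /\
      [&& before b jz ju, before b ju jv, jv \notin labels false u & jz \notin labels false v]].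

Lemma into_winds b p q p' q' l m z jv : into p' p l -> into q' q m -> fits L p q z ->
  winds b p q z jv -> winds b p' q' (at_places l m z) (nth 0%N m jv).
Proof.
move=> hl hm lz [d [u [v [iu [ju [iv [iz [jz]]]]]]]].
case=> /and3P[c1 c2 c3] [j1 j2 j3] [p1 p2 p3] pd [/and5P[h1 h2 h3 h4 /andP[h5 h6]] /and4P[h7 h8 h9 h10]].
have lv := fits_child lz c3; have lu := fits_child lv c2; have ld := fits_child lu c1.
exists (at_places l m d), (at_places l m u), (at_places l m v), (nth 0%N l iu), (nth 0%N m ju), (nth 0%N l iv), (nth 0%N l iz), (nth 0%N m jz).
have nin x j : fits L p q x -> (j < q)%N -> j \notin labels false x -> nth 0%N m j \notin labels false (at_places l m x).
  move=> /and3P[_ _ /allP lx] jq; apply: contra; rewrite at_labels => /mapP[a ha e].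
  by rewrite (into_inj hm jq (lx _ ha) e).
split.
- by rewrite !at_child.
- by split; apply: (into_joined hl hm).
- by split; apply: (into_placed hl hm).
- case: pd => [[i [j [/and3P[hi hj hb] pd]]]|[eb [i hi ->]]].
    left; exists (nth 0%N l i), (nth 0%N m j); split; last exact: (into_placed hl hm).
    by rewrite !(into_lt hl) // !(into_lt hm) // (into_before _ hm).
  by right; split=> //; exists (nth 0%N l i); rewrite ?(into_lt hl).
split; first by rewrite !(into_lt hl) // !(into_lt hm).
by rewrite !(into_before _ hm) // h7 h8 !nin.
Qed.

End Transport.

Lemma joined_transpose k c p q x y : joined (transpose_colour k) c q p (transpose x) (transpose y) <-> joined k (~~ c) p q x y.
Proof.
split=> h sl tl hs ht.
  by have := h tl sl ht hs; rewrite /transpose_colour !at_transpose !transposeK => <-; rewrite negbK.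
by rewrite /transpose_colour !at_transpose !transposeK h // negbK.
Qed.

Lemma placed_transpose P p q i j x : placed P p q i j x -> placed (transpose_place P) q p j i (transpose x).
Proof.
by move=> h sl tl hs ht; rewrite /transpose_place at_transpose transposeK; apply: in_cell_transpose; exact: h.
Qed.

Hypotheses (L7 : (7 <= L)%N) (K15 : (15 <= K)%N) (n60 : (60 <= n)%N).

Definition dims p q := (p <= 10)%N && (q <= 10)%N.

Let dimsP p q : dims p q -> [/\ p + 5 <= K, q + 5 <= K, 3 * p <= n & 3 * q <= n]%N.
Proof. by rewrite /dims; move: K15 n60; clear; split; lia. Qed.

Let dims5 p q : dims p q -> (5 * q + 3 <= n)%N.
Proof. by rewrite /dims; move: n60; clear; lia. Qed.

Section Steps.
Variables (P : term -> pt) (k : term -> term -> bool).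
Hypothesis E : env P k.

(* [no_winding] as a bound on the row of a next vertex joined in red. *)
Lemma winds_stop b p q z jv y iy jy : dims p q -> winds P k b p q z jv -> fits 7 p q y -> child y z ->
  joined k true p q y z -> placed P p q iy jy y -> (iy < p)%N -> (jy < q)%N -> before b jv jy -> False.
Proof.
move=> dm [d [u [v [iu [ju [iv [iz [jz]]]]]]]].
case=> /and3P[c1 c2 c3] [j1 j2 j3] [p1 p2 p3] pd [/and5P[h1 h2 h3 h4 /andP[h5 h6]] /and4P[h7 h8 h9 h10]].
move=> ly cy jy' py hiy hjy hb; have [e1 e2 e3 e4] := dimsP dm.
have ly' : fits L p q y by case/and3P: ly => ld l1 l2; rewrite /fits l1 l2 (leq_trans ld).
apply: (@no_winding R L K n L1 K8 n4 P k E p q e1 e2 e3 (dims5 dm) b d u v z y iu ju iv jv iz jz iy jy) => //.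
- by rewrite c1 c2 c3.
- by rewrite h1 h2 h3.
- by rewrite h4 h5 h6.
by rewrite h7 h8.
Qed.

Lemma placed_W p q c r : (c < p)%N -> (r < q)%N -> placed P p q c r (W c r).
Proof. by move=> cp rq sl tl hs ht; apply: (env_cell E); [exact: places_nth hs cp|exact: places_nth ht rq]. Qed.

Lemma joined_pole p q c r : (c < p)%N -> (r < q)%N -> joined k true p q (W c r) (A c).
Proof.
move=> cp rq sl tl hs ht; apply: (fans_red (env_fans E)).
  by have := places_nth hs cp; clear; lia.
by have := places_nth ht rq; clear; lia.
Qed.

(* The shortest red path that winds upwards starts at a leaf A c. *)
Lemma winds_pole p q c r v iv jv z iz jz : child v (W c r) -> child z v ->
  joined k true p q v (W c r) -> joined k true p q z v ->
  placed P p q iv jv v -> placed P p q iz jz z ->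
  [&& c < p, iv < p, iz < p, r < q, jv < q & jz < q]%N -> [&& jz < r, r < jv & jz \notin labels false v]%N ->
  winds P k true p q z jv.
Proof.
move=> c2 c3 j2 j3 pv pz /and5P[h1 h2 h3 h4 /andP[h5 h6]] /and3P[h7 h8 h9].
exists (A c), (W c r), v, c, r, iv, iz, jz; split.
- by rewrite c2 c3 /= eqxx.
- by split=> //; exact: joined_pole.
- by split=> //; exact: placed_W.
- by right; split=> //; exists c.
by rewrite h1 h2 h3 h4 h5 h6 /= h7 h8 h9 !inE (gtn_eqF h8).
Qed.

(** [request] for two terms from smaller arrangements that are interleaved without
common labels; the lists [l], [m], [l'], [m'] choose their relative position. *)
Lemma request_apart p q p1 q1 p2 q2 l m l' m' d x y i1 j1 i2 j2 : dims p q ->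
  into p p1 l -> into q q1 m -> into p p2 l' -> into q q2 m' ->
  ~~ has [in l] l' -> ~~ has [in m] m' -> (d < 7)%N ->
  fits d p1 q1 x -> fits d p2 q2 y -> placed P p1 q1 i1 j1 x -> placed P p2 q2 i2 j2 y ->
  [&& i1 < p1, j1 < q1, i2 < p2 & j2 < q2]%N ->
  let x' := at_places l m x in let y' := at_places l' m' y in let z := Join x' y' in
  [/\ fits d p q x', fits d p q y', fits d.+1 p q z,
    placed P p q (nth 0%N l i1) (nth 0%N m j1) x' & placed P p q (nth 0%N l' i2) (nth 0%N m' j2) y'] /\
  ([/\ joined k true p q z x', joined k false p q z y' & placed P p q (nth 0%N l i1) (nth 0%N m' j2) z] \/
   [/\ joined k false p q z x', joined k true p q z y' & placed P p q (nth 0%N l' i2) (nth 0%N m j1) z]).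
Proof.
move=> dm hl hm hl' hm' dl dm' d7 lx ly px py /and4P[h1 h2 h3 h4] x' y' z.
have wL e a b t : (e <= 7)%N -> fits e a b t -> fits L a b t.
  by move=> e7 /and3P[ld l1 l2]; rewrite /fits l1 l2 (leq_trans ld) // (leq_trans e7).
have lx' : fits d p q x' by exact: into_fits lx.
have ly' : fits d p q y' by exact: into_fits ly.
have lz : fits d.+1 p q z.
  move: lx' ly'; rewrite /fits /= !all_cat => /and3P[a1 -> ->] /and3P[a2 -> ->].
  by rewrite ltnS geq_max a1 a2.
have Lx := wL _ _ _ _ (ltnW d7) lx; have Ly := wL _ _ _ _ (ltnW d7) ly.
have px' := into_placed hl hm Lx h1 h2 px; have py' := into_placed hl' hm' Ly h3 h4 py.
split; first by [].
have [e1 e2 e3 e4] := dimsP dm.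
apply: (request L1 K8 n4 E e1 e2 e3 e4) => //; first exact: wL lz.
  apply/andP; split; apply/hasPn => a /(at_labels_sub hl' hm' Ly) a'; apply/negP => /(at_labels_sub hl hm Lx) a1.
    by case/hasP: dl; exists a.
  by case/hasP: dm'; exists a.
by rewrite (into_lt hl) // (into_lt hm) // (into_lt hl') // (into_lt hm').
Qed.

End Steps.

Definition blue_winds P k b p q z iv := winds (transpose_place P) (transpose_colour k) b q p (transpose z) iv.

Section BlueSteps.
Variables (P : term -> pt) (k : term -> term -> bool).
Hypothesis E : env P k.

Lemma blue_winds_stop b p q z iv y iy jy : dims p q -> blue_winds P k b p q z iv -> fits 7 p q y -> child y z ->
  joined k false p q y z -> placed P p q iy jy y -> (iy < p)%N -> (jy < q)%N -> before b iv iy -> False.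
Proof.
move=> dm w ly cy jy' py hiy hjy hb.
apply: (winds_stop (env_transpose L1 E) _ w (_ : fits 7 q p (transpose y)) _ _ (placed_transpose py)) => //.
- by rewrite /dims andbC.
- by rewrite fits_transpose.
- by rewrite child_transpose.
by apply/joined_transpose.
Qed.

Lemma blue_winds_pole p q c r v iv jv z iz jz : child v (W c r) -> child z v ->
  joined k false p q v (W c r) -> joined k false p q z v ->
  placed P p q iv jv v -> placed P p q iz jz z ->
  [&& r < q, jv < q, jz < q, c < p, iv < p & iz < p]%N -> [&& iz < c, c < iv & iz \notin labels true v]%N ->
  blue_winds P k true p q z iv.
Proof.
move=> c2 c3 j2 j3 pv pz h1 h2.
apply: (@winds_pole _ _ (env_transpose L1 E) q p r c (transpose v) jv iv (transpose z) jz iz) => //.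
- by rewrite -[W r c]/(transpose (W c r)) child_transpose.
- by rewrite child_transpose.
- by rewrite -[W r c]/(transpose (W c r)); apply/joined_transpose.
- by apply/joined_transpose.
- exact: placed_transpose.
- exact: placed_transpose.
by rewrite labels_transpose.
Qed.

Lemma into_blue_winds b p q p' q' l m z iv : into p' p l -> into q' q m -> fits L p q z ->
  blue_winds P k b p q z iv -> blue_winds P k b p' q' (at_places l m z) (nth 0%N l iv).
Proof. by move=> hl hm lz w; rewrite /blue_winds at_transpose; apply: (into_winds hm hl _ w); rewrite fits_transpose. Qed.

Lemma blue_winds_left p q d id jd u iu ju v iv jv z iz jz :
  [&& child u d, child v u & child z v] ->
  joined k false p q u d -> joined k false p q v u -> joined k false p q z v ->
  placed P p q id jd d -> placed P p q iu ju u -> placed P p q iv jv v -> placed P p q iz jz z ->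
  [&& id < p, iu < p, iv < p & iz < p]%N -> [&& jd < q, ju < q, jv < q & jz < q]%N ->
  [&& iv < iu, iu < iz & iz < id]%N -> (iv \notin labels true u) && (iz \notin labels true v) ->
  blue_winds P k false p q z iv.
Proof.
move=> /and3P[c1 c2 c3] j1 j2 j3 pd pu pv pz /and4P[h1 h2 h3 h4] /and4P[g1 g2 g3 g4] /and3P[b1 b2 b3] /andP[n1 n2].
exists (transpose d), (transpose u), (transpose v), ju, iu, jv, jz, iz; split.
- by rewrite !child_transpose c1 c2 c3.
- by split; apply/joined_transpose.
- by split; apply: placed_transpose.
- by left; exists jd, id; split; [rewrite g1 h1 /= b3|exact: placed_transpose].
by rewrite h2 h3 h4 g2 g3 g4 /= !labels_transpose n1 n2 b1 b2.
Qed.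

Let corner_into (b : bool) p : into p.+1 p (iota (~~ b) p).
Proof.
rewrite /into iota_ltn_sorted size_iota eqxx andbT /=; apply/allP => i; rewrite mem_iota.
by case: b; clear; lia.
Qed.

Let single p c : (c < p)%N -> into p 1 [:: c].
Proof. by move=> h; rewrite /into /= h. Qed.

Let single_out (b : bool) p : ~~ has [in iota (~~ b) p] [:: if b then p else 0%N].
Proof. by rewrite /= orbF mem_iota; case: b; clear; lia. Qed.

(** Ask for a common neighbour of z and of a W that is beyond both bounds. If it is
joined to z in red, it takes the row of the W, and if in blue, its column; both are
excluded by [no_winding]. *)
Lemma winds_both h p q z i j iz jz : dims p.+1 q.+1 -> fits 6 p q z -> placed P p q iz jz z -> (iz < p)%N -> (jz < q)%N ->
  winds P k true p q z j -> (j < q)%N -> blue_winds P k h p q z i -> (i < p)%N -> False.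
Proof.
move=> dm lz pz hi hj w jq wb ip.
have Lz : fits L p q z by case/and3P: lz => ld l1 l2; rewrite /fits l1 l2 (leq_trans ld) // (leq_trans _ L7).
have lw : fits 6 1 1 (W 0 0) by [].
have c0 : ((if h then p else 0) < p.+1)%N by case: h {wb}.
have := request_apart E dm (corner_into h p) (corner_into true q) (single c0) (single (ltnSn q)) (single_out h p) (single_out true q)
  (isT : 6 < 7)%N lz lw pz (@placed_W _ _ E 1 1 0 0 isT isT).
rewrite hi hj => /(_ isT) [[l1 l2 l3 p1 p2] [[j1 j2 py]|[j1 j2 py]]].
  apply: (winds_stop E dm (into_winds (corner_into h p) (corner_into true q) Lz w) _ _ j1 py) => //.
  - by rewrite /= eqxx.
  - exact: (into_lt (corner_into h p) hi).
  by rewrite /= nth_iota.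
apply: (blue_winds_stop dm (into_blue_winds (corner_into h p) (corner_into true q) Lz wb) _ _ j1 py) => //.
- by rewrite /= eqxx.
- exact: (into_lt (corner_into true q) hj).
by rewrite /= nth_iota //; case: (h); rewrite ?add0n.
Qed.

End BlueSteps.

Lemma fits_deep d e p q x : fits d p q x -> (d <= e)%N -> fits e p q x.
Proof. by case/and3P=> ld l1 l2 de; rewrite /fits l1 l2 (leq_trans ld). Qed.

Section Chase.
Variables (P : term -> pt) (k : term -> term -> bool).
Hypothesis E : env P k.

(* The common neighbour of W 0 0 and W 1 1: it is above W 0 0, to which it is joined
   in red, and to the left of W 1 1. *)
Variable x1 : term.
Hypotheses (l1 : fits 2 2 2 x1) (c0 : child x1 (W 0 0)) (c1 : child x1 (W 1 1)).
Hypotheses (r0 : joined k true 2 2 x1 (W 0 0)) (b1 : joined k false 2 2 x1 (W 1 1)).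
Hypothesis p1 : placed P 2 2 0 1 x1.

Let pW c r p q : (c < p)%N -> (r < q)%N -> placed P p q c r (W c r). Proof. exact: (placed_W E). Qed.

Let deepL d p q x : fits d p q x -> (d <= 7)%N -> fits L p q x.
Proof. by move=> h d7; apply: fits_deep h _; exact: leq_trans d7 L7. Qed.

Let out b p q p' q' l m x j : into p' p l -> into q' q m -> fits L p q x ->
  j \notin (if b then l else m) -> j \notin labels b (at_places l m x).
Proof. by move=> hl hm lx; apply: contra; exact: (at_labels_sub hl hm lx). Qed.

Let l1L : fits L 2 2 x1. Proof. exact: (deepL l1 isT). Qed.

Let r1 p q l m : into p 2 l -> into q 2 m ->
  child (at_places l m x1) (W (nth 0 l 0) (nth 0 m 0))%N /\ joined k true p q (at_places l m x1) (W (nth 0 l 0) (nth 0 m 0))%N.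
Proof.
move=> hl hm; split; first exact: (at_child l m c0).
exact: (into_joined hl hm l1L (fits_child l1L c0) r0).
Qed.

(* The red path A, W, x1 goes up twice; a vertex joined to x1 in red that is below
   the W completes it. *)
Let x1_winds p q l m z iz jz : dims p q -> into p 2 l -> into q 2 m -> child z (at_places l m x1) ->
  joined k true p q z (at_places l m x1) -> placed P p q iz jz z ->
  (iz < p)%N -> (jz < nth 0 m 0)%N -> winds P k true p q z (nth 0 m 1)%N.
Proof.
move=> dm hl hm cz jz' pz iz' lt; have [cW jW] := r1 hl hm.
have h2 : (nth 0%N m 0 < nth 0%N m 1)%N by rewrite (into_ltn hm).
apply: (winds_pole E cW cz jW jz' (into_placed hl hm l1L _ _ p1) pz) => //.
  rewrite !(into_lt hl) // !(into_lt hm) // iz' /=; apply: ltn_trans lt _; exact: (into_lt hm).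
rewrite lt h2 /=; apply: (out (b := false) hl hm l1L); apply/negP => /(nthP 0%N)[i].
case/and3P: (hm) => _ _ /eqP -> hi e; rewrite -e in lt; case: i hi lt {e} => [|[|i]] // _ lt.
  by rewrite ltnn in lt.
by move: (ltn_trans lt h2); rewrite ltnn.
Qed.

(** As z winds in red, its neighbours cannot be high above it in red. So a common
neighbour of z and of a copy of x1 to the left and above is joined to z in blue, and
in red to x1: it winds in red, having come down, and in blue, having gone right twice
from the leaf B r, and then left. *)
Lemma winds_right p q z j iz jz c r : dims p.+3 q.+3 -> fits 3 p q z -> placed P p q iz jz z -> (iz < p)%N -> (jz < q)%N ->
  winds P k true p q z j -> (j < q)%N -> child z (W c r) -> joined k false p q z (W c r) ->
  (r < q)%N -> (c < iz)%N -> False.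
Proof.
move=> dm lz pz hi hj w jq cz jz' rq ci.
have dm' : dims p.+2 q.+2 by move: dm; rewrite /dims; clear; lia.
have Lz := deepL lz isT; have cp := ltn_trans ci hi.
have hl : into p.+2 p (iota 2 p).
  by rewrite /into iota_ltn_sorted size_iota eqxx andbT /=; apply/allP => i; rewrite mem_iota; clear; lia.
have hm : into q.+2 q (iota 0 q).
  by rewrite /into iota_ltn_sorted size_iota eqxx andbT /=; apply/allP => i; rewrite mem_iota; clear; lia.
have hl' : into p.+2 2 [:: 0; 1]%N by [].
have hm' : into q.+2 2 [:: q; q.+1] by rewrite /into /= !ltnS leqnn leqnSn.
have d1 : ~~ has [in iota 2 p] [:: 0; 1]%N by rewrite /= !mem_iota.
have d2 : ~~ has [in iota 0 q] [:: q; q.+1] by rewrite /= !mem_iota !add0n /=; clear; lia.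
have := request_apart E dm' hl hm hl' hm' d1 d2 (isT : 3 < 7)%N lz (fits_deep l1 (isT : 2 <= 3)%N) pz p1.
rewrite hi hj => /(_ isT) [[l2 l3 l4 p2 p3] [[j1 j2 py]|[j1 j2 py]]].
  apply: (winds_stop E dm' (into_winds hl hm Lz w) (fits_deep l4 (isT : 4 <= 7)%N) _ j1 py).
  - by rewrite /= eqxx.
  - exact: (into_lt hl).
  - exact: (into_lt hm').
  by rewrite /= nth_iota // add0n; clear -jq; lia.
have cy1 : child (Join (at_places (iota 2 p) (iota 0 q) z) (at_places [:: 0; 1]%N [:: q; q.+1] x1)) (at_places [:: 0; 1]%N [:: q; q.+1] x1).
  by rewrite /= eqxx orbT.
have cy2 : child (Join (at_places (iota 2 p) (iota 0 q) z) (at_places [:: 0; 1]%N [:: q; q.+1] x1)) (at_places (iota 2 p) (iota 0 q) z).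
  by rewrite /= eqxx.
have wr := x1_winds dm' hl' hm' cy1 j2 py isT ltac:(by rewrite nth_iota).
have LW : fits L p q (W c r) by exact: fits_child Lz cz.
have wb := blue_winds_pole E (at_child (iota 2 p) (iota 0 q) cz) cy2 (into_joined hl hm Lz LW jz') j1 p2 py.
apply: (winds_both E dm (fits_deep l4 (isT : 4 <= 6)%N) py _ _ wr _ (wb _ _)) => //.
- by rewrite nth_iota //; clear -hj; lia.
- by rewrite !nth_iota //=; clear -hi hj rq cp; lia.
- rewrite !nth_iota //=; apply/andP; split; first by clear -ci; lia.
  by apply: (out (b := true) hl hm Lz); rewrite mem_iota.
by rewrite nth_iota //; clear -hi; lia.
Qed.

Let x1' := at_places [:: 1; 2]%N [:: 1; 2]%N x1.
Let hx1 : into 3 2 [:: 1; 2]%N. Proof. by []. Qed.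
Let l1' : fits 2 3 3 x1'. Proof. exact: into_fits l1. Qed.
Let p1' : placed P 3 3 1 2 x1'. Proof. exact: (into_placed hx1 hx1 l1L _ _ p1). Qed.
Let b1' : joined k false 3 3 x1' (W 2 2).
Proof. exact: (into_joined hx1 hx1 l1L (fits_child l1L c1) b1). Qed.
Let c1' : child x1' (W 2 2). Proof. exact: (at_child [:: 1; 2]%N [:: 1; 2]%N c1). Qed.
Let labels1' b : {subset labels b x1' <= [:: 1; 2]%N}.
Proof. by move=> i /(at_labels_sub hx1 hx1 l1L); case: b. Qed.

Section SecondStep.
Variable x2 : term.
Hypotheses (l2 : fits 3 3 3 x2) (c20 : child x2 (W 0 0)) (c21 : child x2 x1').
Hypotheses (r20 : joined k true 3 3 x2 (W 0 0)) (b21 : joined k false 3 3 x2 x1').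
Hypothesis p2 : placed P 3 3 0 2 x2.

Let l2L : fits L 3 3 x2. Proof. exact: (deepL l2 isT). Qed.
Let l1L' : fits L 3 3 x1'. Proof. exact: (deepL l1' isT). Qed.

(** x3 is in the lower left corner and winds in red. A copy x4 of x1 further left and
above can only be joined in red to the common neighbour x5, which is thus further left
in the row of x3. With a copy x6 of x1 that lies between x3 and W in columns, and
again above, the common neighbour x7 returns to the right, so that its blue path W,
x3, x5, x7 winds, as well as its red one. *)
Lemma third_below x3 : fits 4 4 4 x3 -> winds P k true 4 4 x3 3 -> child x3 (W 2 0) ->
  joined k false 4 4 x3 (W 2 0) -> placed P 4 4 0 0 x3 -> False.
Proof.
move=> l3 w3 c3 b3 p3; have L3 := deepL l3 isT.
have hl : into 6 4 [:: 2; 3; 4; 5]%N by []. have hm : into 6 4 [:: 0; 1; 2; 3]%N by [].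
have hl' : into 6 2 [:: 0; 1]%N by []. have hm' : into 6 2 [:: 4; 5]%N by [].
have := request_apart E (isT : dims 6 6) hl hm hl' hm' isT isT (isT : 4 < 7)%N l3 (fits_deep l1 (isT : 2 <= 4)%N) p3 p1 isT.
set x3' := at_places _ _ x3; set x4 := at_places _ _ x1; case=> [[_ _ l5 p3' p4] [[j1 j2 p5]|[j1 j2 p5]]].
  by apply: (winds_stop E _ (into_winds hl hm L3 w3) (fits_deep l5 (isT : 5 <= 7)%N) _ j1 p5); rewrite //= eqxx.
have c5 : child (Join x3' x4) x3' by rewrite /= eqxx.
have c5' : child (Join x3' x4) x4 by rewrite /= eqxx orbT.
have w5 := x1_winds (isT : dims 6 6) hl' hm' c5' j2 p5 isT isT.
move: l5 p5 j1 w5 c5 {c5' j2}; set x5 := Join _ _ => l5 p5 b5 w5 c5; have L5 := deepL l5 isT.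
have gl : into 8 6 [:: 0; 1; 2; 5; 6; 7]%N by []. have gm : into 8 6 [:: 0; 1; 2; 3; 4; 5]%N by [].
have gl' : into 8 2 [:: 3; 4]%N by []. have gm' : into 8 2 [:: 6; 7]%N by [].
have := request_apart E (isT : dims 8 8) gl gm gl' gm' isT isT (isT : 5 < 7)%N l5 (fits_deep l1 (isT : 2 <= 5)%N) p5 p1 isT.
set x5' := at_places _ _ x5; set x6 := at_places _ _ x1; case=> [[_ _ l7 p5' p6] [[j1 j2 p7]|[j1 j2 p7]]].
  by apply: (winds_stop E _ (into_winds gl gm L5 w5) (fits_deep l7 (isT : 6 <= 7)%N) _ j1 p7); rewrite //= eqxx.
have c7 : child (Join x5' x6) x5' by rewrite /= eqxx.
have c7' : child (Join x5' x6) x6 by rewrite /= eqxx orbT.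
have w7 := x1_winds (isT : dims 8 8) gl' gm' c7' j2 p7 isT isT.
have L3' : fits L 6 6 x3' by exact: fits_child L5 c5.
have b3' := into_joined hl hm L3 (fits_child L3 c3) b3.
have wb : blue_winds P k false 8 8 (Join x5' x6) 0.
  apply: (@blue_winds_left P k 8 8 (W 6 0) 6 0 (at_places [:: 0; 1; 2; 5; 6; 7]%N [:: 0; 1; 2; 3; 4; 5]%N x3') 2 0 x5' 0 0 (Join x5' x6) 3 0) => //.
  - apply/and3P; split=> //; last exact: at_child.
    exact: (at_child _ _ (at_child [:: 2; 3; 4; 5]%N [:: 0; 1; 2; 3]%N c3)).
  - by apply: (into_joined gl gm _ _ b3') => //; exact: fits_child (at_child _ _ c3).
  - exact: (into_joined gl gm L5 L3' b5).
  - exact: pW.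
  - exact: (into_placed gl gm L3' _ _ p3').
  apply/andP; split; last exact: (out (b := true) gl gm L5).
  rewrite at_labels; apply/mapP => -[a /(at_labels_sub hl hm L3) /=]; rewrite !inE.
  by case/or4P => /eqP->.
exact: (winds_both E (isT : dims 9 9) l7 p7 isT isT w7 isT wb isT).
Qed.

(** The blue path W, x1, x2, x3 goes left twice and then right, so x3 winds in blue.
For a copy x4 of x2 to the left and below, the common neighbour of x3 and x4 cannot
move to the column of x4, and is joined to x3 in red. It winds in red, along the
path A, W, x3, and in blue, as it takes the place of x3 in the path along x4. *)
Lemma third_above x3 (x2' := at_places [:: 0; 1; 3]%N [:: 1; 2; 3]%N x2) : fits 4 4 4 x3 -> child x3 (W 2 0) -> child x3 x2' ->
  joined k true 4 4 x3 (W 2 0) -> joined k false 4 4 x3 x2' -> placed P 4 4 2 3 x3 -> False.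
Proof.
move=> l3 c3 c3' r3 b3 p3; have L3 := deepL l3 isT.
have hl : into 4 3 [:: 0; 1; 3]%N by []. have hm : into 4 3 [:: 1; 2; 3]%N by [].
have wb3 : blue_winds P k false 4 4 x3 0.
  apply: (@blue_winds_left P k 4 4 (W 3 3) 3 3 (at_places [:: 0; 1; 3]%N [:: 1; 2; 3]%N x1') 1 3 x2' 0 3 x3 2 3) => //.
  - by apply/and3P; split=> //; [exact: (at_child _ _ c1')|exact: at_child].
  - exact: (into_joined hl hm l1L' (fits_child l1L' c1') b1').
  - exact: (into_joined hl hm l2L l1L' b21).
  - exact: pW.
  - exact: (into_placed hl hm l1L' _ _ p1').
  - exact: (into_placed hl hm l2L _ _ p2).
  apply/andP; split; last exact: (out (b := true) hl hm l2L).
  by rewrite at_labels; apply/mapP => -[a /labels1']; rewrite !inE => /orP[]/eqP->.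
have gl : into 7 3 [:: 0; 2; 5]%N by []. have gm : into 7 3 [:: 0; 1; 2]%N by [].
have gl' : into 7 4 [:: 1; 3; 4; 6]%N by []. have gm' : into 7 4 [:: 3; 4; 5; 6]%N by [].
have := request_apart E (isT : dims 7 7) gl gm gl' gm' isT isT (isT : 4 < 7)%N (fits_deep l2 (isT : 3 <= 4)%N) l3 p2 p3 isT.
set x4 := at_places _ _ x2; set x3' := at_places _ _ x3; case=> [[_ _ l5 p4 p3'] [[j1 j2 p5]|[j1 j2 p5]]].
  by apply: (blue_winds_stop E _ (into_blue_winds gl' gm' L3 wb3) (fits_deep l5 (isT : 5 <= 7)%N) _ j2 p5); rewrite //= eqxx orbT.
have c5 : child (Join x4 x3') x4 by rewrite /= eqxx.
have c5' : child (Join x4 x3') x3' by rewrite /= eqxx orbT.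
have w5 : winds P k true 7 7 (Join x4 x3') 6.
  apply: (winds_pole E (at_child [:: 1; 3; 4; 6]%N [:: 3; 4; 5; 6]%N c3) c5' _ j2 p3' p5) => //.
  - exact: (into_joined gl' gm' L3 (fits_child L3 c3) r3).
  by rewrite /=; apply: (out (b := false) gl' gm' L3).
have wb5 : blue_winds P k false 7 7 (Join x4 x3') 0.
  apply: (@blue_winds_left P k 7 7 (W 5 2) 5 2 (at_places [:: 0; 2; 5]%N [:: 0; 1; 2]%N x1') 2 2 x4 0 2 (Join x4 x3') 4 2) => //.
  - by apply/and3P; split=> //; [exact: (at_child _ _ c1')|exact: at_child].
  - exact: (into_joined gl gm l1L' (fits_child l1L' c1') b1').
  - exact: (into_joined gl gm l2L l1L' b21).
  - exact: pW.
  - exact: (into_placed gl gm l1L' _ _ p1').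
  apply/andP; split; last exact: (out (b := true) gl gm l2L).
  by rewrite at_labels; apply/mapP => -[a /labels1']; rewrite !inE => /orP[]/eqP->.
exact: (winds_both E (isT : dims 8 8) (fits_deep l5 (isT : 5 <= 6)%N) p5 isT isT w5 isT wb5 isT).
Qed.

(** Ask for a common neighbour of x2 and of a W below it, whose column is between
those of the other vertices in the blue path of x2. *)
Lemma no_second_step : False.
Proof.
have hl : into 4 3 [:: 0; 1; 3]%N by []. have hm : into 4 3 [:: 1; 2; 3]%N by [].
have hl' : into 4 1 [:: 2]%N by []. have hm' : into 4 1 [:: 0]%N by [].
have := request_apart E (isT : dims 4 4) hl hm hl' hm' isT isT (isT : 3 < 7)%N l2 (isT : fits 3 1 1 (W 0 0)) p2
  (pW (isT : 0 < 1)%N (isT : 0 < 1)%N) isT.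
set x2' := at_places _ _ x2; rewrite -[at_places [:: 2]%N [:: 0]%N (W 0 0)]/(W 2 0).
have c3 : child (Join x2' (W 2 0)) x2' by rewrite /= eqxx.
have c3' : child (Join x2' (W 2 0)) (W 2 0) by rewrite /= eqxx orbT.
case=> [[_ _ l3 p2' _] [[j1 j2 p3]|[j1 j2 p3]]]; last exact: (third_above l3 c3' c3 j2 j1 p3).
apply: (third_below l3 _ c3' j2 p3).
apply: (winds_pole E (at_child [:: 0; 1; 3]%N [:: 1; 2; 3]%N c20) c3 _ j1 p2' p3) => //.
  exact: (into_joined hl hm l2L (fits_child l2L c20) r20).
by rewrite /=; apply: (out (b := false) hl hm l2L).
Qed.
End SecondStep.

(** Ask for a common neighbour x2 of W 0 0 and of a copy of x1 to the right and above.
Either it is above W 0 0 and its blue path has gone left twice, or it winds in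
red. *)
Lemma no_first_step : False.
Proof.
have hl : into 3 1 [:: 0]%N by [].
have := request_apart E (isT : dims 3 3) hl hl hx1 hx1 isT isT (isT : 2 < 7)%N (isT : fits 2 1 1 (W 0 0)) l1
  (pW (isT : 0 < 1)%N (isT : 0 < 1)%N) p1 isT.
rewrite -[at_places [:: 0]%N [:: 0]%N (W 0 0)]/(W 0 0) -/x1'.
have c2 : child (Join (W 0 0) x1') (W 0 0) by [].
have c2' : child (Join (W 0 0) x1') x1' by rewrite /= eqxx orbT.
case=> [[_ _ l2 _ _] [[j1 j2 p2]|[j1 j2 p2]]]; first exact: (no_second_step l2 c2 c2' j1 j2 p2).
have w := x1_winds (isT : dims 3 3) hx1 hx1 c2' j2 p2 isT isT.
exact: (winds_right (isT : dims 6 6) l2 p2 isT isT w isT c2 j1 isT isT).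
Qed.

End Chase.

(** By symmetry, the common neighbour of W 0 0 and W 1 1 is joined in red to the
first. *)
Theorem no_env P k : env P k -> False.
Proof.
move=> E; have hl : into 2 1 [:: 0]%N by []. have hl' : into 2 1 [:: 1]%N by [].
have pW := @placed_W _ _ E 1 1 0 0 isT isT.
have := request_apart E (isT : dims 2 2) hl hl hl' hl' isT isT (isT : 1 < 7)%N (isT : fits 1 1 1 (W 0 0)) (isT : fits 1 1 1 (W 0 0)) pW pW isT.
rewrite -[at_places [:: 0]%N [:: 0]%N (W 0 0)]/(W 0 0) -[at_places [:: 1]%N [:: 1]%N (W 0 0)]/(W 1 1).
case=> [[_ _ l2 _ _] [[j1 j2 p2]|[j1 j2 p2]]].
  by apply: (no_first_step E l2 _ _ j1 j2 p2); rewrite /= ?eqxx ?orbT.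
apply: (@no_first_step _ _ (env_transpose L1 E) (transpose (Join (W 0 0) (W 1 1)))) => //.
- by apply/(joined_transpose k true 2 2 _ (W 0 0)).
- by apply/(joined_transpose k false 2 2 _ (W 1 1)).
exact: (placed_transpose p2).
Qed.

End Zigzag.

(** * The grid in a uniform drawing *)

Section Flip.
Variable R : realFieldType.
Notation pt := (R * R)%type.
Variables (L K M : nat).
Implicit Types (P : term -> pt) (k : term -> term -> bool).

Let rv (b : bool) m c := if b then (m - c)%N else c.

(** Reverses the order of the labels of either kind. *)
Definition flip a b x := relabel (rv a M) (rv b M) x.

Let rv_lt b m c : (c < m.+1)%N -> (rv b m c < m.+1)%N.
Proof. by rewrite /rv; case: b; clear; lia. Qed.

Let rvK b m c : (c < m.+1)%N -> rv b m (rv b m c) = c.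
Proof. by rewrite /rv; case: b; clear; lia. Qed.

Let rv_inj b m c d : (c < m.+1)%N -> (d < m.+1)%N -> rv b m c = rv b m d -> c = d.
Proof. by move=> h h' e; rewrite -(rvK b h) e rvK. Qed.

Let fits_flip a b x : fits L M.+1 M.+1 x -> fits L M.+1 M.+1 (flip a b x).
Proof. by move=> h; apply: fits_relabel h _ _ => i; exact: rv_lt. Qed.

Let flip_neq a b x y : fits L M.+1 M.+1 x -> fits L M.+1 M.+1 y -> x != y -> flip a b x != flip a b y.
Proof.
move=> hx hy; apply: contraNneq => /(relabel_inj hx hy) -> //; exact: rv_inj.
Qed.

Lemma drawing_flip a b P k : drawing L M.+1 P k ->
  drawing L M.+1 (P \o flip a b) (fun x y => k (flip a b x) (flip a b y)).
Proof.
move=> [gp nc]; split=> [x y z hx hy hz xy yz xz|x y x' y' hx hx' c c' ne e].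
  by apply: gp; rewrite ?fits_flip ?flip_neq.
apply: nc => //; rewrite ?fits_flip //; [exact: child_relabel|exact: child_relabel|].
move: ne; rewrite !xpair_eqE; apply: contraNN => /andP[/eqP e1 /eqP e2]; apply/andP; split; apply/eqP.
  by apply: relabel_inj hx hx' _ _ e1; exact: rv_inj.
by apply: relabel_inj (fits_child hx c) (fits_child hx' c') _ _ e2; exact: rv_inj.
Qed.

Lemma uniform_flip a b P k : uniform L K M.+1 P k ->
  uniform L K M.+1 (P \o flip a b) (fun x y => k (flip a b x) (flip a b y)).
Proof.
move=> U p q s t s' t' x1 x2 x3 x4 x5 x6 hp hq ms ms' mt mt' hl.
pose hat c m (s : nat -> nat) i := rv c M (s (rv c m.-1 i)).
have hat_mono c m r : mono m M.+1 r -> mono m M.+1 (hat c m r).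
  move=> [h1 h2]; rewrite /hat /rv; case: c; last by split.
  split=> [i j lt jm|i im].
    have : (r (m.-1 - j) < r (m.-1 - i))%N by apply: h1; move: lt jm; clear; lia.
    have : (r (m.-1 - i) < M.+1)%N by apply: h2; move: lt jm; clear; lia.
    by clear; lia.
  by clear; lia.
have flat x u v : fits L p q x -> flip a b (relabel u v x) = relabel (hat a p u) (hat b q v) (relabel (rv a p.-1) (rv b q.-1) x).
  have e c m i r : (i < m)%N -> hat c m r (rv c m.-1 i) = rv c M (r i).
    by case: m => // m; rewrite /hat /= => /(rvK c) ->.
  move=> /and3P[_ /allP h1 /allP h2]; rewrite /flip !relabel_comp; apply: relabel_ext => i hi /=.
    by rewrite e ?h1.
  by rewrite e ?h2.
have lr x : fits L p q x -> fits L p q (relabel (rv a p.-1) (rv b q.-1) x).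
  by move=> lx; apply: fits_relabel lx _ _ => i; [case: (p)|case: (q)] => // m; exact: rv_lt.
move: hl; rewrite /= !andbT => /and5P[l1 l2 l3 l4 /andP[l5 l6]].
rewrite /obs /= !(flat _ s t) // !(flat _ s' t') //.
by apply: (U p q) => //; [exact: hat_mono..|rewrite /= !lr].
Qed.

End Flip.

Section Grid.
Variable R : realFieldType.
Notation pt := (R * R)%type.
Variables (L K n : nat).
Notation M := n.+4.
Hypothesis L1 : (0 < L)%N.
Hypothesis K8 : (8 <= K)%N.
Hypothesis n4 : (4 <= n)%N.

Section Uniform.
Variables (P : term -> pt) (k : term -> term -> bool).
Hypothesis D : drawing L M.+1 P k.
Hypothesis U : uniform L K M.+1 P k.

(* Of the labels 0 and 1, the smaller one if [b] holds. *)
Definition lo_hi (b : bool) : nat := if b then 0%N else 1%N.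

Let pair_mono x y : (x < y)%N -> (y <= M)%N -> mono 2 M.+1 (nth 0%N [:: x; y]).
Proof. by move=> xy yM; apply: (@mono_nth M.+1 [:: x; y]); rewrite /= ?xy // !ltnS yM (leq_trans (ltnW xy)). Qed.

Let one_mono x : (x <= M)%N -> mono 1 M.+1 (nth 0%N [:: x]).
Proof. by move=> xM; apply: (@mono_nth M.+1 [:: x]); rewrite /= ?ltnS ?xM. Qed.

Let lW p q c d : (c < p)%N -> (d < q)%N -> fits L p q (W c d). Proof. exact: fits_W. Qed.

Let K1 : (1 <= K)%N. Proof. exact: leq_trans K8. Qed.
Let K2 : (2 <= K)%N. Proof. exact: leq_trans K8. Qed.

Lemma colour_A s t : (s <= M)%N -> (t <= M)%N -> k (W s t) (A s) = k (W 0 0) (A 0).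
Proof.
move=> sM tM; have := @U 1 1 _ _ _ _ (W 0 0) (A 0) (W 0 0) (W 0 0) (W 0 0) (W 0 0) K1 K1 (one_mono sM) (one_mono (leq0n _)) (one_mono tM) (one_mono (leq0n _)).
by rewrite /= ?lW //= ?fits_A // => /(_ isT) [].
Qed.

Lemma colour_B s t : (s <= M)%N -> (t <= M)%N -> k (W s t) (B t) = k (W 0 0) (B 0).
Proof.
move=> sM tM; have := @U 1 1 _ _ _ _ (W 0 0) (B 0) (W 0 0) (W 0 0) (W 0 0) (W 0 0) K1 K1 (one_mono sM) (one_mono (leq0n _)) (one_mono tM) (one_mono (leq0n _)).
by rewrite /= ?lW //= ?fits_B // => /(_ isT) [].
Qed.

(* Whether the red edge of W s t crosses the blue edge of W i l, when [e] and [d]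
   tell whether s < i and t < l. *)
Definition order_crossing (e d : bool) := crossing (P (A (lo_hi e))) (P (W (lo_hi e) (lo_hi d))) (P (B (lo_hi (~~ d)))) (P (W (lo_hi (~~ e)) (lo_hi (~~ d)))).

Lemma crossing_order s i t l : s != i -> t != l -> (s <= M)%N -> (i <= M)%N -> (t <= M)%N -> (l <= M)%N ->
  crossing (P (A s)) (P (W s t)) (P (B l)) (P (W i l)) = order_crossing (s < i)%N (t < l)%N.
Proof.
move=> si tl sM iM tM lM.
have [u [mu us ui]] : exists u, [/\ mono 2 M.+1 u, u (lo_hi (s < i)%N) = s & u (lo_hi (~~ (s < i)%N)) = i].
  case: (ltngtP s i) si => // lt _; [exists (nth 0%N [:: s; i])|exists (nth 0%N [:: i; s])]; split=> //; exact: pair_mono.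
have [v [mv vt vl]] : exists v, [/\ mono 2 M.+1 v, v (lo_hi (t < l)%N) = t & v (lo_hi (~~ (t < l)%N)) = l].
  case: (ltngtP t l) tl => // lt _; [exists (nth 0%N [:: t; l])|exists (nth 0%N [:: l; t])]; split=> //; exact: pair_mono.
have m01 : mono 2 M.+1 id by split=> // a a2; apply: leq_trans a2 _.
have same x y z : fits L 2 2 x -> fits L 2 2 y -> fits L 2 2 z ->
    ccw (P (relabel u v x)) (P (relabel u v y)) (P (relabel u v z)) = ccw (P x) (P y) (P z).
  move=> lx ly lz; have := @U 2 2 _ _ _ _ x y z z z z K2 K2 mu m01 mv m01.
  rewrite /= lx ly lz !relabel_id => /(_ isT) [e _ _ _ _].
  by rewrite /ccw.
have f2 b : (lo_hi b < 2)%N by case: b.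
rewrite /order_crossing; set e := (s < i)%N in us ui *; set d := (t < l)%N in vt vl *.
have -> : W s t = relabel u v (W (lo_hi e) (lo_hi d)) by rewrite /= us vt.
have -> : W i l = relabel u v (W (lo_hi (~~ e)) (lo_hi (~~ d))) by rewrite /= ui vl.
have -> : A s = relabel u v (A (lo_hi e)) by rewrite /= us.
have -> : B l = relabel u v (B (lo_hi (~~ d))) by rewrite /= vl.
by rewrite /crossing !same ?lW ?fits_A ?fits_B.
Qed.

Let gp x y z : fits L M.+1 M.+1 x -> fits L M.+1 M.+1 y -> fits L M.+1 M.+1 z ->
  x != y -> y != z -> x != z -> orient (P x) (P y) (P z) != 0.
Proof. exact: D.1. Qed.

Let three i : (i < 3)%N -> (i < M.+1)%N. Proof. by move=> h; apply: leq_trans h _. Qed.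

Lemma colours_differ : k (W 0 0) (A 0) != k (W 0 0) (B 0).
Proof.
apply/eqP => e; apply: (@K33_one_colour R L M.+1 P k D (fun i => A i) (fun j => B j) (fun i j => W i j) _ _ _ _ _ _ _ _ _ (k (W 0 0) (A 0))) => //.
- by move=> i j hi hj; apply: lW; exact: three.
- by move=> i j _ _; rewrite /= eqxx.
- by move=> i j _ _; rewrite /= ?eqxx ?orbT.
- by move=> i j _ _ [].
- by move=> i j _ _ [].
- by move=> i j i' j' _ _ _ _ [-> ->].
- by move=> i j hi hj; apply: colour_A; apply: three.
by move=> i j hi hj; rewrite e; apply: colour_B; apply: three.
Qed.

(** In the K33 formed by the A, the B and the W, each of the four cases occurs nine
times. *)
Lemma order_crossing_odd : xorb (xorb (order_crossing true true) (order_crossing false false)) (xorb (order_crossing true false) (order_crossing false true)) = true.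
Proof.
have e1 : forall i j, (i < 3)%N -> (j < 3)%N -> child (W i j) (A i) by move=> i j _ _; rewrite /= eqxx.
have e2 : forall i j, (i < 3)%N -> (j < 3)%N -> child (W i j) (B j) by move=> i j _ _; rewrite /= ?eqxx ?orbT.
have e3 : forall i j, (i < 3)%N -> (j < 3)%N -> fits L M.+1 M.+1 (W i j) by move=> i j hi hj; apply: lW; exact: three.
have g : generic 15 (P \o K33term (fun i => A i) (fun j => B j) (fun i j => W i j)).
  apply: (@K33_generic R L M.+1 P k D _ _ _ e3 e1 e2) => //.
  - by move=> i j _ _ [].
  - by move=> i j _ _ [].
  by move=> i j i' j' _ _ _ _ [-> ->].
have pc i j i' j' : (i < 3)%N -> (j < 3)%N -> (i' < 3)%N -> (j' < 3)%N -> (i < i')%N -> j != j' ->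
    path_crossings (P (A i)) (P (B j)) (P (W i j)) (P (A i')) (P (B j')) (P (W i' j')) =
    xorb (order_crossing true (j < j')%N) (order_crossing false (~~ (j < j')%N)).
  move=> hi hj hi' hj' ii jj.
  have [iM iM' jM jM'] : [/\ i <= M, i' <= M, j <= M & j' <= M]%N by split; rewrite -ltnS; exact: three.
  have ni : i != i' by rewrite neq_ltn ii.
  have same x y x' y' : child x y -> child x' y' -> fits L M.+1 M.+1 x -> fits L M.+1 M.+1 x' -> k x y = k x' y' ->
      uniq [:: x; y; x'; y'] -> crossing (P y) (P x) (P y') (P x') = false.
    move=> cx cx' lx lx' kx; rewrite /= !inE !negb_or => /and4P[/and3P[h1 h2 h3] /andP[h4 h5] h6 _].
    apply/negP => /crossing_inseg; have ly := fits_child lx cx; have ly' := fits_child lx' cx'.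
    case; try by apply: gp; rewrite // eq_sym.
    move=> p [/insegC i1 /insegC i2]; apply: (D.2 x y x' y') i1 i2 => //.
    by rewrite xpair_eqE (negbTE h2).
  rewrite /path_crossings (same (W i j) (A i) (W i' j') (A i')) ?e1 ?e3 ?colour_A //=; last first.
    by rewrite !inE !termE /= ?(negbTE ni) ?(negbTE jj).
  rewrite (same (W i j) (B j) (W i' j') (B j')) ?e2 ?e3 ?colour_B //=; last first.
    by rewrite !inE !termE /= ?(negbTE ni) ?(negbTE jj).
  rewrite crossing_order // crossingC crossing_order // 1?eq_sym // ii.
  have -> : (i' < i)%N = false by rewrite ltnNge ltnW.
  have -> : (j' < j)%N = ~~ (j < j')%N by rewrite -leqNgt [RHS]leq_eqVlt (eq_sym j') (negbTE jj).
  by rewrite !Bool.xorb_false_r ?Bool.xorb_false_l.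
have := K33_odd g; rewrite /= /K33term /= !pc //=.
by case: (order_crossing true true); case: (order_crossing false false); case: (order_crossing true false); case: (order_crossing false true).
Qed.

End Uniform.

Lemma drawing_colours (P : term -> pt) k c : drawing L M.+1 P k -> drawing L M.+1 P (fun x y => k x y == c).
Proof.
move=> [gp nc]; split=> // x y x' y' hx hx' h h' ne /eqP e; apply: nc => //.
by move: e; case: (k x y); case: (k x' y'); case: c.
Qed.

Lemma uniform_colours (P : term -> pt) k c : uniform L K M.+1 P k -> uniform L K M.+1 P (fun x y => k x y == c).
Proof.
move=> U p q s t s' t' x1 x2 x3 x4 x5 x6 hp hq ms ms' mt mt' hl.
by have := U p q s t s' t' x1 x2 x3 x4 x5 x6 hp hq ms ms' mt mt' hl; rewrite /obs => -[-> -> -> -> ->].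
Qed.

Hypotheses (L7 : (7 <= L)%N) (K15 : (15 <= K)%N) (n60 : (60 <= n)%N).

(** By [order_crossing_odd], for some order of s and i exactly one order of t and l
makes the edges cross. Reversing the orders of the labels suitably gives the pattern
of [fans]. *)
Theorem no_uniform_drawing (P : term -> pt) k : drawing L M.+1 P k -> uniform L K M.+1 P k -> False.
Proof.
move=> D0 U0; have dk := colours_differ D0 U0.
have odd := order_crossing_odd D0 U0; have cb := crossing_order U0.
have ca := colour_A U0; have cb' := colour_B U0.
have [a [b [h1 h2]]] : exists a b, order_crossing P (~~ a) b = true /\ order_crossing P (~~ a) (~~ b) = false.
  move: odd; case e1 : (order_crossing P true true); case e2 : (order_crossing P true false); case e3 : (order_crossing P false true); case e4 : (order_crossing P false false) => // _;
  by [exists true, true|exists true, false|exists false, true|exists false, false].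
have D := drawing_flip a b (drawing_colours (k (W 0 0) (A 0)) D0).
have U := uniform_flip a b (uniform_colours (k (W 0 0) (A 0)) U0).
pose rv (b : bool) c := if b then (M - c)%N else c.
have rM c i : (i <= M)%N -> (rv c i <= M)%N by rewrite /rv; case: c; clear; lia.
have rlt c i j : (i < j)%N -> (j <= M)%N -> (rv c i < rv c j)%N = ~~ c /\ rv c i != rv c j.
  by rewrite /rv; case: c => /= ij jM; split; move: ij jM; clear; lia.
have cross s i t l : (s < i)%N -> (i <= M)%N -> rv b t != rv b l -> (t <= M)%N -> (l <= M)%N ->
    crossing (P (flip M a b (A s))) (P (flip M a b (W s t))) (P (flip M a b (B l))) (P (flip M a b (W i l))) =
    order_crossing P (~~ a) (rv b t < rv b l)%N.
  move=> si iM tl tM lM; have [e1 e2] := rlt a s i si iM; rewrite -e1.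
  by rewrite -[LHS]/(crossing (P (A (rv a s))) (P (W (rv a s) (rv b t))) (P (B (rv b l))) (P (W (rv a i) (rv b l)))) cb // rM // ltnW // (leq_trans si).
have F : fans L K M (P \o flip M a b) (fun x y => k (flip M a b x) (flip M a b y) == k (W 0 0) (A 0)).
  split=> // [s t sM tM|s t sM tM|s i l t si iM lt tM].
  - by rewrite -[flip M a b (W s t)]/(W (rv a s) (rv b t)) -[flip M a b (A s)]/(A (rv a s)) ca ?rM // eqxx.
  - rewrite -[flip M a b (W s t)]/(W (rv a s) (rv b t)) -[flip M a b (B t)]/(B (rv b t)) cb' ?rM //.
    by rewrite eq_sym (negbTE dk).
  have [e1 e2] := rlt b l t lt tM; rewrite cross // 1?eq_sym // ?(ltnW (leq_trans lt tM)) //.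
  have -> : (rv b t < rv b l)%N = b by move: e1; rewrite ltn_neqAle e2 leqNgt /= => /negb_inj.
  by rewrite h1.
apply: (@no_env R L K n L1 K8 n4 L7 K15 n60 (P \o flip M a b) _); split; first exact: F.
move=> s t /andP[s1 s2] /andP[t1 t2]; apply: (W_in_cell L1 K8 _ F) => //; try by rewrite addn2 !ltnS.
move=> s' i t' l si iM tl lM; have [e1 e2] := rlt b t' l tl lM.
by rewrite cross ?e1 ?h2 // (leq_trans (ltnW tl)).
Qed.
End Grid.

Local Open Scope nat_scope.

(** * Uniform drawings by Ramsey's theorem *)

Section Ramsey.
Implicit Types (f : seq nat -> bool) (X Y Z z : seq nat).

Definition mono_set f k c Y := forall z, subseq z Y -> size z = k -> f z = c.

(** The intermediate stage in the proof of Ramsey's theorem: the colour of k + 1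
elements of Y depends on the first of them only. *)
Fixpoint first_decides f k Y := if Y is y :: Y' then
  (exists c, mono_set (fun z => f (y :: z)) k c Y') /\ first_decides f k Y' else True.

Lemma mono_set_sub f k c Y Z : subseq Z Y -> mono_set f k c Y -> mono_set f k c Z.
Proof. by move=> s h z zs; apply: h; exact: subseq_trans zs s. Qed.

Lemma mono_set_cons f k c y Y : mono_set (fun z => f (y :: z)) k c Y -> mono_set f k.+1 c Y ->
  mono_set f k.+1 c (y :: Y).
Proof.
move=> h1 h2 [|x z] //=; case: eqP => [->|_] s [e]; first exact: h1.
by apply: h2 => //=; rewrite e.
Qed.

(* The elements of Y are themselves coloured, by the value that they decide. *)
Lemma pigeonhole f k Y a b : first_decides f k Y -> a + b <= size Y ->
  (exists2 Z, subseq Z Y /\ size Z = a & mono_set f k.+1 true Z) \/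
  (exists2 Z, subseq Z Y /\ size Z = b & mono_set f k.+1 false Z).
Proof.
have nil c : mono_set f k.+1 c [::] by move=> [|x z].
elim: Y a b => [|y Y IH] [|a] b //=; try by move=> _ _; left; exists [::].
move=> [[c hc] fY] ab; case: c hc => hc.
  case: (IH a b fY) => [|[Z [s e] hZ]|[Z [s e] hZ]]; first by rewrite addSn ltnS in ab.
    by left; exists (y :: Z); rewrite /= ?eqxx ?e //; apply: mono_set_cons => //; exact: mono_set_sub hc.
  by right; exists Z => //; split=> //; apply: subseq_trans s (subseq_cons _ _).
case: b ab => [|b] ab; first by right; exists [::].
case: (IH a.+1 b fY) => [|[Z [s e] hZ]|[Z [s e] hZ]]; first by rewrite addnS ltnS in ab.
  by left; exists Z => //; split=> //; apply: subseq_trans s (subseq_cons _ _).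
by right; exists (y :: Z); rewrite /= ?eqxx ?e //; apply: mono_set_cons => //; exact: mono_set_sub hc.
Qed.

(** By induction on k: elements are chosen one by one, each time passing to a
subsequence on which the colour of the sets that start with the chosen element is
constant; then [pigeonhole] selects among the chosen elements. *)
Lemma ramsey k m : exists N, forall f X, N <= size X ->
  exists Y c, [/\ subseq Y X, size Y = m & mono_set f k c Y].
Proof.
elim: k m => [|k IH] m.
  exists m => f X h; exists (take m X), (f [::]); rewrite take_subseq size_takel //.
  by split=> // z _ /size0nil->.
have [N hN] : exists N, forall f X, N <= size X ->
    exists Y, [/\ subseq Y X, size Y = m + m & first_decides f k Y].
  elim: (m + m) => [|t [N hN]]; first by exists 0 => f X _; exists [::]; rewrite sub0seq.
  have [N' hN'] := IH N; exists N'.+1 => f [|x X] //=; rewrite ltnS => hX.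
  have [Y [c [s e hY]]] := hN' (fun z => f (x :: z)) X hX.
  have [Z [s' e' hZ]] := hN f Y ltac:(by rewrite e).
  exists (x :: Z); split=> /=; rewrite ?eqxx ?e' //; first exact: subseq_trans s' s.
  by split=> //; exists c; exact: mono_set_sub s' hY.
exists N => f X /(hN f)[Y [s e hY]]; case: (pigeonhole hY (eq_leq (esym e))) => -[Z [s' e'] hZ].
  by exists Z, true; split=> //; exact: subseq_trans s' s.
by exists Z, false; split=> //; exact: subseq_trans s' s.
Qed.

(* Finitely many colourings are treated one after the other. *)
Lemma ramsey_all (I : eqType) (a : I -> nat) (l : seq I) m : exists N, forall (f : I -> seq nat -> bool) X,
  N <= size X -> exists Y, [/\ subseq Y X, size Y = m &
    forall i, i \in l -> exists c, mono_set (f i) (a i) c Y].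
Proof.
elim: l => [|i l [N hN]].
  by exists m => f X h; exists (take m X); rewrite take_subseq size_takel.
have [N' hN'] := ramsey (a i) N; exists N' => f X /(hN' (f i))[Y [c [s e hY]]].
have [Z [s' e' hZ]] := hN f Y ltac:(by rewrite e).
exists Z; split=> // [|j]; first exact: subseq_trans s' s.
by rewrite inE => /orP[/eqP->|/hZ //]; exists c; exact: mono_set_sub s' hY.
Qed.
End Ramsey.

Fixpoint terms L p : seq term :=
  if L is L'.+1 then [seq Leaf true i | i <- iota 0 p] ++ [seq Join x y | x <- terms L' p, y <- terms L' p]
  else [seq Leaf true i | i <- iota 0 p].

Lemma terms_fits L p x : (x \in terms L p) = fits L p 0 x.
Proof.
have leaf i : (i < p) -> Leaf true i \in [seq Leaf true i | i <- iota 0 p].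
  by move=> ip; apply: map_f; rewrite mem_iota.
have leaf' y : y \in [seq Leaf true i | i <- iota 0 p] -> fits 0 p 0 y.
  by move=> /mapP[i]; rewrite mem_iota => /= ip ->; rewrite /fits /= ip.
have deep M y : fits 0 p 0 y -> fits M p 0 y by case/and3P=> d h1 h2; rewrite /fits h1 h2 (leq_trans d).
elim: L x => [|L IH] x /=.
  apply/idP/idP => [/leaf'//|]; case: x => [[] i|x y]; rewrite /fits //= !andbT; exact: leaf.
rewrite mem_cat; apply/orP/idP => [[/leaf'/deep//|/allpairsP[[y z] [/= hy hz ->]]]|].
  move: hy hz; rewrite !IH /fits /= !all_cat ltnS geq_max => /and3P[-> -> ->] /and3P[-> -> ->] //.
case: x => [[] i|y z]; rewrite /fits //= ?andbT ?orbF; first by left; exact: leaf.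
rewrite !all_cat ltnS geq_max => /and3P[/andP[d1 d2] /andP[a1 a2] /andP[b1 b2]].
by right; apply/allpairsP; exists (y, z); rewrite /= !IH /fits d1 d2 a1 a2 b1 b2.
Qed.

Section Index.
Local Open Scope ring_scope.
Variables (R : realFieldType) (L K M : nat).
Notation pt := (R * R)%type.

(** Ramsey's theorem needs a single linear order of labels, and so the graph is made
from terms with one kind of leaves. *)
Definition drawing1 N (P : term -> pt) (k : term -> term -> bool) :=
  (forall x y z, fits L N 0 x -> fits L N 0 y -> fits L N 0 z ->
     x != y -> y != z -> x != z -> orient (P x) (P y) (P z) != 0) /\
  (forall x y x' y', fits L N 0 x -> fits L N 0 x' -> child x y -> child x' y' ->
     (x, y) != (x', y') -> k x y = k x' y' -> noncross (P x) (P y) (P x') (P y')).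

(* The two kinds of leaves come from one: the B-labels are those from [m] on. *)
Fixpoint tail m x := match x with
  | Leaf b i => Leaf true (if b then i else m + i)%N
  | Join x y => Join (tail m x) (tail m y)
  end.

Lemma depth_tail m x : depth (tail m x) = depth x.
Proof. by elim: x => //= x -> y ->. Qed.

Lemma fits_tail d p q x : fits d p q x -> fits d (p + q) 0 (tail p x).
Proof.
rewrite /fits depth_tail => /and3P[-> h1 h2] /=.
elim: x h1 h2 => [[] i|x IHx y IHy] /=; rewrite ?andbT.
- by move=> ip _; exact: ltn_addr.
- by move=> _ iq; rewrite ltn_add2l.
rewrite !all_cat => /andP[a1 a2] /andP[b1 b2].
by have /andP[-> ->] := IHx a1 b1; have /andP[-> ->] := IHy a2 b2.
Qed.

Lemma tail_relabel p s t m d q x : fits d p q x ->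
  tail m (relabel s t x) = relabel (fun i => if (i < p)%N then s i else (m + t (i - p))%N) id (tail p x).
Proof.
elim: x => [[] i|x IHx y IHy] //=; first by rewrite /fits /= ?andbT => ->.
  by rewrite addKn ltnNge leq_addr.
by move=> /fits_Join[h1 h2]; rewrite IHx ?IHy.
Qed.

Lemma tail_inj d p q x y : fits d p q x -> fits d p q y -> tail p x = tail p y -> x = y.
Proof.
elim: x y => [b i|x IHx y IHy] [b' i'|z w] //=; last first.
  by move=> /fits_Join[h1 h2] /fits_Join[h3 h4] [e1 e2]; rewrite (IHx z) // (IHy w).
case: b; case: b'; rewrite /fits /= ?andbT => h h' [e]; try by rewrite e.
- by move: h; rewrite e ltnNge leq_addr.
- by move: h'; rewrite -e ltnNge leq_addr.
by rewrite (addnI e).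
Qed.

Lemma child_tail m x y : child x y -> child (tail m x) (tail m y).
Proof. by case: x => //= a b /orP[]/eqP->; rewrite eqxx ?orbT. Qed.

Fixpoint lists (T : Type) m (s : seq T) :=
  if m is m'.+1 then [seq x :: y | x <- s, y <- lists m' s] else [:: [::]].

Lemma lists_mem (T : eqType) (s xs : seq T) : all [in s] xs -> xs \in lists (size xs) s.
Proof. by elim: xs => //= x xs IH /andP[h1 h2]; apply: allpairs_f => //; exact: IH. Qed.

(* The term with labels in the homogeneous set [Y] that a term with two kinds of
   leaves stands for. *)
Let place (Y : seq nat) x := relabel (nth 0%N Y) id (tail M.+1 x).

Lemma sorted_subseq (Y z : seq nat) : sorted ltn Y -> sorted ltn z -> {subset z <= Y} -> subseq z Y.
Proof.
move=> sY sz zY; suff -> : z = [seq i <- Y | i \in z] by exact: filter_subseq.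
apply: (irr_sorted_eq ltn_trans ltnn) => //; first exact: sorted_filter ltn_trans _ _ sY.
by move=> i; rewrite mem_filter; case: (boolP (i \in z)) => // /zY ->.
Qed.

(** Every observation is a colouring of sets of labels: a term with [p] labels becomes
a term with labels in a set [z], by rank. On a set that is homogeneous for all of
these colourings, the first labels serve as A-labels and the remaining ones as
B-labels. *)
Lemma homogeneous_drawing : exists N, forall (P : term -> pt) k, drawing1 N P k ->
  exists (P' : term -> pt) k', drawing L M.+1 P' k' /\ uniform L K M.+1 P' k'.
Proof.
pose two := (M.+1 + M.+1)%N.
pose l : seq (nat * seq term * nat) :=
  flatten [seq [seq (p, xs, j) | xs <- lists 6 (terms L p), j <- iota 0 5] | p <- iota 0 (K + K).+1].
have [N hN] := ramsey_all (fun i => i.1.1) l two; exists N => P k [gp nc].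
pose g (xs : seq term) z i := relabel (nth 0%N z) id (nth (Leaf true 0) xs i).
pose f (i : nat * seq term * nat) (z : seq nat) :=
  let x := g i.1.2 z in nth true (obs P k (x 0%N) (x 1%N) (x 2%N) (x 3%N) (x 4%N) (x 5%N)) i.2.
have [Y [sY eY hY]] := hN f (iota 0 N) ltac:(by rewrite size_iota).
have ltY : sorted ltn Y by apply: subseq_sorted ltn_trans _ _ sY (iota_ltn_sorted _ _).
have YN i : (i < two)%N -> (nth 0%N Y i < N)%N.
  by move=> h; have := mem_subseq sY (mem_nth 0%N (_ : i < size Y)%N); rewrite mem_iota eY => /(_ h) /andP[].
have YI i j : (i < two)%N -> (j < two)%N -> nth 0%N Y i = nth 0%N Y j -> i = j.
  move=> hi hj /eqP; rewrite nth_uniq ?eY // => [/eqP//|]; exact: sorted_uniq ltn_trans ltnn _ ltY.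
have lt x : fits L M.+1 M.+1 x -> fits L two 0 (tail M.+1 x) by exact: fits_tail.
have lp x : fits L M.+1 M.+1 x -> fits L N 0 (place Y x) by move=> /lt h; apply: fits_relabel h _ _.
have pI x y : fits L M.+1 M.+1 x -> fits L M.+1 M.+1 y -> place Y x = place Y y -> x = y.
  by move=> hx hy /(relabel_inj (lt _ hx) (lt _ hy) YI) e; apply: tail_inj hx hy _; exact: e.
have pn x y : fits L M.+1 M.+1 x -> fits L M.+1 M.+1 y -> x != y -> place Y x != place Y y.
  by move=> hx hy; apply: contraNneq => /(pI _ _ hx hy) ->.
exists (P \o place Y), (fun x y => k (place Y x) (place Y y)); split.
  split=> [x y z hx hy hz xy yz xz|x y x' y' hx hx' c c' ne e]; first by apply: gp; rewrite ?lp ?pn.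
  apply: nc => //; rewrite ?lp //; [exact/child_relabel/child_tail|exact/child_relabel/child_tail|].
  move: ne; rewrite !xpair_eqE; apply: contraNN => /andP[/eqP e1 /eqP e2]; apply/andP; split; apply/eqP.
    exact: pI e1.
  exact: pI (fits_child hx c) (fits_child hx' c') e2.
move=> p q s t s' t' x1 x2 x3 x4 x5 x6 hp hq ms ms' mt mt' hl.
pose sg (s t : nat -> nat) i := if (i < p)%N then s i else (M.+1 + t (i - p))%N.
pose z s t := [seq nth 0%N Y (sg s t i) | i <- iota 0 (p + q)].
have sg_mono u v : mono p M.+1 u -> mono q M.+1 v -> mono (p + q) two (sg u v).
  move=> [u1 u2] [v1 v2]; split=> [i j ij jpq|i ipq]; rewrite /sg.
    case: (ltnP j p) => jp; first by rewrite (ltn_trans ij jp); exact: u1.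
    case: (ltnP i p) => ip; first by apply: leq_trans (u2 _ ip) _; exact: leq_addr.
    by rewrite ltn_add2l; apply: v1; move: ij jpq ip jp; clear; lia.
  case: (ltnP i p) => ip; first by apply: leq_trans (u2 _ ip) _; exact: leq_addr.
  by rewrite ltn_add2l; apply: v2; move: ipq ip; clear; lia.
have zP u v : mono p M.+1 u -> mono q M.+1 v -> subseq (z u v) Y /\ size (z u v) = (p + q)%N.
  move=> mu mv; have [m1 m2] := sg_mono u v mu mv; split; last by rewrite size_map size_iota.
  apply: sorted_subseq => //; last first.
    by move=> i /mapP[j]; rewrite mem_iota => /= jpq ->; apply: mem_nth; rewrite eY; exact: m2.
  apply/(sortedP 0%N) => i; rewrite size_map size_iota => ipq.
  rewrite !(nth_map 0%N) ?size_iota ?(ltnW ipq) // !nth_iota ?(ltnW ipq) // !add0n.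
  by apply: (sorted_ltn_nth ltn_trans 0%N ltY); rewrite ?inE ?eY; [apply: m2; exact: ltnW|exact: m2|exact: m1].
have gz u v x : fits L p q x -> place Y (relabel u v x) = relabel (nth 0%N (z u v)) id (tail p x).
  move=> lx; rewrite /place (tail_relabel _ _ _ lx) relabel_comp; have /and3P[_ /allP h1 /allP h2] := fits_tail lx.
  apply: relabel_ext => i hi //=; rewrite (nth_map 0%N) ?size_iota ?h1 // nth_iota ?h1 //.
pose xs := [:: x1; x2; x3; x4; x5; x6].
have key j : (j < 5)%N -> f ((p + q)%N, map (tail p) xs, j) (z s t) = f ((p + q)%N, map (tail p) xs, j) (z s' t').
  move=> j5; have [|c hc] := hY ((p + q)%N, map (tail p) xs, j).
    apply/flattenP; exists [seq ((p + q)%N, xs, j) | xs <- lists 6 (terms L (p + q)), j <- iota 0 5].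
      by apply/mapP; exists (p + q)%N; rewrite // mem_iota /= add0n ltnS leq_add.
    apply: allpairs_f; last by rewrite mem_iota.
    apply: (@lists_mem _ _ (map (tail p) xs)); rewrite all_map; apply: sub_all hl => x lx /=.
    by rewrite terms_fits; exact: fits_tail.
  have [s1 e1] := zP s t ms mt; have [s2 e2] := zP s' t' ms' mt'.
  by rewrite (hc _ s1 e1) (hc _ s2 e2).
move: (hl); rewrite /= !andbT => /and5P[l1 l2 l3 l4 /andP[l5 l6]].
rewrite {1 2}/obs /=; move: key; rewrite /f /g /= -!gz // => key.
apply: (@eq_from_nth _ true) => // j j5; have := key j j5; rewrite /obs /= => ->.
Qed.

End Index.

Local Open Scope ring_scope.

(** * General position *)

Section Separate.
Variable R : realFieldType.
Notation pt := (R * R)%type.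
Implicit Types (a b c d p : pt).

Definition form (w p : pt) := w.1 * p.1 + w.2 * p.2.

Definition separates w a b c d :=
  [/\ form w a < form w c, form w a < form w d, form w b < form w c & form w b < form w d].

Lemma separates_noncross w a b c d : separates w a b c d -> noncross a b c d.
Proof.
move=> [h1 h2 h3 h4] p [t [t01 ->]] [s [s01 e]].
have af : affine (form w) by move=> u x y; rewrite /form /=; ring.
have le01 (u : R) : 0 < u < 1 -> 0 <= u <= 1 by move=> /andP[/ltW-> /ltW->].
have : form w (mix t a b) < form w (mix s c d).
  by apply: (mix_lt af (le01 _ s01)); apply: (mix_gt af (le01 _ t01)).
by rewrite e ltxx.
Qed.

Lemma noncross_corner a b c : orient a b c != 0 -> noncross a b a c.
Proof.
move=> nz p /inseg_online o [t [/andP[t0 t1] e]]; move: o; rewrite e affine_orient orient_l mulr0 add0r.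
by move/eqP; rewrite mulf_eq0 (gt_eqF t0) (negbTE nz).
Qed.

Lemma noncrossC a b c d : noncross a b c d -> noncross c d a b.
Proof. by move=> h p h1 h2; exact: h h2 h1. Qed.

Lemma noncross_swap a b c d : noncross a b c d -> noncross a b d c.
Proof. by move=> h p h1 /insegC h2; exact: h h1 h2. Qed.

(* The separating line is parallel to the line through a and b. *)
Lemma separate_by_line a b c d : 0 < orient a b c * orient a b d -> exists w, separates w a b c d.
Proof.
move=> h; pose s := orient a b c; exists (- (b.2 - a.2) * s, (b.1 - a.1) * s).
have e p : form (- (b.2 - a.2) * s, (b.1 - a.1) * s) p =
  s * orient a b p + form (- (b.2 - a.2) * s, (b.1 - a.1) * s) a by rewrite /form /orient /=; ring.
have n : 0 < s * s.
  by rewrite -expr2 exprn_even_gt0 //=; apply/eqP => e'; move: h; rewrite -/s e' mul0r ltxx.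
have h' : 0 < s * orient a b d by [].
have := e d; have := e c; have := e b; rewrite orient_r -/s mulr0 add0r.
by move=> eb ec ed; split; rewrite ?ec ?ed ?eb; lra.
Qed.

Lemma separates_sym w a b c d : separates w a b c d -> exists w', separates w' c d a b.
Proof.
move=> [h1 h2 h3 h4]; exists (- w.1, - w.2); rewrite /separates /form /= in h1 h2 h3 h4 *.
by split; lra.
Qed.

Definition apart a b c d := [/\ noncross a b c d, [/\ a <> c, a <> d, b <> c & b <> d],
  ~ inseg a b c, ~ inseg a b d & ~ inseg c d a /\ ~ inseg c d b].

Lemma apart_sym a b c d : apart a b c d -> apart c d a b.
Proof.
move=> [h1 [h2 h3 h4 h5] h6 h7 [h8 h9]]; split=> //; first exact: noncrossC.
by split=> e; [apply: h2|apply: h4|apply: h3|apply: h5].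
Qed.

Lemma apart_swap a b c d : apart a b c d -> apart a b d c.
Proof.
move=> [h1 [h2 h3 h4 h5] h6 h7 [h8 h9]]; split=> //; first exact: noncross_swap.
by split=> /insegC.
Qed.

Lemma off_segment a b c u : a <> b -> c = mix u a b -> a <> c -> b <> c -> ~ inseg a b c -> u < 0 \/ 1 < u.
Proof.
move=> ab e ac bc n; case: (ltrgtP u 0) => [|u0|u0]; [by left| |by case: ac; rewrite e u0 mix0].
case: (ltrgtP u 1) => [u1| |u1]; [|by right|by case: bc; rewrite e u1 mix1].
by case: n; exists u; rewrite u0 u1.
Qed.

(* If all four points are collinear, a line perpendicular to theirs separates the
   segments. Otherwise a and b are on one side of the line through c and d. *)
Lemma separate_degenerate a b c d : a <> b -> c <> d -> apart a b c d -> orient a b c = 0 ->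
  (exists w, separates w a b c d) \/ (exists w, separates w c d a b).
Proof.
move=> ab cd [_ [ac ad bc bd] nc nd [na nb]] oc.
have [u eu] := online (introN eqP ab : a != b) oc.
have hu := off_segment ab eu ac bc nc.
have [od|od] := eqVneq (orient a b d) 0; last first.
  right; apply: separate_by_line.
  have e1 : orient c d a = u * orient a b d by rewrite eu /orient /mix /=; ring.
  have e2 : orient c d b = (u - 1) * orient a b d by rewrite eu /orient /mix /=; ring.
  rewrite e1 e2 mulrACA; apply: mulr_gt0; last by rewrite -expr2 exprn_even_gt0.
  by case: hu => hu; [rewrite nmulr_rgt0 //; lra|apply: mulr_gt0; lra].
have [v ev] := online (introN eqP ab : a != b) od.
have hv := off_segment ab ev ad bd nd.
have opp s t x y z z' : x <> y -> z = mix s x y -> z' = mix t x y -> s < 0 -> 1 < t -> inseg z z' x.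
  move=> _ -> -> s0 t1; exists (- s / (t - s)); split.
    have h : 0 < t - s by lra.
    by apply/andP; split; [apply: divr_gt0; lra|rewrite ltr_pdivrMr // mul1r; lra].
  rewrite mix_mix -{1}(mix0 x y); congr mix; field; apply/eqP; lra.
left; exists (if u < 0 then (a.1 - b.1, a.2 - b.2) else (b.1 - a.1, b.2 - a.2)).
have n : 0 < (b.1 - a.1) ^+ 2 + (b.2 - a.2) ^+ 2.
  case: (a) (b) ab => [a1 a2] [b1 b2] ab /=.
  rewrite lt_neqAle addr_ge0 ?sqr_ge0 // andbT eq_sym paddr_eq0 ?sqr_ge0 //.
  apply/negP => /andP[]; rewrite !sqrf_eq0 !subr_eq0 => /eqP e1 /eqP e2; apply: ab; by rewrite e1 e2.
set m := _ + _ in n.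
have same : (u < 0 /\ v < 0) \/ (1 < u /\ 1 < v).
  case: hu hv => hu [] hv; [by left| | |by right].
    by case: na; exact: opp eu ev hu hv.
  by case: na; apply: insegC; exact: opp ev eu hv hu.
case: same => -[h1 h2].
  rewrite h1 /separates eu ev /form /mix /=.
  have g1 : 0 < - u * m by apply: mulr_gt0 => //; lra.
  have g2 : 0 < - v * m by apply: mulr_gt0 => //; lra.
  by split; rewrite -subr_gt0; move: g1 g2 n; rewrite /m => g1 g2 n; lra.
have -> : (u < 0) = false by apply/negbTE; rewrite -leNgt; lra.
rewrite /separates eu ev /form /mix /=.
have g1 : 0 < (u - 1) * m by apply: mulr_gt0 => //; lra.
have g2 : 0 < (v - 1) * m by apply: mulr_gt0 => //; lra.
by split; rewrite -subr_gt0; move: g1 g2 n; rewrite /m => g1 g2 n; lra.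
Qed.

(** If neither segment has its ends on the same side of the line through the other,
then the segments cross or an endpoint is on the other line. Separation by a line,
unlike disjointness, visibly survives small perturbations. *)
Lemma separation a b c d : a <> b -> c <> d -> apart a b c d -> exists w, separates w a b c d.
Proof.
move=> ab cd h.
have sy (x y z t : pt) : (exists w, separates w x y z t) -> exists w, separates w z t x y.
  by move=> [w]; exact: separates_sym.
have ends (x y z t : pt) : (exists w, separates w x y z t) -> exists w, separates w x y t z.
  by move=> [w [h1 h2 h3 h4]]; exists w.
have both (x y z t : pt) : (exists w, separates w x y z t) \/ (exists w, separates w z t x y) -> exists w, separates w x y z t.
  by case=> //; exact: sy.
have [e1|n1] := eqVneq (orient a b c) 0; first exact/both/separate_degenerate.
have [e2|n2] := eqVneq (orient a b d) 0.
  apply/ends/both/separate_degenerate => //; [exact: nesym|exact: apart_swap].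
have [e3|n3] := eqVneq (orient c d a) 0.
  apply/sy/both/separate_degenerate => //; exact: apart_sym.
have [e4|n4] := eqVneq (orient c d b) 0.
  apply/sy/ends/both/separate_degenerate => //; [exact: nesym|exact/apart_swap/apart_sym].
case: (ltP 0 (orient a b c * orient a b d)) => [|le1]; first exact: separate_by_line.
case: (ltP 0 (orient c d a * orient c d b)) => [|le2]; first by move/separate_by_line/sy.
have lt x y : x != 0 -> y != 0 -> x * y <= 0 -> x * y < 0.
  by move=> nx ny; rewrite le_eqVlt mulf_eq0 (negbTE nx) (negbTE ny).
have [p [i1 i2]] : exists p, inseg a b p /\ inseg c d p.
  by apply: crossing_inseg => //; rewrite /crossing !ccw_sign // !lt.
by case: h => nc _ _ _ _; case: (nc p i1 i2).
Qed.

(** Properties of this kind are closed under finite conjunction ([small_all]), so that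
one perturbation meets all requirements. *)
Definition small (Q : R -> Prop) := exists2 e, 0 < e & forall x, 0 < x < e -> Q x.

Lemma small_and Q Q' : small Q -> small Q' -> small (fun x => Q x /\ Q' x).
Proof.
move=> [e e0 h] [e' e0' h']; exists (Num.min e e'); first by rewrite lt_min e0.
by move=> x /andP[x0]; rewrite lt_min => /andP[x1 x2]; split; [apply: h|apply: h']; rewrite x0.
Qed.

Lemma small_all (I : eqType) (s : seq I) (Q : I -> R -> Prop) : (forall i, i \in s -> small (Q i)) ->
  small (fun x => forall i, i \in s -> Q i x).
Proof.
elim: s => [|i s IH] h; first by exists 1.
have [|e e0 he] := small_and (h i (mem_head _ _)) (IH _); first by move=> j js; apply: h; rewrite inE js orbT.
by exists e => // x /he[h1 h2] j; rewrite inE => /orP[/eqP->|]; [|exact: h2].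
Qed.

Lemma small_impl (Q Q' : R -> Prop) : (forall x, 0 < x -> Q x -> Q' x) -> small Q -> small Q'.
Proof. by move=> h [e e0 he]; exists e => // x /andP[x0 xe]; apply: h => //; apply: he; rewrite x0. Qed.

Lemma small_linear (a b : R) : 0 < a -> small (fun x => 0 < a + x * b).
Proof.
move=> a0; have d : 0 < 1 + `|b| by have := normr_ge0 b; lra.
exists (a / (1 + `|b|)); first exact: divr_gt0.
move=> x /andP[x0]; rewrite ltr_pdivlMr // => h.
have : x * - `|b| <= x * b by rewrite ler_pM2l //; have := ler_norm (- b); rewrite normrN; lra.
lra.
Qed.

(* Near 0, the sign is that of the first nonzero coefficient. *)
Lemma small_quadratic (a b c : R) : c != 0 -> small (fun x => a + x * b + x ^+ 2 * c != 0).
Proof.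
have pos u v w : 0 < u -> small (fun x => 0 < u + x * v + x ^+ 2 * w).
  move=> u0; have [e e0 he] := @small_linear u (- (`|v| + `|w|)) u0.
  exists (Num.min e 1); first by rewrite lt_min e0 ltr01.
  move=> x /andP[x0]; rewrite lt_min => /andP[xe x1]; have := he x ltac:(by rewrite x0).
  have h1 : 0 <= x * (`|v| + v).
    by apply: mulr_ge0; [exact: ltW|have := ler_norm (- v); rewrite normrN; lra].
  have h2 : 0 <= x * (`|w| * (1 - x)).
    by apply: mulr_ge0; [exact: ltW|apply: mulr_ge0; [exact: normr_ge0|lra]].
  have h3 : 0 <= x * (x * (`|w| + w)).
    by do 2!(apply: mulr_ge0; first exact: ltW); have := ler_norm (- w); rewrite normrN; lra.
  by rewrite expr2; lra.
have nz u v w : u != 0 -> small (fun x => u + x * v + x ^+ 2 * w != 0).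
  case: (ltrgt0P u) => // u0 _; first by apply: small_impl (pos u v w u0) => x _ /gt_eqF ->.
  apply: small_impl (pos (- u) (- v) (- w) _); last by rewrite oppr_gt0.
  by move=> x _ h; apply/eqP => e; move: h; rewrite !mulrN -!opprD e oppr0 ltxx.
move=> nc; have [->|] := eqVneq a 0; last exact: nz.
have [->|nb] := eqVneq b 0.
  exists 1 => // x /andP[x0 _]; rewrite mulr0 !add0r mulf_neq0 // expf_neq0 // gt_eqF //.
apply: small_impl (nz b c 0 nb) => x x0 h.
rewrite add0r (_ : x * b + x ^+ 2 * c = x * (b + x * c + x ^+ 2 * 0)); last by ring.
by rewrite mulf_neq0 // gt_eqF.
Qed.

End Separate.

(** * The graph *)

Section TermGraph.
Variable (L N : nat).
Notation V := (seq_sub (terms L N)).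

Definition term_adj (x y : V) := child (val x) (val y) || child (val y) (val x).

Lemma term_adj_sym : symmetric term_adj. Proof. by move=> x y; exact: orbC. Qed.

Lemma term_adj_irrefl : irreflexive term_adj.
Proof. by move=> x; rewrite /term_adj orbb; apply/negP => /child_depth; rewrite ltnn. Qed.

Definition term_graph : sgraph := SGraph term_adj_sym term_adj_irrefl.

(** A deepest vertex of a subgraph has no neighbours in it but its subterms. *)
Lemma term_graph_degenerate : degenerate term_graph 2.
Proof.
move=> X F [FE FX] /set0Pn[x0 hx0].
pose v := [arg max_(x > x0 | x \in X) depth (val (x : V))]%N.
have [hv maxv] : v \in X /\ (forall x : term_graph, x \in X -> depth (val (x : V)) <= depth (val (v : V)))%N.
  by rewrite /v; case: arg_maxnP => // i hi h; split=> // x /h.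
exists v => //; rewrite /degree_in.
pose C := [set w : term_graph | child (val (v : V)) (val (w : V))].
have sub : [set E in F | v \in E] \subset [set [set v; w] | w in C].
  apply/subsetP => E; rewrite inE => /andP[hE vE].
  have /(subsetP FE) := hE; rewrite inE => /existsP[x /existsP[y /andP[xy /eqP eE]]].
  have /subsetP sE := FX E hE.
  have [w ew vw] : exists2 w, E = [set v; w] & term_adj v w.
    move: vE; rewrite eE !inE => /orP[]/eqP ->; first by exists y.
    by exists x; [rewrite setUC|rewrite term_adj_sym].
  apply/imsetP; exists w => //; rewrite inE; case/orP: vw => // /child_depth.
  by rewrite ltnNge maxv // sE // ew !inE eqxx orbT.
apply: leq_trans (subset_leq_card sub) _; apply: leq_trans (leq_imset_card _ _) _.
rewrite cardE; have u : uniq [seq val (w : V) | w <- enum C] by rewrite map_inj_uniq ?enum_uniq //; exact: val_inj.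
rewrite -(size_map (fun w : V => val w)); case e : (val (v : V)) => [b i|a b].
  by rewrite (_ : enum C = [::]) //; apply/eqP; rewrite -size_eq0 -cardE cards_eq0; apply/eqP/setP => w; rewrite !inE e.
apply: (@leq_trans (size [:: a; b])) => //; apply: uniq_leq_size => // z /mapP[w].
by rewrite mem_enum inE e /= => h ->; rewrite !inE.
Qed.

End TermGraph.

Section Drawing.
Variables (R : realType) (L N : nat).
Notation G := (term_graph L N).
Notation V := (seq_sub (terms L N)).
Notation pt := (R * R)%type.
Variables (pos : G -> 'rV[R]_2) (c : {set G} -> nat).
Hypotheses (geo : geometric_drawing pos) (col : edge_coloring 2 c) (nmc : no_monochromatic_crossing pos c).

Let vert (x : term) (h : x \in terms L N) : G := SeqSub h.

Let Q (x : term) : pt := if insub x is Some v then (pos (v : V) ord0 ord0, pos (v : V) ord0 ord_max) else (0, 0).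
Let r (x : term) : R := (index x (terms L N))%:R.
Let k (x y : term) : bool := if (insub x, insub y) is (Some u, Some v) then c [set (u : V); (v : V)] == 0%N else true.
Let P e x : pt := ((Q x).1 + e * r x, (Q x).2 + e * r x ^+ 2).

Let QE x (h : x \in terms L N) : Q x = (pos (vert h) ord0 ord0, pos (vert h) ord0 ord_max).
Proof. by rewrite /Q insubT. Qed.

Let row_eq (u v : 'rV[R]_2) : u ord0 ord0 = v ord0 ord0 -> u ord0 ord_max = v ord0 ord_max -> u = v.
Proof.
move=> h1 h2; apply/rowP => j; case: j => [[|[|j]] hj] //.
  by rewrite (_ : Ordinal hj = ord0) //; exact: val_inj.
by rewrite (_ : Ordinal hj = ord_max) //; exact: val_inj.
Qed.

Let Q_inj x y : x \in terms L N -> y \in terms L N -> Q x = Q y -> x = y.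
Proof.
move=> hx hy; rewrite (QE hx) (QE hy) => -[e1 e2].
by have := geo.1 _ _ (row_eq e1 e2); move/(congr1 (fun v : V => val v)).
Qed.

Let mix_interior x y p (hx : x \in terms L N) (hy : y \in terms L N) : inseg (Q x) (Q y) p ->
  exists2 q : 'rV[R]_2, p = (q ord0 ord0, q ord0 ord_max) & edge_interior pos [set vert hx; vert hy] q.
Proof.
move=> [t [t01 ->]]; exists ((1 - t) *: pos (vert hx) + t *: pos (vert hy)).
  by rewrite (QE hx) (QE hy) !mxE.
by exists (vert hx), (vert hy), t.
Qed.

Let edge_in x y (hx : x \in terms L N) (hy : y \in terms L N) : child x y -> [set vert hx; vert hy] \in edges G.
Proof.
by move=> h; rewrite inE; apply/existsP; exists (vert hx); apply/existsP; exists (vert hy); rewrite /= /term_adj /= h eqxx.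
Qed.

Let off_edge x y z : x \in terms L N -> y \in terms L N -> z \in terms L N -> child x y -> ~ inseg (Q x) (Q y) (Q z).
Proof.
move=> hx hy hz cxy /(mix_interior hx hy)[q e i]; apply: (geo.2 _ (edge_in hx hy cxy) (vert hz)).
rewrite (_ : pos (vert hz) = q) //; move: e; rewrite (QE hz) => -[e1 e2]; exact: row_eq.
Qed.

Let Q_noncross x y x' y' : x \in terms L N -> y \in terms L N -> x' \in terms L N -> y' \in terms L N ->
  child x y -> child x' y' -> (x, y) != (x', y') -> k x y = k x' y' -> noncross (Q x) (Q y) (Q x') (Q y').
Proof.
move=> hx hy hx' hy' h h' ne ek p /(mix_interior hx hy)[q e i] /(mix_interior hx' hy')[q' e' i'].
have eq : q = q' by move: e'; rewrite e => -[e1 e2]; exact: row_eq.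
have hE := edge_in hx hy h; have hE' := edge_in hx' hy' h'.
apply: (nmc hE hE').
  split; last by exists q; split=> //; rewrite eq.
  move=> eE; have d := child_depth h; have d' := child_depth h'.
  have vi a b (ha : a \in terms L N) (hb : b \in terms L N) : vert ha = vert hb -> a = b.
    by move/(congr1 (fun v : V => val v)).
  have mx : vert hx \in [set vert hx'; vert hy'] by rewrite -eE !inE eqxx.
  have my : vert hy \in [set vert hx'; vert hy'] by rewrite -eE !inE eqxx orbT.
  case/set2P: mx => /vi ex; case/set2P: my => /vi ey.
  - by move: d; rewrite ex ey ltnn.
  - by rewrite ex ey eqxx in ne.
  - by move: d d'; rewrite ex ey => a /(ltn_trans a); rewrite ltnn.
  by move: d; rewrite ex ey ltnn.
move: ek (col hE) (col hE'); rewrite /k !insubT /=.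
by do 2!case: (c _) => [|[|//]] /=.
Qed.

Let orient_P e x y z : orient (P e x) (P e y) (P e z) = orient (Q x) (Q y) (Q z) +
  e * (((Q y).1 - (Q x).1) * (r z ^+ 2 - r x ^+ 2) + (r y - r x) * ((Q z).2 - (Q x).2)
     - (((Q y).2 - (Q x).2) * (r z - r x) + (r y ^+ 2 - r x ^+ 2) * ((Q z).1 - (Q x).1))) +
  e ^+ 2 * ((r y - r x) * (r z - r x) * (r z - r y)).
Proof. by rewrite /orient /P /=; ring. Qed.

Let r_inj x y : x \in terms L N -> y \in terms L N -> r x = r y -> x = y.
Proof. by move=> hx hy /eqP; rewrite /r eqr_nat => /eqP; exact: index_inj. Qed.

(** The vertex number r is moved by e (r, r^2). In an orientation the coefficient of
e^2 is a Vandermonde determinant, so that for small e the points are in general position.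
Disjoint edges of one colour are separated by a line, also for small e, and edges
with a common end do not meet otherwise by general position. *)
Lemma perturbed : exists e, drawing1 L N (P e) k.
Proof.
pose ts := terms L N.
pose gen (i : term * term * term) e := i.1.1 != i.1.2 -> i.1.2 != i.2 -> i.1.1 != i.2 ->
  orient (P e i.1.1) (P e i.1.2) (P e i.2) != 0.
pose dis (i : term * term * term * term) e := let: (x, y, x', y') := i in
  child x y -> child x' y' -> uniq [:: x; y; x'; y'] -> k x y = k x' y' -> noncross (P e x) (P e y) (P e x') (P e y').
have sg : small (fun e => forall i, i \in [seq (a, b) | a <- [seq (a, b) | a <- ts, b <- ts], b <- ts] -> gen i e).
  apply: small_all => i /allpairsP[[[x' y'] z] /= [/allpairsP[[x y] /= [hx hy [-> ->]]] hz ->]].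
  rewrite /gen /=; case: (boolP [&& x != y, y != z & x != z]) => [/and3P[xy yz xz]|nn]; last first.
    by exists 1 => // e _ h1 h2 h3; move: nn; rewrite h1 h2 h3.
  apply: small_impl (small_quadratic _ _ _) => [e e0 h _ _ _|]; first by rewrite orient_P; exact: h.
  have nr a b : a \in ts -> b \in ts -> a != b -> r b - r a != 0.
    by move=> ha hb; apply: contraNneq => /subr0_eq/(r_inj hb ha) ->.
  by rewrite !mulf_neq0 ?nr.
have sd : small (fun e => forall i, i \in [seq (a, b) | a <- [seq (a, b) | a <- [seq (a, b) | a <- ts, b <- ts], b <- ts], b <- ts] -> dis i e).
  apply: small_all => i /allpairsP[[[[x1 y1] x1'] y'] /= [/allpairsP[[[x2 y2] x'] /= [/allpairsP[[x y] /= [hx hy [-> ->]]] hx' [-> -> ->]]] hy' ->]].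
  rewrite /dis; case: (boolP [&& child x y, child x' y', uniq [:: x; y; x'; y'] & k x y == k x' y']) => [|nn]; last first.
    by exists 1 => // e _ h1 h2 h3 h4; move: nn; rewrite h1 h2 h3 h4 eqxx.
  move=> /and4P[h h' u /eqP ek]; have ne : (x, y) != (x', y').
    by move: u; rewrite /= !inE !negb_or xpair_eqE => /and4P[/and3P[_ /negbTE->]].
  have qn a b : a \in ts -> b \in ts -> a != b -> Q a <> Q b.
    by move=> ha hb ab /(Q_inj ha hb) e; rewrite e eqxx in ab.
  move: (u); rewrite /= !inE !negb_or => /and4P[/and3P[n1 n2 n3] /andP[n4 n5] n6 _].
  have ap : apart (Q x) (Q y) (Q x') (Q y').
    split; [exact: Q_noncross| |exact: off_edge|exact: off_edge|split; exact: off_edge].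
    by split; exact: qn.
  have [w [w1 w2 w3 w4]] := separation (qn _ _ hx hy n1) (qn _ _ hx' hy' n6) ap.
  have lin a b : form w (Q a) < form w (Q b) -> small (fun e => form w (P e a) < form w (P e b)).
    move=> lt; have := small_linear ((w.1 * r b + w.2 * r b ^+ 2) - (w.1 * r a + w.2 * r a ^+ 2)) (_ : 0 < form w (Q b) - form w (Q a)).
    rewrite subr_gt0 => /(_ lt); apply: small_impl => e e0 he; rewrite -subr_gt0.
    rewrite (_ : _ - _ = form w (Q b) - form w (Q a) + e * ((w.1 * r b + w.2 * r b ^+ 2) - (w.1 * r a + w.2 * r a ^+ 2))) //.
    by rewrite /form /P /=; ring.
  apply: small_impl (small_and (small_and (lin _ _ w1) (lin _ _ w2)) (small_and (lin _ _ w3) (lin _ _ w4))).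
  by move=> e _ [[s1 s2] [s3 s4]] _ _ _ _; apply: (@separates_noncross _ w).
have [e0 he0 he] := small_and sg sd; exists (e0 / 2).
have {he} [hg hd] := he (e0 / 2) ltac:(by apply/andP; split; lra).
have gp x y z : fits L N 0 x -> fits L N 0 y -> fits L N 0 z -> x != y -> y != z -> x != z ->
    orient (P (e0 / 2) x) (P (e0 / 2) y) (P (e0 / 2) z) != 0.
  rewrite -!terms_fits => hx hy hz; apply: (hg ((x, y), z)).
  by apply: allpairs_f => //; exact: allpairs_f.
split=> // x y x' y' lx lx' h h' ne ek.
have ly := fits_child lx h; have ly' := fits_child lx' h'.
have xy : x != y by apply: contraTneq (child_depth h) => ->; rewrite ltnn.
have xy' : x' != y' by apply: contraTneq (child_depth h') => ->; rewrite ltnn.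
have corner a b d : fits L N 0 a -> fits L N 0 b -> fits L N 0 d -> a != b -> a != d -> b != d ->
    noncross (P (e0 / 2) a) (P (e0 / 2) b) (P (e0 / 2) a) (P (e0 / 2) d).
  by move=> la lb ld ab ad bd; apply: noncross_corner; exact: gp.
have sl a b a' b' : noncross (P (e0 / 2) a) (P (e0 / 2) b) (P (e0 / 2) a') (P (e0 / 2) b') ->
    noncross (P (e0 / 2) b) (P (e0 / 2) a) (P (e0 / 2) a') (P (e0 / 2) b').
  by move/noncrossC/noncross_swap/noncrossC.
have [exx|nxx] := eqVneq x x'.
  rewrite -exx in ne lx' ly' h' xy' ek *; apply: corner => //.
  by apply: contraNneq ne => ->.
have [eyy|nyy] := eqVneq y y'.
  rewrite -eyy in ne lx' ly' h' xy' ek *; apply/sl/noncross_swap/corner => //; by rewrite eq_sym.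
have [exy|nxy] := eqVneq x y'.
  rewrite -exy in ne lx' ly' h' xy' ek *; apply/noncross_swap/corner => //; rewrite eq_sym //.
  by apply: contraTneq (ltn_trans (child_depth h) (child_depth h')) => ->; rewrite ltnn.
have [eyx|nyx] := eqVneq y x'.
  rewrite -eyx in ne lx' ly' h' xy' ek *; apply/sl/corner => //; first by rewrite eq_sym.
apply: (hd (((x, y), x'), y')) => //.
  by do 3!(apply: allpairs_f; last by rewrite terms_fits); rewrite terms_fits.
by rewrite /= !inE !negb_or xy nxx nxy nyx nyy xy'.
Qed.

End Drawing.

Theorem theorem2 (R : realType) :
  exists G : sgraph,
    [/\ degenerate G 2,
        (geometric_arboricity R G >= geometric_thickness R G)%N
      & (geometric_thickness R G >= 3)%N].
Proof.
have [N hN] := homogeneous_drawing R 7 15 64.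
exists (term_graph 7 N); split; first exact: term_graph_degenerate.
  rewrite /geometric_arboricity /geometric_thickness.
  case: (ex_minnP (ex_arboricity_colorable _ _)) => a /asboolP[pos [c [h1 h2 h3 _]]] _.
  by case: ex_minnP => t _; apply; apply/asboolP; exists pos, c.
rewrite /geometric_thickness; case: ex_minnP => t /asboolP[pos [c [h1 h2 h3]]] _.
rewrite ltnNge; apply/negP => t2.
have h2' : edge_coloring 2 c by move=> E hE; exact: leq_trans (h2 E hE) t2.
have [e De] := perturbed h1 h2' h3; have [P' [k' [D U]]] := hN _ _ De.
exact: (@no_uniform_drawing R 7 15 60 isT isT isT isT isT isT P' k' D U).
Qed.
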